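(* Let $n\ge1$ and let $\lambda$ and $\mu$ be two bipartitions of $n$. Then $$[\mathcal{P}_{\tau_n(\lambda)}^{\mathbb{Q}}:\mathcal{D}_{\tau_n(\mu)}^{\mathbb{Q}}]=[\mathcal{P}_\lambda^{\mathbb{Q}}:\mathcal{D}_\mu^{\mathbb{Q}}],$$ where the left-hand side is a Cartan invariant of $\mathbb{Q}\Sigma'(W_{n+1})$ and the right-hand side a Cartan invariant of $\mathbb{Q}\Sigma'(W_n)$.
   Context: $W_n$ is the group of permutations $\sigma$ of $I_n=\{\pm1,\dots,\pm n\}$ with $\sigma(-i)=-\sigma(i)$. It acts on $\mathbb{R}^n$ (canonical basis $e_1,\dots,e_n$, $e_{-i}=-e_i$) by $\sigma(e_i)=e_{\sigma(i)}$, and is the Weyl group of $\Phi_n=\{\pm 2e_i\}\cup\{\pm e_i\pm e_j : i<j\}$ with basis $\{2e_1,e_2-e_1,\dots,e_n-e_{n-1}\}$; $\Phi_n^+$ is the set of positive roots, and $\alpha>0$ means $\alpha\in\Phi_n^+$. For a root $\alpha$, $s_\alpha\in W_n$ is the reflection in $\alpha$. A signed composition of $n$ is a finite sequence $C=(c_1,\dots,c_r)$ of non-zero integers with $\sum|c_i|=n$; $\mathrm{Comp}(n)$ is the set of these. Let $I_{C,+}^{(i)}=\{k\in\mathbb{N}: |c_1|+\dots+|c_{i-1}|+1\le k\le |c_1|+\dots+|c_i|\}$, $I_C^{(i)}=I_{C,+}^{(i)}$ if $c_i<0$ and $I_C^{(i)}=I_{C,+}^{(i)}\cup -I_{C,+}^{(i)}$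 if $c_i>0$, and $W_C=\{w\in W_n : w(I_C^{(i)})=I_C^{(i)}\ \forall i\}$. Let $\Phi_C=\{\alpha\in\Phi_n: s_\alpha\in W_C\}$, $\Phi_C^+=\Phi_C\cap\Phi_n^+$, $\Delta_C$ the basis of $\Phi_C$ contained in $\Phi_C^+$, $X_C=\{w\in W_n: w(\alpha)>0\ \forall\alpha\in\Phi_C^+\}$ and $x_C=\sum_{w\in X_C}w$. The $x_C$ are linearly independent and $\mathbb{Q}\Sigma'(W_n)=\bigoplus_{C}\mathbb{Q}x_C$ is a unital subalgebra of $\mathbb{Q}W_n$ (Mantaci-Reutenauer algebra). A bipartition of $n$ is a pair $\lambda=(\lambda^+,\lambda^-)$ of partitions with $|\lambda^+|+|\lambda^-|=n$; $\mathrm{Bip}(n)$ is the set of these. The map $\tau_n:\mathrm{Bip}(n)\to\mathrm{Bip}(n+1)$ sends $(\lambda^+,\lambda^-)$ to $(\lambda^+,\lambda^-\cup\{1\})$, i.e. it adds one part equal to $1$ to $\lambda^-$. For $C\in\mathrm{Comp}(n)$, $\boldsymbol{\lambda}(C)=(\lambda^+,\lambda^-)$ where $\lambda^+$ (resp. $\lambda^-$) consists of the positive parts (resp. absolute values of the negative parts) of $C$. For $\lambda\in\mathrm{Bip}(n)$, $\mathrm{cox}_\lambda$ is a Coxeter element of $W_C$ (product, in some order, of the $s_\alpha$, $\alpha\in\Delta_C$) for any $C$ with $\boldsymbol{\lambda}(C)=\lambda$; its $W_n$-conjugacy class depends only on $\lambda$. $\mathcal{D}_\lambda^{\mathbb{Q}}$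 is the one-dimensional left $\mathbb{Q}\Sigma'(W_n)$-module on which $\mathbb{Q}\Sigma'(W_n)$ acts via the algebra morphism $\pi_\lambda^{\mathbb{Q}}:x_C\mapsto(\mathrm{Ind}_{W_C}^{W_n}1)(\mathrm{cox}_\lambda)$; the $\mathcal{D}_\lambda^{\mathbb{Q}}$ ($\lambda\in\mathrm{Bip}(n)$) are representatives of the isomorphism classes of simple modules. $\mathcal{P}_\lambda^{\mathbb{Q}}$ is the projective cover of $\mathcal{D}_\lambda^{\mathbb{Q}}$, and $[\mathcal{P}_\lambda^{\mathbb{Q}}:\mathcal{D}_\mu^{\mathbb{Q}}]$ is the multiplicity of $\mathcal{D}_\mu^{\mathbb{Q}}$ as a composition factor of $\mathcal{P}_\lambda^{\mathbb{Q}}$. The same notation is used for $n+1$ in place of $n$. *)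

(* Defs.v *)
From HB Require Import structures.
From mathcomp Require Import all_boot all_order all_algebra all_fingroup all_field all_character.
From mathcomp Require Import boolp.
From mathcomp Require classical_sets.
Set Implicit Arguments.
Unset Strict Implicit.
Unset Printing Implicit Defensive.
Import Order.TTheory GRing.Theory Num.Theory.
Local Open Scope ring_scope.

Definition galg (K : fieldType) (gT : finGroupType) := {ffun gT -> K^o}.

Section GroupAlgebra.
Variables (K : fieldType) (gT : finGroupType).
Local Notation A := (galg K gT).
Implicit Types f g h : A.

HB.instance Definition _ := Vector.copy A {ffun gT -> K^o}.

Definition gbasis (w : gT) : A := [ffun x => (x == w)%:R].

Definition galg_mul f g : A :=
  [ffun x => \sum_(u : gT) f u * g (u^-1 * x)%g].

Fact galg_mulA : associative galg_mul.
Proof.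
move=> f g h; apply/ffunP=> x; rewrite !ffunE.
under [RHS]eq_bigr => w _ do rewrite ffunE mulr_suml.
rewrite exchange_big /=; apply: eq_bigr => u _.
rewrite ffunE mulr_sumr (reindex_inj (mulgI u^-1%g)) /=.
by apply: eq_bigr => w _; rewrite mulrA invMg invgK -mulgA mulKVg.
Qed.

Fact galg_mul1l : left_id (gbasis 1) galg_mul.
Proof.
move=> f; apply/ffunP=> x; rewrite ffunE (bigD1 1%g) //= ffunE eqxx mul1r.
rewrite invg1 mul1g big1 ?addr0 // => u /negbTE ne.
by rewrite ffunE ne mul0r.
Qed.

Fact galg_mul1r : right_id (gbasis 1) galg_mul.
Proof.
move=> f; apply/ffunP=> x; rewrite ffunE (bigD1 x) //= ffunE mulVg eqxx mulr1.
rewrite big1 ?addr0 // => u ne; rewrite ffunE.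
by rewrite -eq_mulVg1 (negbTE ne) mulr0.
Qed.

Fact galg_mulDl : left_distributive galg_mul +%R.
Proof.
move=> f g h; apply/ffunP=> x; rewrite !ffunE -big_split.
by apply: eq_bigr => u _; rewrite ffunE mulrDl.
Qed.

Fact galg_mulDr : right_distributive galg_mul +%R.
Proof.
move=> f g h; apply/ffunP=> x; rewrite !ffunE -big_split.
by apply: eq_bigr => u _; rewrite ffunE mulrDr.
Qed.

Fact galg_1_neq0 : gbasis 1 != 0.
Proof.
by apply/eqP=> /ffunP/(_ 1%g)/eqP; rewrite !ffunE eqxx oner_eq0.
Qed.

HB.instance Definition _ := GRing.Zmodule_isNzRing.Build A
  galg_mulA galg_mul1l galg_mul1r galg_mulDl galg_mulDr galg_1_neq0.

Fact galg_scaleAl (a : K) f g : a *: (f * g) = (a *: f) * g.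
Proof.
apply/ffunP=> x; rewrite !ffunE scaler_sumr; apply: eq_bigr => u _.
by rewrite ffunE -scalerAl.
Qed.

HB.instance Definition _ := GRing.Lmodule_isLalgebra.Build K A galg_scaleAl.

Fact galg_scaleAr (a : K) f g : a *: (f * g) = f * (a *: g).
Proof.
apply/ffunP=> x; rewrite !ffunE scaler_sumr; apply: eq_bigr => u _.
by rewrite ffunE -scalerAr.
Qed.

HB.instance Definition _ := GRing.Lalgebra_isAlgebra.Build K A galg_scaleAr.
HB.instance Definition _ := Algebra_isFalgebra.Build K A.

End GroupAlgebra.

(* Finite-dimensional left modules over a unital subalgebra of [aT], which is
   given by its underlying subspace [A].  A module is a vector space [V] with
   [r : 'Hom(aT, 'End(V))], of which only the restriction to [A] is relevant;
   elements of 'End(V) compose as functions, so these are left modules. *)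
Section Modules.
Variables (K : fieldType) (aT : falgType K) (A : {vspace aT}).

Definition is_module (V : vectType K) (r : 'Hom(aT, 'End(V))) : Prop :=
  r 1 = \1%VF /\ {in A &, forall a b, r (a * b) = (r a \o r b)%VF}.

Definition is_modhom (V1 V2 : vectType K) (r1 : 'Hom(aT, 'End(V1)))
    (r2 : 'Hom(aT, 'End(V2))) (f : 'Hom(V1, V2)) : Prop :=
  {in A, forall a v, f (r1 a v) = r2 a (f v)}.

Definition is_submodule (V : vectType K) (r : 'Hom(aT, 'End(V)))
    (U : {vspace V}) : Prop :=
  {in A, forall a, (r a @: U <= U)%VS}.

Definition is_projective (P : vectType K) (r : 'Hom(aT, 'End(P))) : Prop :=
  is_module r /\
  forall (V1 V2 : vectType K)
    (r1 : 'Hom(aT, 'End(V1))) (r2 : 'Hom(aT, 'End(V2)))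
    (p : 'Hom(V1, V2)) (g : 'Hom(P, V2)),
  is_module r1 -> is_module r2 ->
  is_modhom r1 r2 p -> limg p = fullv -> is_modhom r r2 g ->
  exists2 h : 'Hom(P, V1), is_modhom r r1 h & (p \o h)%VF = g.

Definition is_projective_cover (P D : vectType K) (r : 'Hom(aT, 'End(P)))
    (d : 'Hom(aT, 'End(D))) : Prop :=
  is_projective r /\
  exists p : 'Hom(P, D),
    [/\ is_modhom r d p, limg p = fullv &
        forall U : {vspace P}, is_submodule r U ->
          (U + lker p)%VS = fullv -> U = fullv].

(* [U] and [U'] are submodules with [U] included in [U'] and [U' / U] simple *)
Definition simple_factor (V : vectType K) (r : 'Hom(aT, 'End(V)))
    (U U' : {vspace V}) : Prop :=
  [/\ is_submodule r U, is_submodule r U', (U <= U')%VS, U <> U' &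
      forall T : {vspace V}, is_submodule r T ->
        (U <= T)%VS -> (T <= U')%VS -> T = U \/ T = U'].

(* the quotient [U' / U] is isomorphic to [D], by a morphism from [U'] onto
   [D] with kernel [U]; the values of [f] outside [U'] are irrelevant *)
Definition factor_isom (V D : vectType K) (r : 'Hom(aT, 'End(V)))
    (d : 'Hom(aT, 'End(D))) (U U' : {vspace V}) : Prop :=
  exists f : 'Hom(V, D),
    [/\ {in A & U', forall a v, f (r a v) = d a (f v)},
        (f @: U')%VS = fullv & (U' :&: lker f)%VS = U].

Definition is_composition_series (V : vectType K) (r : 'Hom(aT, 'End(V)))
    (k : nat) (U : nat -> {vspace V}) : Prop :=
  [/\ U 0%N = 0%VS, U k = fullv &
      forall i, (i < k)%N -> simple_factor r (U i) (U i.+1)].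

(* number of factors isomorphic to [D] in some composition series of [V]; by
   the Jordan-Hoelder theorem the choice of the series is immaterial *)
Definition multiplicity (V D : vectType K) (r : 'Hom(aT, 'End(V)))
    (d : 'Hom(aT, 'End(D))) : nat :=
  classical_sets.xget 0%N (fun m : nat =>
    exists k U, is_composition_series r k U /\
      m = #|[set i : 'I_k | `[< factor_isom r d (U i) (U i.+1) >]]|).

End Modules.

(* I_n: (i, false) stands for i + 1 and (i, true) for -(i + 1) *)
Definition sidx (n : nat) : finType := ('I_n * bool)%type.
Definition sopp n (x : sidx n) : sidx n := (x.1, ~~ x.2).

Definition is_signed n (s : {perm sidx n}) : bool :=
  [forall x, s (sopp x) == sopp (s x)].

(* The group law on [W n] is composition of functions, (u * v) x = u (v x),
   the opposite of the law of {perm sidx n}. *)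
Definition W (n : nat) := {s : {perm sidx n} | is_signed s}.

Section SignedPermutations.
Variable n : nat.

HB.instance Definition _ := Finite.on (W n).

Definition Wapp (w : W n) (x : sidx n) : sidx n := val w x.

Fact W_one_subproof : is_signed (1%g : {perm sidx n}).
Proof. by apply/forallP=> x; rewrite !perm1. Qed.

Fact W_mul_subproof (u v : W n) : is_signed (val v * val u)%g.
Proof.
apply/forallP=> x; rewrite !permM.
by rewrite (eqP (forallP (valP v) x)) (eqP (forallP (valP u) _)).
Qed.

Fact W_inv_subproof (u : W n) : is_signed (val u)^-1%g.
Proof.
apply/forallP=> x; apply/eqP/(@perm_inj _ (val u)).
by rewrite permKV (eqP (forallP (valP u) _)) permKV.
Qed.

Definition W_one : W n := exist (fun s => is_true (is_signed s)) _ W_one_subproof.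
Definition W_mul (u v : W n) : W n := exist (fun s => is_true (is_signed s)) _ (W_mul_subproof u v).
Definition W_inv (u : W n) : W n := exist (fun s => is_true (is_signed s)) _ (W_inv_subproof u).

Fact W_mulA : associative W_mul.
Proof. by move=> u v w; apply/val_inj; rewrite /= mulgA. Qed.
Fact W_mul1 : left_id W_one W_mul.
Proof. by move=> u; apply/val_inj; rewrite /= mulg1. Qed.
Fact W_mulV : left_inverse W_one W_inv W_mul.
Proof. by move=> u; apply/val_inj; rewrite /= mulgV. Qed.

HB.instance Definition _ := Finite_isGroup.Build (W n) W_mulA W_mul1 W_mulV.

Lemma WappM (u v : W n) x : Wapp (u * v)%g x = Wapp u (Wapp v x).
Proof. by rewrite /Wapp /= permM. Qed.

Lemma Wapp1 x : Wapp 1%g x = x.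
Proof. by rewrite /Wapp /= perm1. Qed.

End SignedPermutations.

(* Roots have integer coordinates, so the reflection representation is taken
   over the rational numbers. *)
Section Roots.
Variable n : nat.
Local Notation vec := 'rV[rat]_n.

Definition evec (x : sidx n) : vec := (-1) ^+ x.2 *: delta_mx 0 x.1.

Definition Wact (w : W n) (v : vec) : vec :=
  \sum_(i < n) v 0 i *: evec (Wapp w (i, false)).

Definition dotp (u v : vec) : rat := \sum_(i < n) u 0 i * v 0 i.

Definition is_root (a : vec) : Prop :=
  (exists x : sidx n, a = 2 *: evec x) \/
  (exists x y : sidx n, (x.1 < y.1)%N /\ a = evec x + evec y).

(* for i != 0, [ord_pred i] is i - 1 *)
Definition simple_root (i : 'I_n) : vec :=
  if i == 0 :> nat then 2 *: evec (i, false)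
  else evec (i, false) - evec (ord_pred i, false).

Definition is_pos_root (a : vec) : Prop :=
  is_root a /\
  exists c : 'I_n -> nat, a = \sum_(i < n) simple_root i *+ c i.

Definition is_reflection (a : vec) (w : W n) : Prop :=
  forall v, Wact w v = v - (2 * dotp v a / dotp a a) *: a.

(* meaningful when [a] is a root *)
Definition refl (a : vec) : W n :=
  odflt 1%g [pick w | `[< is_reflection a w >]].

End Roots.

Definition is_scomp (n : nat) (c : seq int) : bool :=
  all (fun x => x != 0) c && (\sum_(x <- c) `|x|%N == n)%N.

(* Comp(n) *)
Definition scomp (n : nat) := {c : seq int | is_scomp n c}.

Section SignedCompositionsFinite.
Variable n : nat.

Let code (x : int) : 'I_n.+1 * bool := (inord `|x|%N, x < 0).
Let decode (p : 'I_n.+1 * bool) : int := (-1) ^+ p.2 * (p.1 : nat)%:Z.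

Fact scomp_size (c : scomp n) : (size (map code (val c)) <= n)%N.
Proof.
rewrite size_map; case: c => c /= /andP[nz /eqP <-].
elim: c nz => [|x c IH] /=; first by rewrite big_nil.
case/andP=> x0 /IH le; rewrite big_cons -add1n leq_add //.
by rewrite absz_gt0.
Qed.

Let enc (c : scomp n) : n.-bseq ('I_n.+1 * bool) := Bseq (scomp_size c).
Let dec (b : n.-bseq ('I_n.+1 * bool)) : option (scomp n) :=
  insub (map decode b).

Fact scomp_encK : pcancel enc dec.
Proof.
move=> c; rewrite /dec /= -map_comp map_id_in; first exact: valK.
move=> x xc; rewrite /decode /code /= inordK; first by rewrite -intEsign.
have /andP[_ /eqP <-] := valP c.
by rewrite ltnS (big_rem x) //= leq_addr.
Qed.

HB.instance Definition _ := Finite.copy (scomp n) (pcan_type scomp_encK).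

End SignedCompositionsFinite.

Section Parabolic.
Variables (n : nat) (C : scomp n).

(* I_C^(i), with i counted from 0 *)
Definition block (i : nat) : {set sidx n} :=
  let sum_to j := (\sum_(c <- take j (val C)) `|c|%N)%N in
  [set x : sidx n | [&& (sum_to i < x.1.+1)%N, (x.1.+1 <= sum_to i.+1)%N
                      & x.2 ==> (0 < (val C)`_i)]].

Definition WC_set : {set W n} :=
  [set w | [forall i : 'I_(size (val C)), Wapp w @: block i == block i]].

Fact WC_group_set : group_set WC_set.
Proof.
apply/group_setP; split=> [|u v].
  rewrite inE; apply/forallP=> i; apply/eqP; rewrite -[RHS]imset_id.
  by apply: eq_imset => x; rewrite Wapp1.
rewrite !inE => /forallP hu /forallP hv; apply/forallP=> i.
rewrite -[X in _ == X](eqP (hu i)) -[in X in _ == X](eqP (hv i)) -imset_comp.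
by apply/eqP/eq_imset => x; rewrite WappM.
Qed.

Definition WC : {group W n} := Group WC_group_set.

Definition is_rootC (a : 'rV[rat]_n) : Prop := is_root a /\ refl a \in WC.
Definition is_pos_rootC (a : 'rV[rat]_n) : Prop := is_rootC a /\ is_pos_root a.

(* [s] enumerates Delta_C *)
Definition is_baseC (s : seq 'rV[rat]_n) : Prop :=
  [/\ {in s, forall a, is_pos_rootC a}, free s &
      forall a, is_rootC a -> exists c : 'rV[rat]_n -> nat,
        a = \sum_(b <- s) b *+ c b \/ a = - \sum_(b <- s) b *+ c b].

Definition is_coxeter (w : W n) : Prop :=
  exists2 s : seq 'rV[rat]_n, is_baseC s & w = (\prod_(a <- s) refl a)%g.

Definition XC : {set W n} :=
  [set w | `[< forall a, is_pos_rootC a -> is_pos_root (Wact w a) >]].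

Definition xC : galg rat (W n) := \sum_(w in XC) gbasis rat w.

(* (Ind 1)(w); [getCrat] because 'Ind takes its (here rational) values in
   algC *)
Definition indC (w : W n) : rat :=
  getCrat ('Ind[[set: W n]%G] (1 : 'CF(WC)) w).

End Parabolic.

Definition is_partition (p : seq nat) : bool := sorted geq p && (0%N \notin p).

Definition is_bipart (n : nat) (l : seq nat * seq nat) : bool :=
  [&& is_partition l.1, is_partition l.2 & sumn l.1 + sumn l.2 == n]%N.

(* Bip(n), a bipartition being the pair (lambda^+, lambda^-) *)
Definition bipart (n : nat) := {l : seq nat * seq nat | is_bipart n l}.

Fact tau_subproof n (l : bipart n) :
  is_bipart n.+1 ((val l).1, rcons (val l).2 1%N).
Proof.
case: l => -[p q] /= /and3P[/= hp /andP[sq q0] /eqP <-].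
rewrite /is_bipart hp /is_partition mem_rcons inE negb_or q0 /= sumn_rcons.
rewrite addnA addn1 eqxx !andbT.
case: q sq q0 => //= x q; rewrite rcons_path => -> /=.
by have := mem_last x q; case: (last x q) => // -> .
Qed.

Definition tau n (l : bipart n) : bipart n.+1 :=
  exist (fun p => is_true (is_bipart n.+1 p)) _ (tau_subproof l).

Definition bip_of_scomp n (C : scomp n) : seq nat * seq nat :=
  (sort geq [seq `|x|%N | x <- val C & 0 < x],
   sort geq [seq `|x|%N | x <- val C & x < 0]).

(* some Coxeter element of some W_C with lambda(C) = l; its conjugacy class
   does not depend on the choice *)
Definition cox n (l : bipart n) : W n :=
  odflt 1%g [pick w | `[< exists2 C : scomp n,
                            bip_of_scomp C = val l & is_coxeter C w >]].

Section MantaciReutenauer.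
Variable n : nat.
Local Notation QW := (galg rat (W n)).

Definition xC_tuple : #|{: scomp n}|.-tuple QW :=
  [tuple xC (enum_val i) | i < #|{: scomp n}|].

Definition MR : {vspace QW} := <<xC_tuple>>%VS.

(* linear extension of x_C |-> (Ind 1)(cox_l), the x_C being a basis of MR *)
Definition pi_char (l : bipart n) (a : QW) : rat :=
  \sum_(i < #|{: scomp n}|) coord xC_tuple i a * indC (enum_val i) (cox l).

Definition Dmod (l : bipart n) : 'Hom(QW, 'End(rat^o)) :=
  linfun (fun a : QW => pi_char l a *: (\1%VF : 'End(rat^o))).

End MantaciReutenauer.

(* Main.v *)
Require Import Defs.
From HB Require Import structures.
From mathcomp Require Import all_boot all_order all_algebra all_fingroup all_field all_character.
From mathcomp Require Import boolp zify ring lra.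
Set Implicit Arguments.
Unset Strict Implicit.
Unset Printing Implicit Defensive.
Import Order.TTheory GRing.Theory Num.Theory.
Local Open Scope ring_scope.

(** Let A' and A be the Mantaci-Reutenauer algebras of W_(n+1) and W_n, embed
    W_n in W_(n+1) as the stabilizer of n+1, and put K = (n, -1), so that W_K is
    this copy of W_n.  The set X_K contains, for each signed index y, exactly
    one element [cosetW y] with n+1 |-> y, and x_K is the sum of these.

    The algebra morphism.  For a in A' the product a x_K has the form
    x_K res(a) for a unique res(a) in A.  This defines a morphism of algebras
    res : A' -> A such that res(a) = 0 implies a x_K = 0.  On the basis it is
    explicit ([res_xC]): res(x_D) is the sum, over the orbits of W_D on the
    signed indices, of x_C where C is D with one position of the block
    underlying the orbit deleted.  The formula rests on [insertion_count]: when
    the first n letters of a word are sorted according to C, each orbit contains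
    exactly one place at which the last letter can be inserted so as to give an
    element of X_D.  This holds because X_D is a transversal of W_(n+1) / W_D.

    Two consequences.  First, res is onto A ([res_onto]): deleting a position of
    (C, -1) gives back a positive multiple of C plus terms in which
    the part of C before the final parts -1 is shorter.  Second, the simple
    module D_(tau m) is D_m seen through res ([pi_char_tau]): the Mackey formula
    for the restriction of Ind 1 from W_(n+1) to W_n runs over the same orbits
    ([indC_liftW]), and a Coxeter element of type tau m has, up to the action of
    W_(n+1), the orbits of a Coxeter element of type m.  Such a value of an
    induced character depends only on these orbits, which are the orbits of
    W_C ([coxeter_orbits]).

    The modules.  The cover P' of D_(tau l) is a direct summand of the regular
    module, and x_K acts on D_(tau l) by a positive number.  Hence right
    multiplication by x_K, followed by the projection onto P', is a surjective
    endomorphism of P', and so is bijective; but it is zero on a P' when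
    res(a) = 0.  So the kernel of res annihilates P'
    ([res_ker_cover]), P' is a module over A, and there it is the projective
    cover P of D_l ([cover_isom]).  The isomorphism P' = P matches submodules,
    hence composition series, and it matches factors D_(tau m) with factors D_m
    ([multiplicity_transfer]).

    That A' is an algebra with basis the x_C comes from a description by values:
    a function on W_n lies in the span of the x_C exactly when it is constant on
    the classes of words with given signs and given ascents between neighbours
    of equal sign ([mem_MR]), a condition that convolution preserves
    ([tame_mul]). *)

(** * Transfer of multiplicities between two algebras *)
Section Intertwining.
Variables (K : fieldType) (aT bT : falgType K).
Variables (A : {vspace aT}) (B : {vspace bT}) (V W D : vectType K).
Variables (r : 'Hom(aT, 'End(V))) (s : 'Hom(bT, 'End(W))).
Variables (d : 'Hom(aT, 'End(D))) (e : 'Hom(bT, 'End(D))).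

(** Only the operators by which the two algebras act are compared, so that the
    algebras themselves need not be related. *)
Definition intertwines (h : 'Hom(V, W)) : Prop :=
  {in A, forall a, exists b,
    [/\ b \in B, forall v, h (r a v) = s b (h v) & d a = e b]} /\
  {in B, forall b, exists a,
    [/\ a \in A, forall v, h (r a v) = s b (h v) & d a = e b]}.

(** The numbers among which [multiplicity] chooses.  Two modules for which
    these predicates agree have equal multiplicities, whatever the choice. *)
Definition series_count (m : nat) : Prop :=
  exists k U, is_composition_series A r k U /\
    m = #|[set i : 'I_k | `[< factor_isom A r d (U i) (U i.+1) >]]|.

End Intertwining.

Lemma intertwines_inv (K : fieldType) (aT bT : falgType K)
    (A : {vspace aT}) (B : {vspace bT}) (V W D : vectType K)
    (r : 'Hom(aT, 'End(V))) (s : 'Hom(bT, 'End(W)))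
    (d : 'Hom(aT, 'End(D))) (e : 'Hom(bT, 'End(D)))
    (h : 'Hom(V, W)) (k : 'Hom(W, V)) :
    cancel h k -> cancel k h ->
  intertwines A B r s d e h -> intertwines B A s r e d k.
Proof.
move=> hK kK [AB BA]; split=> [b /BA[a [Aa ha de]]|a /AB[b [Bb hb de]]].
  by exists a; split=> // w; rewrite -{1}(kK w) -ha hK.
by exists b; split=> // w; rewrite -{1}(kK w) -hb hK.
Qed.

Lemma limg_cancel (K : fieldType) (V W : vectType K) (h : 'Hom(V, W))
  (k : 'Hom(W, V)) (U : {vspace V}) : cancel h k -> (k @: (h @: U))%VS = U.
Proof.
move=> hK; rewrite -limg_comp -[RHS]lim1g; apply: eq_in_limg => v _.
by rewrite comp_lfunE hK id_lfunE.
Qed.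

Section MultiplicityTransfer.
Variables (K : fieldType) (aT bT : falgType K).
Variables (A : {vspace aT}) (B : {vspace bT}) (V W D : vectType K).
Variables (r : 'Hom(aT, 'End(V))) (s : 'Hom(bT, 'End(W))).
Variables (d : 'Hom(aT, 'End(D))) (e : 'Hom(bT, 'End(D))).
Variables (h : 'Hom(V, W)) (k : 'Hom(W, V)).
Hypotheses (hK : cancel h k) (kK : cancel k h).
Hypothesis hI : intertwines A B r s d e h.

Let limg_hk U : (h @: (k @: U))%VS = U. Proof. exact: limg_cancel. Qed.
Let limg_kh U : (k @: (h @: U))%VS = U. Proof. exact: limg_cancel. Qed.

Let mem_limg U v : (h v \in (h @: U)%VS) = (v \in U).
Proof.
apply/idP/idP=> [/(memv_img k)|/(memv_img h) //].
by rewrite limg_kh hK.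
Qed.

Lemma limg_submodule U : is_submodule A r U -> is_submodule B s (h @: U).
Proof.
move=> Us b Bb; have [a [Aa ha _]] := hI.2 _ Bb.
have -> : (s b @: (h @: U) = h @: (r a @: U))%VS.
  by rewrite -!limg_comp; apply: eq_in_limg => v _; rewrite !comp_lfunE /= ha.
exact/limgS/Us.
Qed.

Lemma limg_submodule_inv U : is_submodule B s U -> is_submodule A r (k @: U).
Proof.
move=> Us a Aa; have [b [Bb hb _]] := hI.1 _ Aa.
have -> : (r a @: (k @: U) = k @: (s b @: U))%VS.
  rewrite -!limg_comp; apply: eq_in_limg => v _; rewrite !comp_lfunE /=.
  by rewrite -{2}(kK v) -hb hK.
exact/limgS/Us.
Qed.

Lemma limg_simple_factor U U' :
  simple_factor A r U U' -> simple_factor B s (h @: U) (h @: U').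
Proof.
case=> Us U's UU' neq simp; split; try exact: limg_submodule.
- exact: limgS.
- by move=> /(congr1 (lfun_img k)); rewrite !limg_kh.
move=> T Ts UT TU'; rewrite -(limg_hk T).
case: (simp (k @: T)%VS) => [|||->|->]; [exact: limg_submodule_inv| | |by left|by right].
- by rewrite -(limg_kh U) limgS.
- by rewrite -(limg_kh U') limgS.
Qed.

Lemma limg_factor_isom U U' :
  factor_isom A r d U U' -> factor_isom B s e (h @: U) (h @: U').
Proof.
case=> f [fr fU' fU]; exists (f \o k)%VF; split.
- move=> b _ Bb /memv_imgP[v Uv ->]; have [a [Aa ha da]] := hI.2 _ Bb.
  by rewrite !comp_lfunE /= -ha !hK fr // da.
- by rewrite limg_comp limg_kh.
by apply/vspaceP=> w; rewrite -(kK w) -fU !(memv_cap, mem_limg, memv_ker) comp_lfunE /= !hK.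
Qed.

End MultiplicityTransfer.


Lemma series_count_transfer (K : fieldType) (aT bT : falgType K)
    (A : {vspace aT}) (B : {vspace bT}) (V W D : vectType K)
    (r : 'Hom(aT, 'End(V))) (s : 'Hom(bT, 'End(W)))
    (d : 'Hom(aT, 'End(D))) (e : 'Hom(bT, 'End(D)))
    (h : 'Hom(V, W)) (k : 'Hom(W, V)) (m : nat) :
    cancel h k -> cancel k h -> intertwines A B r s d e h ->
  series_count A r d m -> series_count B s e m.
Proof.
move=> hK kK hI [l [U [[U0 Ul Us] ->]]].
exists l, (fun i => h @: U i)%VS; split.
  split=> [||i il]; first by rewrite U0 limg0.
    by apply/vspaceP=> w; rewrite memvf -(kK w) memv_img ?Ul ?memvf.
  exact: (limg_simple_factor hK kK hI) (Us i il).
apply: eq_card => i; rewrite !inE; apply/asboolP/asboolP.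
  exact: (limg_factor_isom hK kK hI).
move/(limg_factor_isom kK hK (intertwines_inv hK kK hI)).
by rewrite !(limg_cancel _ hK).
Qed.

Lemma multiplicity_transfer (K : fieldType) (aT bT : falgType K)
    (A : {vspace aT}) (B : {vspace bT}) (V W D : vectType K)
    (r : 'Hom(aT, 'End(V))) (s : 'Hom(bT, 'End(W)))
    (d : 'Hom(aT, 'End(D))) (e : 'Hom(bT, 'End(D)))
    (h : 'Hom(V, W)) (k : 'Hom(W, V)) :
    cancel h k -> cancel k h -> intertwines A B r s d e h ->
  multiplicity A r d = multiplicity B s e.
Proof.
move=> hK kK hI; congr (classical_sets.xget 0%N _).
apply/funext=> m; apply/propext; split.
  exact: (series_count_transfer hK kK hI).
exact: (series_count_transfer kK hK (intertwines_inv hK kK hI)).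
Qed.

(** * Projective covers along a morphism of algebras *)
Lemma linear_lfunE (K : fieldType) (V W : vectType K) (f : V -> W) :
  linear f -> linfun f =1 f.
Proof.
move=> fL v; pose g : {linear V -> W} :=
  HB.pack f (GRing.isLinear.Build K V W _ f fL).
exact: (lfunE g).
Qed.

Lemma limg_fullP (K : fieldType) (V W : vectType K) (f : 'Hom(V, W)) :
  limg f = fullv -> forall w, exists v, w = f v.
Proof.
move=> fT w; have : w \in limg f by rewrite fT memvf.
by case/memv_imgP=> v _ ->; exists v.
Qed.

Lemma full_limg_ker (K : fieldType) (V : vectType K) (f : 'End(V)) :
  limg f = fullv -> injective f.
Proof.
move=> fT; apply/lker0P; rewrite -dimv_eq0.
have := limg_ker_dim f fullv; rewrite fT capfv => /eqP.
by rewrite -[X in _ == X]add0n eqn_add2r.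
Qed.

Section ProjectiveCover.
Variables (K : fieldType) (aT : falgType K) (A : {vspace aT}).
Variables (P : vectType K) (r : 'Hom(aT, 'End(P))) (d : 'Hom(aT, 'End(K^o))).
Hypotheses (A1 : 1 \in A) (AM : {in A &, forall a b, a * b \in A}).

(** Nakayama's lemma for a one-dimensional quotient with superfluous kernel:
    a stable subspace that does not vanish in the quotient is everything. *)
Lemma essential_limg (U : vectType K) (f : 'Hom(U, P)) (p : 'Hom(P, K^o)) u :
    (forall S : {vspace P}, is_submodule A r S ->
       (S + lker p)%VS = fullv -> S = fullv) ->
    {in A, forall a v, exists v', r a (f v) = f v'} ->
  p (f u) != 0 -> limg f = fullv.
Proof.
move=> ess fr pfu; apply: ess.
  move=> a Aa; apply/subvP=> _ /memv_imgP[_ /memv_imgP[v _ ->] ->].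
  by have [v' ->] := fr a Aa v; rewrite memv_img ?memvf.
apply/vspaceP=> v; rewrite memvf; apply/memv_addP.
pose c := p v / p (f u).
have pfc : p (f (c *: u)) = p v by rewrite !linearZ; exact: divfK.
exists (f (c *: u)); first by rewrite memv_img ?memvf.
exists (v - f (c *: u)); last by rewrite addrC subrK.
by rewrite memv_ker linearB /= pfc subrr.
Qed.

Lemma simple_quotient_module (p : 'Hom(P, K^o)) :
  is_module A r -> is_modhom A r d p -> limg p = fullv -> is_module A d.
Proof.
move=> [r1 rM] pr /limg_fullP pT; split.
  by apply/lfunP=> c; have [v ->] := pT c; rewrite id_lfunE -pr // r1 id_lfunE.
move=> a b Aa Ab; apply/lfunP=> c; have [v ->] := pT c.
by rewrite comp_lfunE /= -!pr ?AM // rM // comp_lfunE.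
Qed.

Definition regular : 'Hom(aT, 'End(subvs_of A)) :=
  linfun (fun a => linfun (vsproj A) \o amull a \o linfun vsval)%VF.

Lemma regularE a u : a \in A -> vsval (regular a u) = a * vsval u.
Proof.
move=> Aa; rewrite linear_lfunE => [|c b b']; last first.
  apply/lfunP=> v; rewrite add_lfunE scale_lfunE !comp_lfunE !lfunE /=.
  by rewrite mulrDl -scalerAl linearP.
by rewrite !comp_lfunE !lfunE /= vsprojK // AM ?subvsP.
Qed.

Lemma regular_module : is_module A regular.
Proof.
split=> [|a b Aa Ab]; apply/lfunP=> u; apply/val_inj => /=.
  by rewrite regularE // mul1r id_lfunE.
by rewrite comp_lfunE !regularE ?AM // mulrA.
Qed.
End ProjectiveCover.

Section CoverAlongMorphism.
Variables (K : fieldType) (aT bT : falgType K).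
Variables (A : {vspace aT}) (B : {vspace bT}) (res : 'Hom(aT, bT)) (x : aT).
Hypotheses (A1 : 1 \in A) (AM : {in A &, forall a b, a * b \in A}).
Hypotheses (res1 : res 1 = 1)
  (resM : {in A &, forall a b, res (a * b) = res a * res b})
  (res_onto : (res @: A)%VS = B).
Hypotheses (Ax : x \in A) (res_ker : {in A, forall a, res a = 0 -> a * x = 0}).
Variables (P Q : vectType K).
Variables (r : 'Hom(aT, 'End(P))) (d : 'Hom(aT, 'End(K^o))).
Variables (s : 'Hom(bT, 'End(Q))) (e : 'Hom(bT, 'End(K^o))).
Hypotheses (de : {in A, forall a, d a = e (res a)}) (dx : d x != 0).
Hypotheses (coverP : is_projective_cover A r d)
           (coverQ : is_projective_cover B s e).

(** P is a summand of the regular module: a vector [v0] outside the kernel of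
    the cover gives a surjection [phi] from the regular module, split by some
    [psi].  The endomorphism [theta] = phi (psi v * x) of P does not vanish on
    the simple quotient because x acts on it by a nonzero scalar, so it is
    injective; and theta (a v) = phi (a * psi v * x) is 0 when [res a = 0],
    as [res (a * psi v) = 0]. *)
Lemma res_ker_cover a : a \in A -> res a = 0 -> r a = 0.
Proof.
case: coverP => -[rmod rproj] [p [pr pT pess]] Aa ra0.
have [r1 rM] := rmod; have [d1 dM] := simple_quotient_module A1 AM rmod pr pT.
have [v0 pv0] := limg_fullP pT 1.
pose phi : 'Hom(subvs_of A, P) := linfun (fun u => r (vsval u) v0).
have phiE u : phi u = r (vsval u) v0.
  apply: linear_lfunE => c u1 u2.
  by rewrite !linearP /= add_lfunE scale_lfunE.
have phi_hom : is_modhom A (regular A) r phi.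
  by move=> b Ab u; rewrite !phiE regularE // rM ?subvsP // comp_lfunE.
have phiT : limg phi = fullv.
  apply: (essential_limg (A := A) (p := p) (u := Subvs A1) pess).
    by move=> b Ab u; exists (regular A b u); rewrite phi_hom.
  by rewrite phiE /= r1 id_lfunE -pv0 oner_eq0.
have [|psi psi_hom psiK] :=
  rproj _ _ _ _ phi \1%VF (regular_module A1 AM) rmod phi_hom phiT.
  by move=> b Ab v; rewrite !id_lfunE.
have psiE v : r (vsval (psi v)) v0 = v.
  by rewrite -phiE -[RHS]id_lfunE -psiK comp_lfunE.
pose theta : 'End(P) := linfun (fun v => r (vsval (psi v) * x) v0).
have thetaE v : theta v = r (vsval (psi v) * x) v0.
  apply: linear_lfunE => c u1 u2.
  by rewrite !linearP /= mulrDl -scalerAl linearP /= add_lfunE scale_lfunE.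
have psiA v : vsval (psi v) \in A by exact: subvsP.
have theta_r b v : b \in A -> theta (r b v) = r (b * vsval (psi v) * x) v0.
  by move=> Ab; rewrite thetaE psi_hom // regularE.
have theta_inj : injective theta.
  apply/full_limg_ker/(essential_limg (A := A) (p := p) (u := v0) pess).
    move=> b Ab v; exists (r b v); rewrite theta_r // thetaE -mulrA.
    by rewrite (rM b) ?comp_lfunE //; apply: AM.
  have dx1 : d x 1 != 0.
    apply: contraNneq dx => dx1; apply/eqP/lfunP=> c.
    have -> : c = c *: (1 : K^o) by rewrite -[RHS]/(c * 1) mulr1.
    by rewrite linearZ /= dx1 scaler0 zero_lfunE.
  rewrite thetaE rM // comp_lfunE !pr //= -pv0.
  have -> : d x 1 = d x 1 *: (1 : K^o) by rewrite -[RHS]/(_ * 1) mulr1.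
  have dpsi : d (vsval (psi v0)) (p v0) = p v0 by rewrite -pr // psiE.
  by rewrite linearZ /= -pv0 in dpsi *; rewrite dpsi -[_ *: _]/(_ * 1) mulr1.
apply/lfunP=> v; rewrite zero_lfunE; apply/theta_inj.
rewrite theta_r // res_ker ?AM // ?linear0 ?zero_lfunE //.
by rewrite resM // ra0 mul0r.
Qed.

(** Projectivity of P lifts the cover of Q along that of P to a surjection h.
    As the kernel of [res] kills P, the algebra B acts on P through a linear
    section [t] of [res]; projectivity of Q over B then splits h, and the image
    of the splitting is all of P because the kernel of the cover P is
    superfluous. *)
Lemma cover_isom : exists (h : 'Hom(P, Q)) (k : 'Hom(Q, P)),
  [/\ cancel h k, cancel k h &
      {in A, forall a v, h (r a v) = s (res a) (h v)}].
Proof.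
have [[rmod rproj] [p [pr pT pess]]] := coverP.
have [[smod sproj] [q [qs qT qess]]] := coverQ.
have [[r1 rM] [s1 sM]] := (rmod, smod).
have resA a : a \in A -> res a \in B by move=> Aa; rewrite -res_onto memv_img.
have resV b : b \in B -> exists2 a, a \in A & b = res a.
  by rewrite -res_onto => /memv_imgP.
have sres_mod : is_module A (s \o res)%VF.
  split=> [|a b Aa Ab]; rewrite !comp_lfunE ?res1 //.
  by rewrite resM // sM ?resA.
have [| h hr hq] := rproj _ _ _ d q p sres_mod
    (simple_quotient_module A1 AM rmod pr pT) _ qT pr.
  by move=> a Aa v; rewrite comp_lfunE qs ?resA // de.
have {}hr a v : a \in A -> h (r a v) = s (res a) (h v).
  by move=> Aa; rewrite hr // comp_lfunE.
have hT : limg h = fullv.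
  have [v0 pv0] := limg_fullP pT 1.
  apply: (essential_limg (A := B) (p := q) (u := v0) qess).
    by move=> b /resV[a Aa ->] v; exists (r a v); rewrite hr.
  by rewrite -[q _]/(q (h v0)) -(comp_lfunE q h) hq -pv0 oner_eq0.
pose f := (res \o projv A)%VF; pose t := (projv A \o f^-1)%VF.
have tA b : t b \in A by rewrite comp_lfunE memv_proj.
have resK b : b \in B -> res (t b) = b.
  move=> Bb; rewrite comp_lfunE -[res _]comp_lfunE limg_lfunVK //.
  by rewrite limg_comp limg_proj res_onto.
(* only these two properties of [t] matter from here on *)
move: t => t in tA resK *.
have rt a : a \in A -> r (t (res a)) = r a.
  move=> Aa; apply/eqP; rewrite -subr_eq0 -linearB /=; apply/eqP.
  apply: res_ker_cover; first by rewrite rpredB.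
  by rewrite linearB /= resK ?resA // subrr.
have rt_mod : is_module B (r \o t)%VF.
  split=> [|_ _ /resV[a Aa ->] /resV[b Ab ->]]; rewrite !comp_lfunE.
    by rewrite -res1 rt.
  by rewrite -resM // !rt ?AM // rM.
have h_hom : is_modhom B (r \o t)%VF s h.
  by move=> _ /resV[a Aa ->] v; rewrite comp_lfunE rt // hr.
have [|k kr hk] := sproj _ _ _ s h \1%VF rt_mod smod h_hom hT.
  by move=> b Bb w; rewrite !id_lfunE.
have kK : cancel k h by move=> w; rewrite -comp_lfunE hk id_lfunE.
have kT : limg k = fullv.
  have [w0 qw0] := limg_fullP qT 1.
  apply: (essential_limg (A := A) (p := p) (u := w0) pess).
    move=> a Aa w; exists (s (res a) w).
    by rewrite kr ?resA // comp_lfunE rt.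
  by rewrite -hq comp_lfunE kK -qw0 oner_eq0.
exists h, k; split=> // [v|]; last by move=> a Aa v; rewrite hr.
by have [w ->] := limg_fullP kT v; rewrite kK.
Qed.

End CoverAlongMorphism.

(** * Signed indices and signed permutations *)
Section SignedIndices.
Variable n : nat.
Implicit Types (x y : sidx n) (u v w : W n).

(** The order -n < ... < -1 < 1 < ... < n.  Odd integers are used because the
    positions are counted from 0, which has to differ from its opposite. *)
Definition ival x : int := (-1) ^+ x.2 * (x.1.*2.+1)%:Z.

Lemma soppK : involutive (@sopp n).
Proof. by case=> i b; rewrite /sopp /= negbK. Qed.

Lemma ival_opp x : ival (sopp x) = - ival x.
Proof. by rewrite /ival /=; case: x.2 => /=; lia. Qed.

Lemma ival_inj : injective ival.
Proof.
case=> [i a] [j b]; rewrite /ival /=.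
by case: a; case: b => /= E; try lia; congr (_, _); apply/ord_inj; lia.
Qed.

Lemma ival_gt0 x : (0 < ival x) = ~~ x.2.
Proof. by rewrite /ival; case: x.2 => /=; lia. Qed.

Lemma Wapp_opp w x : Wapp w (sopp x) = sopp (Wapp w x).
Proof. exact/eqP/(forallP (valP w)). Qed.

Lemma Wapp_inj w : injective (Wapp w).
Proof. exact: perm_inj. Qed.

Lemma WappK w : cancel (Wapp w) (Wapp w^-1%g).
Proof. by move=> x; rewrite -WappM mulVg Wapp1. Qed.

Lemma WappVK w : cancel (Wapp w^-1%g) (Wapp w).
Proof. by move=> x; rewrite -WappM mulgV Wapp1. Qed.

Lemma W_eqP u v : (forall x, Wapp u x = Wapp v x) -> u = v.
Proof. by move=> E; apply/val_inj/permP. Qed.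

Lemma W_eq_pos u v :
  (forall i, Wapp u (i, false) = Wapp v (i, false)) -> u = v.
Proof.
move=> E; apply: W_eqP => -[i []]; last exact: E.
by rewrite -[(i, true)]/(sopp (i, false)) !Wapp_opp E.
Qed.

Section MakeW.
Variable f : sidx n -> sidx n.
Hypotheses (f_inj : injective f) (f_opp : forall x, f (sopp x) = sopp (f x)).

Fact mkW_subproof : is_signed (perm f_inj).
Proof. by apply/forallP=> x; rewrite !permE f_opp. Qed.

Definition mkW : W n := exist (fun s => is_true (is_signed s)) _ mkW_subproof.

Lemma mkWE x : Wapp mkW x = f x.
Proof. by rewrite /Wapp /= permE. Qed.
End MakeW.

End SignedIndices.

(** * Blocks of a signed composition *)
Section Blocks.
Implicit Types (C : seq int) (p q : nat).

Definition csizes C : seq nat := [seq `|c|%N | c <- C].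
Definition bidx C p : nat := reshape_index (csizes C) p.
Definition cpos C p : bool := 0 < C`_(bidx C p).
Definition linked C p : bool := bidx C p == bidx C p.+1.

Lemma bidx_cons c C p :
  bidx (c :: C) p = if (p < `|c|)%N then 0%N else (bidx C (p - `|c|)).+1.
Proof.
rewrite /bidx /reshape_index /=; case: ltnP => h; first by rewrite (eqP h).
by rewrite subSn.
Qed.

Lemma leq_bidx C p q : (p <= q)%N -> (bidx C p <= bidx C q)%N.
Proof.
elim: C p q => // c C IH p q pq; rewrite !bidx_cons.
case: ltnP => // cp; rewrite ifN -?leqNgt ?(leq_trans cp pq) // ltnS.
by apply: IH; rewrite leq_sub2r.
Qed.

Lemma bidx_convex C p q t :
  (p <= t <= q)%N -> bidx C p = bidx C q -> bidx C t = bidx C p.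
Proof.
case/andP=> pt tq E; apply/eqP.
by rewrite eqn_leq (leq_bidx _ pt) E leq_bidx.
Qed.

Lemma bidx_linked C p q : (p <= q)%N ->
  bidx C p = bidx C q <-> forall t, (p <= t < q)%N -> linked C t.
Proof.
move=> pq; split=> [E t /andP[pt tq]|].
  by rewrite /linked (@bidx_convex C p q t) ?(@bidx_convex C p q t.+1) //; lia.
move: pq; elim: q => [|q IH]; first by rewrite leqn0 => /eqP->.
rewrite leq_eqVlt => /predU1P[-> // | pq] L.
rewrite (IH pq) => [|t /andP[pt tq]]; last by rewrite L //; lia.
by apply/eqP/L; rewrite -ltnS pq leqnn.
Qed.

(** A composition amounts to a sign for each position and a link between some
    neighbours of equal sign.  It is built from the right: a new first position
    either enlarges the first part by one or opens a part of size one. *)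
Lemma scomp_realize m (P L : nat -> bool) :
    (forall p, (p.+1 < m)%N -> L p -> P p = P p.+1) ->
  exists C, [/\ all (fun c => c != 0) C, sumn (csizes C) = m,
    forall p, (p < m)%N -> cpos C p = P p &
    forall p, (p.+1 < m)%N -> linked C p = L p].
Proof.
elim: m P L => [|m IH] P L PL; first by exists [::].
pose e : int := if P 0%N then 1 else -1.
have eP : (0 < e) = P 0%N by rewrite /e; case: ifP.
have e1 : `|e|%N = 1%N by rewrite /e; case: ifP.
have [|C [C0 Cm CP CL]] := IH (P \o S) (L \o S).
  by move=> p pm; apply: PL.
case L0: ((0 < m)%N && L 0%N); last first.
  exists (e :: C); split=> /=; rewrite ?Cm ?e1 //.
  - by rewrite C0 andbT /e; case: ifP.
  - move=> [|p] pm; rewrite /cpos bidx_cons e1 //=.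
    by rewrite subn1 /=; apply: CP.
  - move=> [|p] pm; rewrite /linked !bidx_cons e1 /= ?subn1 /=.
      by move: L0; rewrite -ltnS pm /= => ->.
    by rewrite eqSS; apply: CL.
case: C C0 Cm CP CL L0 => [|c C] /=; first by move=> _ <-.
case/andP=> c0 C0 Cm CP CL /andP[m0 L0].
have ce : (0 < c) = P 0%N.
  have := CP 0%N m0; rewrite /cpos bidx_cons absz_gt0 c0 /= => ->.
  by rewrite -(PL 0%N).
have ace : absz (c + e) = (absz c).+1 by move: ce; rewrite /e; case: ifP => _; lia.
have cec : (0 < c + e) = (0 < c) by move: ce; rewrite /e; case: ifP => _; lia.
exists (c + e :: C); split=> /=; rewrite ?ace ?addSn ?Cm //.
- by rewrite C0 andbT -absz_gt0 ace.
- move=> [|p] pm; rewrite /cpos bidx_cons ace /= ?ltnS ?cec //.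
  have := CP p pm; rewrite /cpos bidx_cons subSS.
  by case: ltnP => //= _; rewrite cec.
move=> [|p] pm; rewrite /linked !bidx_cons ace /= !ltnS ?subSS.
  by rewrite absz_gt0 c0 L0.
by have := CL p pm; rewrite /linked !bidx_cons.
Qed.

Lemma scomp_unique C D :
    all (fun c => c != 0) C -> all (fun c => c != 0) D ->
    sumn (csizes C) = sumn (csizes D) ->
    (forall p, (p < sumn (csizes C))%N -> cpos C p = cpos D p) ->
    (forall p, (p.+1 < sumn (csizes C))%N -> linked C p = linked D p) ->
  C = D.
Proof.
elim: C D => [|c C IH] [|d D] //=.
- by move=> _ /andP[d0 _]; lia.
- by move=> /andP[c0 _] _; lia.
case/andP=> c0 C0 /andP[d0 D0] CD pE lE.
have scd : (0 < c) = (0 < d).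
  have := pE 0%N; rewrite /cpos !bidx_cons !absz_gt0 c0 d0 /=; apply.
  by apply: ltn_addr; rewrite absz_gt0.
have acd : `|c|%N = `|d|%N.
  have c1 : (0 < `|c|)%N by rewrite absz_gt0.
  have d1 : (0 < `|d|)%N by rewrite absz_gt0.
  have main x y X Y : (0 < `|x|)%N -> (`|x| < `|y|)%N ->
      linked (x :: X) `|x|.-1 = linked (y :: Y) `|x|.-1 -> False.
    move=> x0 xy; rewrite /linked !bidx_cons !prednK // leqnn ltnn /= xy.
    by rewrite (ltnW xy).
  case: (ltngtP `|c| `|d|) => // lt.
    case: (main c d C D c1 lt); apply: lE; rewrite prednK // CD.
    exact: ltn_addr.
  case: (main d c D C d1 lt); apply/esym/lE; rewrite prednK //.
  exact: ltn_addr.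
have -> : c = d by clear -scd acd c0 d0; lia.
congr (_ :: _); apply: IH => //; first by move: CD; rewrite acd => /addnI.
  move=> p pC; have := pE (p + `|c|)%N; rewrite /cpos !bidx_cons -acd !addnK.
  have -> : (p + `|c| < `|c|)%N = false by rewrite ltnNge leq_addl.
  by apply; rewrite addnC ltn_add2l.
move=> p pC; have := lE (p + `|c|)%N; rewrite /linked !bidx_cons -acd -!addSn.
have lt q : (q + `|c| < `|c|)%N = false by rewrite ltnNge leq_addl.
by rewrite !lt (lt p.+1) !addnK !eqSS; apply; rewrite addnC leq_add2l.
Qed.

End Blocks.

(** * Labels and the groups W_C *)
Section Labels.
Variables (n : nat).
Implicit Types (x y : sidx n) (w : W n).

(** A complete invariant of the orbits of W_C on the signed indices: a positive
    block is one orbit, a negative block contributes one orbit for each sign. *)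
Definition lab (C : seq int) x : nat * bool := (bidx C x.1, x.2 && ~~ cpos C x.1).

Lemma sumn_csizes (C : scomp n) : sumn (csizes (val C)) = n.
Proof.
case: C => C /= /andP[_ /eqP <-].
by rewrite /csizes sumnE big_map.
Qed.

Lemma scomp_neq0 (C : scomp n) : all (fun c => c != 0) (val C).
Proof. by case: C => C /= /andP[]. Qed.

Lemma bidx_size (C : scomp n) (p : 'I_n) : (bidx (val C) p < size (val C))%N.
Proof.
rewrite -[size _](size_map absz); apply: reshape_indexP.
by rewrite [sumn _]sumn_csizes.
Qed.

Lemma mem_block (C : scomp n) i x :
  (i < size (val C))%N -> (x \in block C i) = (lab (val C) x == (i, false)).
Proof.
move=> iC; rewrite inE /lab /cpos.
have sumE j : (\sum_(c <- take j (val C)) `|c|)%N = sumn (take j (csizes (val C))).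
  by rewrite /csizes -map_take sumnE big_map.
rewrite !sumE xpair_eqE.
have iC' : (i < size (csizes (val C)))%N by rewrite size_map.
rewrite (take_nth 0%N) // sumn_rcons ltnS.
set sh := csizes _; rewrite andbA.
have -> : (sumn (take i sh) <= x.1)%N && (x.1 < sumn (take i sh) + nth 0 sh i)%N
          = (bidx (val C) x.1 == i).
  apply/andP/eqP=> [[h1 h2]|<-]; last first.
    have := reshape_indexK sh x.1; rewrite /flatten_index => E.
    have := @reshape_offsetP sh x.1; rewrite [sumn sh]sumn_csizes ltn_ord.
    move/(_ isT) => lt; rewrite /bidx -/sh.
    by rewrite -[X in (_ <= X)%N]E -[X in (X < _)%N]E leq_addr ltn_add2l.
  rewrite /bidx -/sh -(subnKC h1); apply: flatten_indexKl; lia.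
by case: eqP => //= ->; case: x.2 => //=; rewrite eqbF_neg negbK.
Qed.

Lemma lab_oppP C x y : lab C (sopp x) = lab C (sopp y) <-> lab C x = lab C y.
Proof.
rewrite /lab /= /cpos; split=> -[-> E]; congr (_, _); move: E;
  by case: x.2; case: y.2; case: (0 < _).
Qed.

Lemma mem_WC (C : scomp n) w :
  w \in WC C <-> forall x, lab (val C) (Wapp w x) = lab (val C) x.
Proof.
rewrite inE; split=> [/forallP wC x|wC]; last first.
  apply/forallP=> i; rewrite eqEcard card_imset ?leqnn ?andbT; last exact: Wapp_inj.
  by apply/subsetP=> _ /imsetP[x xi ->]; move: xi; rewrite !mem_block ?wC.
have pos y : ~~ (lab (val C) y).2 -> lab (val C) (Wapp w y) = lab (val C) y.
  move=> y0; pose i := Ordinal (bidx_size C y.1).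
  have yi : lab (val C) y == (i : nat, false).
    by rewrite /lab xpair_eqE eqxx eqbF_neg.
  apply/eqP; rewrite (eqP yi) -mem_block ?ltn_ord // -(eqP (wC i)).
  by rewrite imset_f // mem_block.
have [|x1] := boolP (lab (val C) x).2; last exact: pos.
move=> /= /andP[x2 xc]; apply/lab_oppP; rewrite -Wapp_opp; apply: pos.
by rewrite /= x2.
Qed.

Lemma scomp_of_data (P L : nat -> bool) :
    (forall p, (p.+1 < n)%N -> L p -> P p = P p.+1) ->
  exists C : scomp n, (forall p, (p < n)%N -> cpos (val C) p = P p) /\
    (forall p, (p.+1 < n)%N -> linked (val C) p = L p).
Proof.
move=> /scomp_realize[C [C0 Cn CP CL]].
have Cs : is_scomp n C by rewrite /is_scomp C0 /= -Cn sumnE big_map.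
by exists (Sub C Cs); rewrite SubK.
Qed.

End Labels.

(** * Roots, reflections and the sets X_C *)
Section RootSystem.
Variable n : nat.
Implicit Types (x y z : sidx n) (w : W n) (a v : 'rV[rat]_n).

Lemma evec_opp x : evec (sopp x) = - evec x.
Proof. by rewrite /evec /=; case: x.2; rewrite ?scale1r ?scaleN1r ?opprK. Qed.

Lemma evecE v : v = \sum_(i < n) v 0 i *: evec (i, false).
Proof.
rewrite {1}(row_sum_delta v); apply: eq_bigr => i _.
by rewrite /evec /= scale1r.
Qed.

Lemma Wact_linear w : linear (Wact w).
Proof.
move=> c u v; rewrite /Wact scaler_sumr -big_split; apply: eq_bigr => i _ /=.
by rewrite !mxE scalerDl scalerA.
Qed.

Lemma WactD w u v : Wact w (u + v) = Wact w u + Wact w v.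
Proof. by rewrite -[u]scale1r Wact_linear !scale1r. Qed.

Lemma Wact0 w : Wact w 0 = 0.
Proof. by rewrite /Wact big1 // => i _; rewrite mxE scale0r. Qed.

Lemma WactZ w c v : Wact w (c *: v) = c *: Wact w v.
Proof. by rewrite -[c *: v]addr0 Wact_linear Wact0 addr0. Qed.

Lemma Wact_evec w x : Wact w (evec x) = evec (Wapp w x).
Proof.
have pos i : Wact w (evec (i, false)) = evec (Wapp w (i, false)).
  rewrite /Wact (bigD1 i) //= big1 ?addr0 => [|j ji].
    by rewrite /evec /= !mxE !eqxx mulr1 scale1r.
  by rewrite /evec /= !mxE (negPf ji) mulr0 scale0r.
case: x => i []; last exact: pos.
rewrite -[(i, true)]/(sopp (i, false)) evec_opp -scaleN1r WactZ pos.
by rewrite Wapp_opp evec_opp scaleN1r.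
Qed.

(** Twice the height with respect to the simple roots ([height_simple]). *)
Definition height v : rat := \sum_(i < n) v 0 i * (i.*2.+1)%:R.

Lemma height_linear : linear (height : 'rV[rat]_n -> rat^o).
Proof.
move=> c u v; rewrite /height scaler_sumr -big_split; apply: eq_bigr => i _ /=.
by rewrite !mxE mulrDl -[_ *: _]/(c * _) mulrA.
Qed.

HB.instance Definition _ :=
  GRing.isLinear.Build rat 'rV[rat]_n rat^o _ height height_linear.

Lemma height_evec x : height (evec x) = (ival x)%:~R.
Proof.
rewrite /height (bigD1 x.1) //= big1 ?addr0 => [|j jx].
  by rewrite /evec !mxE !eqxx mulr1 /ival; case: x.2 => /=; lra.
by rewrite /evec !mxE (negPf jx) mulr0 mul0r.
Qed.

Lemma height_simple (i : 'I_n) : height (simple_root i) = 2.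
Proof.
rewrite /simple_root; case: eqP => [i0|/eqP i0].
  by rewrite linearZ /= height_evec /ival /= i0; apply/eqP.
rewrite linearB /= !height_evec /ival /= -lt0n in i0 *.
have -> : ((i + n).-1 %% n)%N = i.-1.
  rewrite -subn1 -addnBAC // modnDr subn1 modn_small //.
  by rewrite prednK // ltnW.
rewrite -intrB -[RHS]/(2%:~R); congr (_%:~R); lia.
Qed.

Definition nonneg_comb a : Prop :=
  exists c : 'I_n -> nat, a = \sum_(i < n) simple_root i *+ c i.

Lemma nonneg_combD a b : nonneg_comb a -> nonneg_comb b -> nonneg_comb (a + b).
Proof.
case=> c -> [d ->]; exists (fun i => c i + d i)%N.
by rewrite -big_split; apply: eq_bigr => i _; rewrite /= mulrnDr.
Qed.

Lemma nonneg_comb0 : nonneg_comb 0.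
Proof. by exists (fun=> 0%N); rewrite big1. Qed.

Lemma nonneg_comb_simple i : nonneg_comb (simple_root i).
Proof.
exists (fun j => (j == i) : nat); rewrite (bigD1 i) //= eqxx big1 ?addr0 //.
by move=> j /negPf->.
Qed.

Lemma simple_root_pred (i j : 'I_n) : i = j.+1 :> nat ->
  simple_root i = evec (i, false) - evec (j, false).
Proof.
move=> ij; rewrite /simple_root ij /=; congr (_ - evec (_, _)).
apply/ord_inj => /=; rewrite ij addSn /= modnDr modn_small //.
Qed.

Lemma nonneg_comb_sub (i j : 'I_n) : (i <= j)%N ->
  nonneg_comb (evec (j, false) - evec (i, false)).
Proof.
case: j => j; elim: j => [|j IH] jn /= ij.
  have -> : Ordinal jn = i by apply/ord_inj => /=; lia.
  by rewrite subrr; exact: nonneg_comb0.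
move: ij; rewrite leq_eqVlt => /predU1P[ij|ij].
  have -> : Ordinal jn = i by apply/ord_inj.
  by rewrite subrr; exact: nonneg_comb0.
rewrite -(subrK (evec (Ordinal (ltnW jn), false)) (evec (Ordinal jn, false))).
rewrite -addrA; apply: nonneg_combD; last exact: IH.
by rewrite -simple_root_pred //; exact: nonneg_comb_simple.
Qed.

Lemma nonneg_comb_double (i : 'I_n) : nonneg_comb (2 *: evec (i, false)).
Proof.
have n0 : (0 < n)%N by apply: leq_ltn_trans (ltn_ord i).
rewrite -(subrK (evec (Ordinal n0, false)) (evec (i, false))) scalerDr.
apply: nonneg_combD; last first.
  exact: (nonneg_comb_simple (Ordinal n0)).
by rewrite scaler_nat mulr2n; apply: nonneg_combD; exact: nonneg_comb_sub.
Qed.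

Lemma root_height_neq0 a : is_root a -> height a != 0.
Proof.
case=> [[x ->]|[x [y [xy ->]]]].
  rewrite linearZ /= height_evec mulf_neq0 // intr_eq0 /ival.
  by case: x.2 => /=; lia.
rewrite linearD /= !height_evec -intrD intr_eq0 /ival.
by case: x y xy => i [] [j []] /= ij; rewrite ?expr0 ?expr1; lia.
Qed.

Lemma pos_rootP a : is_pos_root a <-> is_root a /\ 0 < height a.
Proof.
split=> -[ra].
  case=> c ac; split=> //; rewrite lt_neqAle; apply/andP; split.
    by rewrite eq_sym root_height_neq0.
  rewrite ac linear_sum sumr_ge0 // => i _.
  by rewrite linearMn /= height_simple mulrn_wge0.
case: ra => [[x ->]|[x [y [xy ->]]]].
  rewrite linearZ /= height_evec pmulr_rgt0 // ltr0z ival_gt0 => x2.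
  split; first by left; exists x.
  by case: x x2 => i [] //= _; exact: nonneg_comb_double.
rewrite linearD /= !height_evec -intrD ltr0z => h.
split; first by right; exists x, y.
have : ~~ y.2.
  by case: x y xy h => i [] [j []] //= ij; rewrite /ival /= ?expr0 ?expr1; lia.
case: y xy h => j [] //= xy _ _; case: x xy => i [] /= ij.
  rewrite -[(i, true)]/(sopp (i, false)) evec_opp addrC.
  exact/nonneg_comb_sub/ltnW.
rewrite -(subrK (evec (i, false)) (evec (j, false))) addrCA -mulr2n.
apply: nonneg_combD; first exact/nonneg_comb_sub/ltnW.
by rewrite -scaler_nat; exact: nonneg_comb_double.
Qed.

Lemma dotp_evec x y : dotp (evec x) (evec y) = (x == y)%:R - (x == sopp y)%:R.
Proof.
rewrite /dotp (bigD1 x.1) //= big1 ?addr0 => [|j jx]; last first.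
  by rewrite /evec !mxE (negPf jx) mulr0 mul0r.
rewrite /evec !mxE /= eqxx mulr1.
case: x y => i b [j c] /=; rewrite !xpair_eqE.
by case: eqP => //= _; case: b; case: c; rewrite /=; lra.
Qed.

Lemma dotpDl u v a : dotp (u + v) a = dotp u a + dotp v a.
Proof. by rewrite /dotp -big_split; apply: eq_bigr => i _; rewrite mxE mulrDl. Qed.

Lemma dotpZl c v a : dotp (c *: v) a = c * dotp v a.
Proof. by rewrite /dotp mulr_sumr; apply: eq_bigr => i _; rewrite mxE mulrA. Qed.

Lemma dotpC v a : dotp v a = dotp a v.
Proof. by rewrite /dotp; apply: eq_bigr => i _; rewrite mulrC. Qed.

Lemma dotpDr a u v : dotp a (u + v) = dotp a u + dotp a v.
Proof. by rewrite !(dotpC a) dotpDl. Qed.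

Lemma dotpZr a c v : dotp a (c *: v) = c * dotp a v.
Proof. by rewrite !(dotpC a) dotpZl. Qed.

Lemma evec_inj : injective (@evec n).
Proof.
move=> x y xy; apply: ival_inj; apply/eqP; rewrite -(eqr_int rat).
by rewrite -!height_evec xy.
Qed.

(** W acts faithfully, so the reflection is recognized by its effect on the
    vectors e_x. *)
Lemma refl_eq a w :
    (forall x, evec (Wapp w x) = evec x - (2 * dotp (evec x) a / dotp a a) *: a) ->
  refl a = w.
Proof.
move=> wa.
have lin (f : 'rV[rat]_n -> 'rV[rat]_n) v :
  linear f -> f v = \sum_(i < n) v 0 i *: f (evec (i, false)).
  move=> fL; pose g : {linear 'rV[rat]_n -> 'rV[rat]_n} :=
    HB.pack f (GRing.isLinear.Build rat 'rV[rat]_n 'rV[rat]_n _ f fL).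
  rewrite -[f]/(g : _ -> _) {1}(evecE v) linear_sum.
  by apply: eq_bigr => i _; rewrite linearZ.
have w_refl : is_reflection a w.
  move=> v; rewrite (lin (Wact w)) //; last exact: Wact_linear.
  rewrite (lin (fun v => v - (2 * dotp v a / dotp a a) *: a)).
    by apply: eq_bigr => i _; rewrite Wact_evec wa.
  move=> c u1 u2; rewrite dotpDl dotpZl scalerBr addrACA -opprD scalerA -scalerDl.
  by congr (_ - _ *: _); ring.
rewrite /refl; case: pickP => [u /asboolP u_refl /=|/(_ w)/asboolP //].
by apply: W_eqP => x; apply: evec_inj; rewrite -!Wact_evec u_refl w_refl.
Qed.

Definition flip_fun x z := if z.1 == x.1 then sopp z else z.
Fact flip_inj x : injective (flip_fun x).
Proof.
apply: (can_inj (g := flip_fun x)) => z; rewrite /flip_fun.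
by case E: (z.1 == x.1); rewrite /= ?E ?soppK.
Qed.
Fact flip_opp x z : flip_fun x (sopp z) = sopp (flip_fun x z).
Proof. by rewrite /flip_fun /=; case: ifP. Qed.
Definition flip x : W n := mkW (@flip_inj x) (@flip_opp x).

Lemma flipE x z : Wapp (flip x) z = if z.1 == x.1 then sopp z else z.
Proof. exact: mkWE. Qed.

Definition swap_fun x y z : sidx n :=
  if z.1 == x.1 then (y.1, y.2 (+) x.2 (+) z.2) else
  if z.1 == y.1 then (x.1, y.2 (+) x.2 (+) z.2) else z.
Fact swap_inj x y : injective (swap_fun x y).
Proof.
apply: (can_inj (g := swap_fun x y)) => -[i b]; rewrite /swap_fun /=.
case E: (i == x.1); rewrite /= ?eqxx; first case E': (y.1 == x.1) => /=.
- by rewrite (eqP E) (eqP E') addKb.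
- by rewrite (eqP E) addKb.
case F: (i == y.1) => /=; last by rewrite E F.
by rewrite eqxx addKb (eqP F).
Qed.
Fact swap_opp x y z : swap_fun x y (sopp z) = sopp (swap_fun x y z).
Proof. by rewrite /swap_fun /sopp /=; do 2?case: ifP => //= _; rewrite addbN. Qed.
Definition swap x y : W n := mkW (@swap_inj x y) (@swap_opp x y).

Lemma swapE x y z : Wapp (swap x y) z =
  if z.1 == x.1 then (y.1, y.2 (+) x.2 (+) z.2) else
  if z.1 == y.1 then (x.1, y.2 (+) x.2 (+) z.2) else z.
Proof. exact: mkWE. Qed.

Lemma evec_sgn (i : 'I_n) b : evec (i, b) = (-1) ^+ b *: evec (i, false) :> 'rV[rat]_n.
Proof. by rewrite /evec /= scale1r. Qed.

Lemma dotp_evec1 (i j : 'I_n) b c :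
  dotp (evec (i, b)) (evec (j, c)) = (-1) ^+ (b (+) c) * (i == j)%:R :> rat.
Proof.
rewrite dotp_evec /sopp !xpair_eqE /=.
by case: eqP; case: b; case: c => //= _; lra.
Qed.

Lemma refl_coef_long u v : dotp v v = 1 ->
  2 * dotp u (2 *: v) / dotp (2 *: v) (2 *: v) = dotp u v.
Proof. by move=> vv; rewrite !dotpZr !dotpZl vv mulr1; field. Qed.

Lemma refl_coef_short u v t : dotp v v = 1 -> dotp t t = 1 -> dotp v t = 0 ->
  2 * dotp u (v + t) / dotp (v + t) (v + t) = dotp u v + dotp u t.
Proof.
move=> vv tt vt.
by rewrite !dotpDr !dotpDl (dotpC t v) vv tt vt; field.
Qed.

Lemma refl_long x : refl (2 *: evec x) = flip x.
Proof.
case: x => j c; apply: refl_eq => -[i b].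
have vv : dotp (evec (j, c)) (evec (j, c)) = 1.
  by rewrite dotp_evec1 addbb eqxx mulr1.
rewrite (refl_coef_long _ vv) dotp_evec1 flipE /=.
case: eqP => [->|_] /=; last by rewrite mulr0 scale0r subr0.
rewrite /sopp /= (evec_sgn j b) (evec_sgn j c) (evec_sgn j (~~ b)).
rewrite mulr1 !scalerA -scalerBl; congr (_ *: _).
by case: (b); case: (c).
Qed.

Lemma refl_short x y : x.1 != y.1 -> refl (evec x + evec y) = swap x (sopp y).
Proof.
case: x y => j c [k d] /= jk; apply: refl_eq => -[i b].
have vv : dotp (evec (j, c)) (evec (j, c)) = 1.
  by rewrite dotp_evec1 addbb eqxx mulr1.
have ww : dotp (evec (k, d)) (evec (k, d)) = 1.
  by rewrite dotp_evec1 addbb eqxx mulr1.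
have vw : dotp (evec (j, c)) (evec (k, d)) = 0.
  by rewrite dotp_evec1 (negPf jk) mulr0.
rewrite (refl_coef_short _ vv ww vw) !dotp_evec1 swapE /=.
case: (eqVneq i j) => [->|ij].
  rewrite (negPf jk) /= (evec_sgn j b) (evec_sgn j c) (evec_sgn k d).
  rewrite (evec_sgn k (_ (+) _)) mulr1 mulr0 addr0.
  move: (evec (j, false)) (evec (k, false)) => ej ek.
  rewrite scalerDr !scalerA opprD addrA -scalerBl -scaleNr.
  have -> : (-1) ^+ b - (-1) ^+ (b (+) c) * (-1) ^+ c = 0 :> rat.
    by case: (b); case: (c).
  by rewrite scale0r add0r; congr (_ *: _); case: (b); case: (c); case: (d).
case: (eqVneq i k) => [->|ik] /=; last first.
  by rewrite !mulr0 addr0 scale0r subr0.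
rewrite (evec_sgn k b) (evec_sgn j c) (evec_sgn k d) (evec_sgn j (_ (+) _)).
rewrite mulr1 mulr0 add0r.
move: (evec (j, false)) (evec (k, false)) => ej ek.
rewrite scalerDr !scalerA opprD addrCA -scalerBl -scaleNr.
have -> : (-1) ^+ b - (-1) ^+ (b (+) d) * (-1) ^+ d = 0 :> rat.
  by case: (b); case: (d).
by rewrite scale0r addr0; congr (_ *: _); case: (b); case: (c); case: (d).
Qed.

Lemma flip_WC (C : scomp n) x : (flip x \in WC C) = cpos (val C) x.1.
Proof.
apply/idP/idP=> [/mem_WC/(_ x)|cx].
  by rewrite flipE eqxx /lab /= => -[]; case: x.2; case: cpos.
apply/mem_WC => z; rewrite flipE; case: eqP => // zx.
by rewrite /lab /= zx cx !andbF.
Qed.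

Lemma swap_WC (C : scomp n) x y : (swap x y \in WC C) = (lab (val C) x == lab (val C) y).
Proof.
apply/idP/eqP=> [/mem_WC/(_ x)|xy].
  by rewrite swapE eqxx addbK -surjective_pairing => ->.
apply/mem_WC => -[i b]; rewrite swapE /=.
case: x y xy => j c [k d] [jk]; rewrite /lab /cpos /= jk => cd.
case: eqP => [->|_] /=.
  rewrite jk; congr (_, _); move: cd.
  by case: (0 < _); rewrite ?andbF //= !andbT; case: b; case: c; case: d.
case: eqP => [->|_] //=; rewrite jk; congr (_, _); move: cd.
by case: (0 < _); rewrite ?andbF //= !andbT; case: b; case: c; case: d.
Qed.

Lemma pos_root_long x : is_pos_root (2 *: evec x) <-> 0 < ival x.
Proof.
have ht : height (2 *: evec x) = 2 * (ival x)%:~R.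
  by rewrite linearZ /= height_evec.
rewrite -(ltr0z rat) -(pmulr_rgt0 _ (ltr0Sn rat 1)) -ht.
split=> [/pos_rootP[]//|h]; apply/pos_rootP; split=> //.
by left; exists x.
Qed.

Lemma short_is_root x y : x.1 != y.1 -> is_root (evec x + evec y).
Proof.
rewrite neq_ltn => /orP[xy|yx]; right; first by exists x, y.
by exists y, x; rewrite addrC.
Qed.

Lemma pos_root_short x y : x.1 != y.1 ->
  is_pos_root (evec x + evec y) <-> 0 < ival x + ival y.
Proof.
move=> xy; have ht : height (evec x + evec y) = (ival x + ival y)%:~R.
  by rewrite linearD /= !height_evec intrD.
rewrite -(ltr0z rat) -ht; split=> [/pos_rootP[]//|h].
by apply/pos_rootP; split=> //; exact: short_is_root.
Qed.

Lemma Wapp_neq1 w x y : x.1 != y.1 -> (Wapp w x).1 != (Wapp w y).1.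
Proof.
apply: contraNneq => E; apply/eqP.
have [/Wapp_inj->|] // := eqVneq (Wapp w x) (Wapp w y).
move=> ne; have /Wapp_inj-> // : Wapp w x = Wapp w (sopp y).
rewrite Wapp_opp; move: E ne; case: (Wapp w x) => i b; case: (Wapp w y) => j c.
by rewrite /sopp xpair_eqE /= => ->; rewrite eqxx; case: b; case: c.
Qed.

(** On a word, positivity of the images of 2 e_i and e_j - e_i says that the
    letter at i is positive and that the letters at i < j increase; the roots
    e_i + e_j of a positive block give nothing new. *)
Lemma mem_XC (C : scomp n) w :
  w \in XC C <->
  (forall i : 'I_n, cpos (val C) i -> 0 < ival (Wapp w (i, false))) /\
  (forall i j : 'I_n, (i < j)%N -> bidx (val C) i = bidx (val C) j ->
     ival (Wapp w (i, false)) < ival (Wapp w (j, false))).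
Proof.
rewrite inE; split=> [/asboolP wX|[wp wl]].
  split=> [i ip|i j ij E].
    rewrite -pos_root_long -Wact_evec -WactZ; apply: wX; split.
      by split; [left; exists (i, false) | rewrite refl_long flip_WC].
    by apply/pos_root_long; rewrite ival_gt0.
  have ji : (j, false).1 != (i, true).1 by rewrite /= neq_ltn ij orbT.
  have := wX (evec (j, false) + evec (i, true)).
  rewrite WactD !Wact_evec pos_root_short ?Wapp_neq1 //.
  rewrite -[(i, true)]/(sopp (i, false)) Wapp_opp ival_opp subr_gt0.
  apply; split; last first.
    apply/pos_root_short => //; rewrite ival_opp /ival /= ?expr0; lia.
  split; first exact: short_is_root.
  by rewrite refl_short // soppK swap_WC /lab /= E.
apply/asboolP => a [[ra aC] a_pos].
case: ra => [[x ax]|[x [y [xy ax]]]]; rewrite {a}ax in aC a_pos *.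
  move: a_pos aC; rewrite refl_long flip_WC WactZ Wact_evec !pos_root_long.
  by rewrite ival_gt0; case: x => i [] //= _; exact: wp.
have xy' : x.1 != y.1 by rewrite neq_ltn xy.
move: a_pos aC; rewrite refl_short // swap_WC WactD !Wact_evec.
rewrite !pos_root_short ?Wapp_neq1 // => h /eqP[E1 E2].
case: y xy xy' h E1 E2 => j [] /= ij _ h E1 E2.
  by exfalso; case: x ij h {E1 E2} => i [] /= ij; rewrite /ival /= ?expr0 ?expr1; lia.
case: x ij h E1 E2 => i [] /= ij h E1 E2.
  rewrite -[(i, true)]/(sopp (i, false)) Wapp_opp ival_opp addrC subr_gt0.
  exact: wl.
have cj : cpos (val C) j by move: E2; case: cpos.
by apply: addr_gt0; apply: wp; rewrite // /cpos E1.
Qed.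

End RootSystem.

(** * Coset representatives *)
Lemma incr_ord_id n (g : 'I_n -> 'I_n) :
  (forall i j : 'I_n, j = i.+1 :> nat -> (g i < g j)%N) -> forall i, g i = i.
Proof.
move=> g_incr i; apply/ord_inj/eqP; rewrite eqn_leq; apply/andP; split; last first.
  case: i => i; elim: i => // i IH iSn; have i_n := ltnW iSn.
  exact: leq_ltn_trans (IH i_n) (g_incr (Ordinal i_n) (Ordinal iSn) erefl).
case: i => i i_n /=.
suff main k : (k + i.+1 = n)%N -> (g (Ordinal i_n) <= i)%N by apply/main/subnK.
elim: k i i_n => [|k IH] i i_n E; first by have := ltn_ord (g (Ordinal i_n)); lia.
have iSn : (i.+1 < n)%N by lia.
have := g_incr (Ordinal i_n) (Ordinal iSn) erefl.
by have := IH _ iSn; rewrite addnS; lia.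
Qed.

Section Words.
Variable n : nat.
Implicit Types (x y z : sidx n) (u v w : W n) (i j p q : 'I_n) (C D : scomp n).

Definition letter w i : int := ival (Wapp w (i, false)).

Lemma letter_gt0 w i : (0 < letter w i) = ~~ (Wapp w (i, false)).2.
Proof. exact: ival_gt0. Qed.

Lemma letter_lt0 w i : (letter w i < 0) = (Wapp w (i, false)).2.
Proof. by rewrite -[RHS]negbK -letter_gt0 -leNgt /letter /ival; case: (_.2) => /=; lia. Qed.

Lemma letter_inj w : injective (letter w).
Proof. by move=> i j /ival_inj/Wapp_inj[]. Qed.

Lemma letter_flip w i j :
  letter (w * flip (i, false))%g j = if j == i then - letter w j else letter w j.
Proof.
rewrite /letter WappM flipE /=; case: eqP => // _.
by rewrite Wapp_opp ival_opp.
Qed.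

Lemma letter_swap w i j p : letter (w * swap (i, false) (j, false))%g p =
  letter w (if p == i then j else if p == j then i else p).
Proof. by rewrite /letter WappM swapE /=; case: eqP => // _; case: eqP. Qed.

(** Take h such that the sum of [k i * letter (g * h) i] is maximal: neither a
    change of sign nor an exchange of two letters that H allows can increase
    it, which forces the stated inequalities. *)
Lemma rearrangement (H : {group W n}) (g : W n) (k : 'I_n -> int) :
  exists2 h, h \in H &
  [/\ forall i, flip (i, false) \in H -> 0 < k i -> 0 < letter (g * h)%g i,
      forall i, flip (i, false) \in H -> k i < 0 -> letter (g * h)%g i < 0 &
      forall i j, swap (i, false) (j, false) \in H -> k i < k j ->
        letter (g * h)%g i < letter (g * h)%g j].
Proof.
pose phi h := \sum_i k i * letter (g * h)%g i.
have [h hH hmax] := Order.TotalTheory.arg_maxP phi (group1 H).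
have flip_le i : flip (i, false) \in H -> 0 <= k i * letter (g * h)%g i.
  move=> fH; have := hmax _ (groupM hH fH); rewrite /phi /= [X in X <= _](bigD1 i) //.
  rewrite [X in _ <= X](bigD1 i) //= mulgA letter_flip eqxx.
  under eq_bigr => j /negPf ji do rewrite letter_flip ji.
  rewrite lerD2r; move: (k i) (letter _ i) => a b; nia.
have swap_le i j : swap (i, false) (j, false) \in H -> i != j ->
    0 <= (k j - k i) * (letter (g * h)%g j - letter (g * h)%g i).
  move=> sH ij; have := hmax _ (groupM hH sH); rewrite /phi /=.
  rewrite [X in X <= _](bigD1 i) // [X in _ <= X](bigD1 i) //=.
  rewrite [X in _ + X <= _](bigD1 j) ?[X in _ <= _ + X](bigD1 j) 1?eq_sym //=.
  rewrite mulgA !letter_swap !eqxx eq_sym (negPf ij).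
  under eq_bigr => p /andP[/negPf pi /negPf pj] do rewrite letter_swap pi pj.
  rewrite !addrA lerD2r; move: (k i) (k j) (letter _ i) (letter _ j) => a b c d.
  nia.
exists h => //; split=> [i /flip_le|i /flip_le|i j sH kij].
- move=> le ki; rewrite letter_gt0 -letter_lt0 -leNgt.
  by rewrite -(pmulr_rge0 _ ki).
- move=> le ki; rewrite letter_lt0; apply/negPn/negP; rewrite -letter_gt0.
  by move=> lt; move: le; rewrite leNgt nmulr_rlt0 ?lt.
have ij : i != j by apply: contraTneq kij => ->; rewrite ltxx.
rewrite lt_neqAle (inj_eq (@letter_inj _)) ij /= -subr_ge0.
by rewrite -(pmulr_rge0 (x := k j - k i)) ?swap_le // subr_gt0.
Qed.

Lemma mem_XC_adjacent C w :
  w \in XC C <->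
  (forall i, cpos (val C) i -> 0 < letter w i) /\
  (forall i j, j = i.+1 :> nat -> linked (val C) i -> letter w i < letter w j).
Proof.
rewrite mem_XC; split=> -[wp wl]; split=> //.
  by move=> i j ij /eqP l; apply: wl; rewrite ?ij.
move=> i [j jn] /= ij E; have := ij; rewrite leq_eqVlt.
move: E => /(bidx_linked _ (ltnW ij)).
elim: j jn ij => // j IH jn ij L _.
have jn' := ltnW jn; have lj : letter w (Ordinal jn') < letter w (Ordinal jn).
  by apply: wl => //=; apply: L; rewrite -ltnS ij leqnn.
move: ij; rewrite ltnS leq_eqVlt => /predU1P[ij|ij].
  by have -> : i = Ordinal jn' by apply/ord_inj.
apply: lt_trans lj; apply: IH => //; last by rewrite -leq_eqVlt.
by move=> t /andP[it tj]; apply: L; rewrite it ltnW.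
Qed.

(** Sorting the letters of g inside the blocks, by [rearrangement] for weights
    that increase with the position. *)
Lemma XC_transversal C g : exists2 h, h \in WC C & (g * h)%g \in XC C.
Proof.
have [h hC [hp _ hl]] := rearrangement (WC C) g (fun i : 'I_n => i.+1%:Z).
exists h => //; apply/mem_XC_adjacent; split=> [i ci|i j ij /eqP l].
  by apply: hp => //; rewrite flip_WC.
by apply: hl; [rewrite swap_WC /lab /= ij l | rewrite ij; lia].
Qed.

(** If u and u h are both sorted inside the blocks then h permutes the positions
    of each block monotonically and without sign changes, so it is trivial. *)
Lemma XC_unique C u h : u \in XC C -> h \in WC C -> (u * h)%g \in XC C -> h = 1%g.
Proof.
move=> /mem_XC[up ul] /mem_WC hC /mem_XC[vp vl].
have bh x : bidx (val C) (Wapp h x).1 = bidx (val C) x.1 by case: (hC x).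
have h_pos i : (Wapp h (i, false)).2 = false.
  apply/negP=> neg; have := hC (i, false); rewrite /lab /= neg => -[bE /= /negbFE cg].
  have ci : cpos (val C) i by rewrite /cpos -bE.
  have := vp i ci; rewrite WappM.
  case: (Wapp h _) neg cg => k [] //= _ ck.
  rewrite -[(k, true)]/(sopp (k, false)) Wapp_opp ival_opp oppr_gt0 ltNge.
  by rewrite ltW // up.
pose g i := (Wapp h (i, false)).1.
have hE i : Wapp h (i, false) = (g i, false).
  by rewrite /g; have := h_pos i; case: (Wapp h _) => k b /= ->.
have g_id i : g i = i.
  apply: incr_ord_id => {}i j ij; rewrite ltnNge; apply/negP=> ji.
  have ij' : (i < j)%N by rewrite ij.
  have E : bidx (val C) i = bidx (val C) j.
    apply/eqP; rewrite eqn_leq leq_bidx ?(ltnW ij') //=.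
    by rewrite -(bh (i, false)) -(bh (j, false)) !hE leq_bidx.
  have := vl i j ij' E; rewrite !WappM !hE.
  move: ji; rewrite leq_eqVlt => /predU1P[/ord_inj->|ji]; first by rewrite ltxx.
  apply/negP; rewrite -leNgt ltW // ul //.
  by have := bh (i, false); have := bh (j, false); rewrite !hE /= => -> ->.
by apply: W_eq_pos => i; rewrite hE g_id Wapp1.
Qed.

End Words.

(** * Functions constant on descent classes *)
Section Tame.
Variables (K : fieldType) (gT : finGroupType) (S : {set gT}).
Implicit Types (f g : galg K gT) (s u w : gT).

(** For the exchanges s of two consecutive absolute values, u^-1 s u is again
    such an exchange exactly when the two letters are neighbours of equal sign
    in the word u.  Any other exchange keeps all signs of u and all ascents
    between neighbours of equal sign. *)
Definition tame f : Prop :=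
  forall s w, s \in S -> (w^-1 * (s * w))%g \notin S -> f (s * w)%g = f w.

Lemma galg_mulE f g x : (f * g) x = \sum_(u : gT) f u * g (u^-1 * x)%g.
Proof. by rewrite [LHS]ffunE. Qed.

(** In the sum over u of f(u) g(u^-1 s w), the terms with u^-1 s u outside S are
    handled by the substitution of s u for u and the invariance of f; for the
    others t = u^-1 s u lies in S, u^-1 s w = t u^-1 w, and the invariance of g
    applies because t is conjugate by u^-1 w to w^-1 s w. *)
Lemma tame_mul f g : tame f -> tame g -> tame (f * g).
Proof.
move=> tf tg s w sS wS; rewrite !galg_mulE.
pose phi u := if (u^-1 * (s * u))%g \in S then u else (s * u)%g.
have phiE u : ((phi u)^-1 * (s * phi u))%g = (u^-1 * (s * u))%g.
  by rewrite /phi; case: ifP => // _; rewrite invMg !mulgA mulgKV.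
have phi_inj : injective phi.
  move=> u v uv; have := phiE u; rewrite uv phiE => E; move: uv.
  by rewrite /phi -E; case: ifP => // _ /mulgI.
rewrite (reindex_inj phi_inj); apply: eq_bigr => u _; rewrite /phi.
case: ifPn => [uS|uS]; last first.
  by rewrite tf // invMg -mulgA mulKg.
congr (_ * _); have -> : (u^-1 * (s * w) = (u^-1 * (s * u)) * (u^-1 * w))%g.
  by rewrite !mulgA mulgK.
by apply: tg => //; rewrite invMg invgK !mulgA !mulgK -!mulgA.
Qed.

Lemma tame_lin (c : K) f g : tame f -> tame g -> tame (c *: f + g).
Proof. by move=> tf tg s w sS wS; rewrite !ffunE tf ?tg. Qed.

Lemma tame0 : tame 0.
Proof. by move=> s w _ _; rewrite !ffunE. Qed.
End Tame.

Section DescentClasses.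
Variable n : nat.
Implicit Types (x y z : sidx n) (s u v w : W n) (i j p q : 'I_n) (C D : scomp n).

Definition adj_swaps : {set W n} :=
  [set s | [exists i : 'I_n, exists j : 'I_n,
     (j == i.+1 :> nat) && (s == swap (i, false) (j, false))]].

Lemma adj_swapsP s :
  reflect (exists i j : 'I_n, j = i.+1 :> nat /\ s = swap (i, false) (j, false))
          (s \in adj_swaps).
Proof.
rewrite inE; apply: (iffP existsP) => [[i /existsP[j /andP[/eqP ij /eqP ->]]]|].
  by exists i, j.
by case=> i [j [ij ->]]; exists i; apply/existsP; exists j; rewrite ij !eqxx.
Qed.

Lemma eq_index x y : (x.1 == y.1) = (x == y) || (x == sopp y).
Proof.
case: x y => i b [j c]; rewrite /sopp !xpair_eqE /= -andb_orr.
by case: b; case: c; rewrite andbT.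
Qed.

Lemma swapL x y : Wapp (swap x y) x = y.
Proof. by rewrite swapE eqxx addbK -surjective_pairing. Qed.

Lemma swapC x y : swap x y = swap y x.
Proof.
apply: W_eqP => z; rewrite !swapE (addbC y.2).
by have [zx|_] := eqVneq z.1 x.1; have [zy|_] := eqVneq z.1 y.1;
  rewrite // -?zx -?zy.
Qed.

Lemma swap_sopp x y : swap (sopp x) (sopp y) = swap x y.
Proof.
apply: W_eqP => z; rewrite !swapE /=.
by have -> : ~~ y.2 (+) ~~ x.2 = y.2 (+) x.2 by case: x.2; case: y.2.
Qed.

Lemma swap_conj w x y :
  (w^-1 * (swap x y * w))%g = swap (Wapp w^-1%g x) (Wapp w^-1%g y).
Proof.
have half x' y' z : (Wapp w z).1 = x'.1 ->
    Wapp w^-1%g (Wapp (swap x' y') (Wapp w z)) =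
    Wapp (swap (Wapp w^-1%g x') (Wapp w^-1%g y')) z.
  move/eqP; rewrite eq_index => /orP[]/eqP zx.
    by rewrite zx swapL -(WappK w z) zx swapL.
  by rewrite zx Wapp_opp swapL -(WappK w z) zx !Wapp_opp swapL.
apply: W_eqP => z; rewrite !WappM.
have [zx|zx] := eqVneq (Wapp w z).1 x.1; first exact: half.
have [zy|zy] := eqVneq (Wapp w z).1 y.1; first by rewrite swapC half // swapC.
rewrite swapE (negPf zx) (negPf zy) WappK swapE.
have nz t : (Wapp w z).1 != t.1 -> (z.1 == (Wapp w^-1%g t).1) = false.
  move=> ne; apply: negbTE; apply: contraNneq ne => E; apply/eqP.
  apply/eqP; rewrite eq_index -[t in _ == t](WappVK w) -[t in sopp t](WappVK w).
  rewrite -Wapp_opp !(inj_eq (@Wapp_inj _ _)) -eq_index E eqxx //.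
by rewrite !nz.
Qed.

Lemma ival_pair (t : 'I_n) d :
  ival (t, d) = if d then - (t.*2.+1)%:Z else (t.*2.+1)%:Z.
Proof. by case: d; rewrite /ival /= ?expr0 ?expr1 ?mulN1r ?mul1r. Qed.

(** Exchanging two consecutive integers only affects the order of these two. *)
Lemma swap_succ_mono (i k l : nat) (f : nat -> nat) :
    (forall t, f t = if t == i then i.+1 else if t == i.+1 then i else t) ->
    k != l -> ~~ ((k == i) && (l == i.+1)) -> ~~ ((k == i.+1) && (l == i)) ->
  (f k < f l)%N = (k < l)%N.
Proof.
move=> fE /eqP kl; rewrite !fE.
case: (k =P i) => ki; case: (l =P i) => li /=; first by lia.
- by case: eqP => //= li' _ _; lia.
- by rewrite andbT => _; case: eqP => //= ki' _; lia.
by case: (k =P i.+1) => ki'; case: (l =P i.+1) => li' _ _; lia.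
Qed.

Lemma adj_swap_letter s w p q : s \in adj_swaps -> q = p.+1 :> nat ->
  (w^-1 * (s * w))%g \notin adj_swaps ->
  (letter (s * w)%g p < letter (s * w)%g q) = (letter w p < letter w q).
Proof.
case/adj_swapsP=> i [j [ij ->]] pq; rewrite swap_conj => nS.
have pqS : swap (p, false) (q, false) \in adj_swaps by apply/adj_swapsP; exists p, q.
rewrite /letter !WappM.
have ne : (Wapp w (p, false)).1 != (Wapp w (q, false)).1.
  by apply: Wapp_neq1; rewrite neq_ltn /= pq ltnSn.
have {}nS k l b : Wapp w (p, false) = (k, b) -> Wapp w (q, false) = (l, b) ->
    ~~ ((k == i) && (l == j)) && ~~ ((k == j) && (l == i)).
  have inv t k' : Wapp w (t, false) = (k', b) -> Wapp w^-1%g (k', false) = (t, b).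
    move=> E; case: b E => E; last by rewrite -E WappK.
    by rewrite -[(k', false)]/(sopp (k', true)) Wapp_opp -E WappK.
  have bS : swap (p, b) (q, b) \in adj_swaps.
    by case: b {inv} => //; rewrite -swap_sopp.
  move=> /inv wp /inv wq; apply/andP; split; apply: contra nS => /andP[/eqP ki /eqP lj].
    by rewrite -ki -lj wp wq.
  by rewrite -ki -lj wp wq swapC.
case: (Wapp w (p, false)) (Wapp w (q, false)) ne nS => k b [l c] /= kl nS.
have {}nS : b = c -> ~~ ((k == i) && (l == j)) && ~~ ((k == j) && (l == i)).
  by move=> bc; apply: (nS k l b); rewrite ?bc.
pose f (t : nat) := (if t == i then i.+1 else if t == i.+1 then i : nat else t)%N.
have sE (t : 'I_n) d : exists2 t' : 'I_n,
    Wapp (swap (i, false) (j, false)) (t, d) = (t', d) & t' = f t :> nat.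
  rewrite swapE /= -!(inj_eq (@ord_inj n)) ij /f.
  by case: eqP => [_|_]; [exists j | case: eqP => [_|_]; [exists i|exists t]].
move: (Wapp_neq1 (swap (i, false) (j, false)) (x := (k, b)) (y := (l, c)) kl).
have [k' -> k'E] := sE k b; have [l' -> l'E] := sE l c.
have mono : b = c -> (k' < l')%N = (k < l)%N.
  move=> /nS /andP[]; rewrite -!(inj_eq (@ord_inj n)) ij k'E l'E => h1 h2.
  exact: (swap_succ_mono (i := i)).
have kl' : k <> l :> nat by move/ord_inj/eqP; rewrite (negPf kl).
rewrite /= -(inj_eq (@ord_inj n)) !ival_pair => /eqP kl''.
by case: b c nS mono => -[] nS mono; try have := mono erefl; lia.
Qed.

Lemma adj_swap_sign s w p : s \in adj_swaps ->
  (0 < letter (s * w)%g p) = (0 < letter w p).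
Proof.
case/adj_swapsP=> i [j [ij ->]]; rewrite !letter_gt0 WappM swapE /=.
by case: eqP => // _; case: eqP.
Qed.

Lemma swapK x y : (swap x y * swap x y = 1)%g.
Proof.
apply: W_eqP => z; rewrite WappM Wapp1.
have [/eqP|zx] := eqVneq z.1 x.1.
  by rewrite eq_index => /orP[]/eqP->; rewrite ?Wapp_opp swapL swapC swapL.
have [/eqP|zy] := eqVneq z.1 y.1.
  by rewrite eq_index => /orP[]/eqP->; rewrite ?Wapp_opp swapC swapL swapC swapL.
by rewrite (swapE _ _ z) (negPf zx) (negPf zy) swapE (negPf zx) (negPf zy).
Qed.

Lemma adj_swapK s : s \in adj_swaps -> (s * s = 1)%g.
Proof. by case/adj_swapsP=> i [j [_ ->]]; exact: swapK. Qed.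

Lemma xCE C w : xC C w = (w \in XC C)%:R.
Proof.
rewrite /xC sum_ffunE; under eq_bigr => u _ do rewrite ffunE.
have [wX|wX] := boolP (w \in XC C).
  by rewrite (bigD1 w) //= eqxx big1 ?addr0 // => u /andP[_]; rewrite eq_sym => /negPf->.
by rewrite big1 // => u uX; case: eqP => // wu; rewrite -wu (negPf wX) in uX.
Qed.

Lemma xC_tame C : tame adj_swaps (xC C).
Proof.
have stab s w : s \in adj_swaps -> (w^-1 * (s * w))%g \notin adj_swaps ->
    w \in XC C -> (s * w)%g \in XC C.
  move=> sS wS /mem_XC_adjacent[wp wl]; apply/mem_XC_adjacent; split=> [i ci|i j ij l].
    by rewrite adj_swap_sign // wp.
  by rewrite adj_swap_letter // wl.
move=> s w sS wS; rewrite !xCE; congr (_%:R); congr nat_of_bool; apply/idP/idP.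
  have ssw : (s * (s * w) = w)%g by rewrite mulgA adj_swapK // mul1g.
  move=> swX; rewrite -ssw; apply: stab => //.
  have sV : (s^-1 = s)%g by apply/eqP; rewrite eq_invg_mul adj_swapK.
  by rewrite ssw invMg sV -mulgA.
exact: stab.
Qed.

End DescentClasses.

(** * Generic words and the basis x_C *)
Section GenericWords.
Variable n : nat.
Implicit Types (s u v w : W n) (i j p q : 'I_n) (C D : scomp n).

(** The words whose signs and ascents are exactly those prescribed by C, that is,
    one descent class.  Ascents between neighbours of opposite sign are
    determined by the signs. *)
Definition generic C w : Prop :=
  (forall i, (0 < letter w i) = cpos (val C) i) /\
  (forall i j, j = i.+1 :> nat -> cpos (val C) i = cpos (val C) j ->
     (letter w i < letter w j) = linked (val C) i).

Lemma linked_cpos (C : seq int) (p : nat) : linked C p -> cpos C p = cpos C p.+1.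
Proof. by rewrite /cpos => /eqP ->. Qed.

(** By [rearrangement], any integral weights give a word with the signs of the
    weights and with letters in the order of the weights. *)
Lemma generic_exists C : exists w, generic C w.
Proof.
(* Letters increase inside a block and decrease from one block to the next; the
   shift by N.+1, above all values, makes the letters of negative blocks
   negative. *)
pose N := (n * n + n)%N.
pose k (i : 'I_n) : int := ((n - bidx (val C) i) * n + i.+1)%N%:Z
  - (if cpos (val C) i then 0 else N.+1%:Z).
have block_le i : ((n - bidx (val C) i) * n <= n * n)%N.
  by rewrite leq_mul2r leq_subr orbT.
have [kpos kneg] : (forall i, (0 < k i) = cpos (val C) i) /\
    (forall i, (k i < 0) = ~~ cpos (val C) i).
  split=> i; have := block_le i; have := ltn_ord i; rewrite /k /N;
    move: ((n - _) * n)%N (n * n)%N => a b i_n ab;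
    by case: (cpos (val C) i) => /=; lia.
have [w _ [wp wn wl]] := rearrangement [set: W n]%G 1%g k.
move: wp wn wl; rewrite mul1g => wp wn wl; exists w; split=> [i|i j ij cij].
  have [ci|ci] := boolP (cpos (val C) i); first by rewrite wp ?inE ?kpos.
  by apply/negbTE; rewrite -leNgt ltW // wn ?inE ?kneg.
case L: (linked (val C) i).
  apply: wl; rewrite ?inE // /k -cij ij; move/eqP: L => <-; lia.
apply/negbTE; rewrite -leNgt ltW //; apply: wl; rewrite ?inE // /k -cij.
have bn : (bidx (val C) j < n)%N.
  apply: leq_trans (bidx_size C j) _.
  by have := scomp_size C; rewrite size_map.
have lt : (bidx (val C) i < bidx (val C) j)%N.
  by rewrite ltn_neqAle ij leq_bidx // andbT negbT.
have jn := ltn_ord j.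
have : ((n - bidx (val C) j).+1 * n <= (n - bidx (val C) i) * n)%N.
  by rewrite leq_mul2r; apply/orP; right; lia.
by rewrite mulSn; lia.
Qed.

Lemma generic_cover w : exists C, generic C w.
Proof.
pose l t : int := if insub t is Some i then letter w i else 0.
have lE i : l i = letter w i by rewrite /l valK.
pose P t := 0 < l t.
pose L t := (P t == P t.+1) && (l t < l t.+1).
have [|C [CP CL]] := @scomp_of_data n P L; first by move=> t _ /andP[/eqP].
exists C; split=> [i|i j ij cij]; first by rewrite CP // /P lE.
have jn := ltn_ord j; rewrite CL -?ij // /L.
by rewrite -ij -!CP // cij eqxx !lE.
Qed.

Definition rank w i : 'I_n := (Wapp w (i, false)).1.

Lemma rank_inj w : injective (rank w).
Proof.
move=> i j E; apply/eqP/negPn/negP=> ij.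
by have := @Wapp_neq1 _ w (i, false) (j, false) ij; rewrite -/(rank w i) E eqxx.
Qed.

Lemma rankK w : cancel (rank w^-1%g) (rank w).
Proof.
move=> a; rewrite /rank; case E: (Wapp _ (a, false)) => [p c] /=.
have := WappVK w (a, false); rewrite E; case: c {E} => [|->] //.
by rewrite -[(p, true)]/(sopp (p, false)) Wapp_opp => /(congr1 fst).
Qed.

Lemma letter_rank w i : letter w i = ival (rank w i, (letter w i < 0)).
Proof. by rewrite letter_lt0 -surjective_pairing. Qed.

Lemma generic_lt0 C w i : generic C w -> (letter w i < 0) = ~~ cpos (val C) i.
Proof. by case=> <- _; rewrite letter_gt0 letter_lt0 negbK. Qed.

Lemma generic_rank_eq C w w' : generic C w -> generic C w' ->
  rank w =1 rank w' -> w = w'.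
Proof.
move=> wC w'C E; apply: W_eq_pos => i; apply: ival_inj.
rewrite -[LHS]/(letter w i) -[RHS]/(letter w' i).
by rewrite letter_rank E (generic_lt0 i wC) -(generic_lt0 i w'C) -letter_rank.
Qed.

Lemma generic_swap C w s : s \in adj_swaps n ->
  (w^-1 * (s * w))%g \notin adj_swaps n -> generic C w -> generic C (s * w)%g.
Proof.
move=> sS wS [wp wl]; split=> [i|i j ij cij]; first by rewrite adj_swap_sign.
by rewrite adj_swap_letter // wl.
Qed.

(** If the letters of absolute values a and a + 1 were neighbours of equal sign
    in w, their order would be an ascent or a descent shared by w and w'. *)
Lemma generic_swap_notin C w w' (a b : 'I_n) :
    generic C w -> generic C w' -> b = a.+1 :> nat ->
    (rank w' (rank w^-1%g b) < rank w' (rank w^-1%g a))%N ->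
  (w^-1 * (swap (a, false) (b, false) * w))%g \notin adj_swaps n.
Proof.
move=> wC w'C ab; rewrite swap_conj /rank.
case Ea: (Wapp w^-1%g (a, false)) => [p c]; case Eb: (Wapp _ (b, false)) => [q d] /=.
rewrite -[(Wapp w' _).1]/(rank w' _) -[X in (_ < X)%N]/(nat_of_ord (rank w' p)) => lt.
have pq : p != q by apply: contraTneq lt => ->; rewrite ltnn.
apply/adj_swapsP=> -[k [k1 [kk1 E]]].
have := congr1 (fun v => Wapp v (p, c)) E; rewrite swapL swapE /= => {}E.
have {E} [dc pqk] : d = c /\ ((p = k /\ q = k1) \/ (p = k1 /\ q = k)).
  move: E; case: eqP => [->|_]; first by case=> -> ->; split=> //; left.
  case: eqP => [->|_]; first by case=> -> ->; split=> //; right.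
  by case=> qp; rewrite qp eqxx in pq.
have wE t e : Wapp w^-1%g (e, false) = (t, c) -> letter w t = ival (e, c).
  move=> E; have := WappVK w (e, false); rewrite E /letter; case: (c) => [|-> //].
  rewrite -[(t, true)]/(sopp (t, false)) Wapp_opp.
  by rewrite -[(e, true)]/(sopp (e, false)) ival_opp => <-; rewrite ival_opp opprK.
have wp := wE _ _ Ea; rewrite dc in Eb; have wq := wE _ _ Eb.
have c_lt0 t (e : 'I_n) : letter w t = ival (e, c) -> c = ~~ cpos (val C) t.
  move=> E; rewrite -(generic_lt0 t wC) E ival_pair; case: (c); lia.
have cp := c_lt0 _ _ wp; have cq := c_lt0 _ _ wq.
have w'p : letter w' p = ival (rank w' p, c).
  by rewrite letter_rank (generic_lt0 _ w'C) -cp.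
have w'q : letter w' q = ival (rank w' q, c).
  by rewrite letter_rank (generic_lt0 _ w'C) -cq.
have cpq : cpos (val C) p = cpos (val C) q by apply: negb_inj; rewrite -cp -cq.
have [[_ wl] [_ w'l]] := (wC, w'C).
case: pqk => -[pk qk]; subst k k1.
  have := wl _ _ kk1 cpq; rewrite -(w'l _ _ kk1 cpq) wp wq w'p w'q !ival_pair ab.
  by case: (c); lia.
have := wl _ _ kk1 (esym cpq); rewrite -(w'l _ _ kk1 (esym cpq)) wp wq w'p w'q.
by rewrite !ival_pair ab; case: (c); lia.
Qed.

(** While w differs from w', some consecutive values a, a + 1 stand in the
    opposite order in w'.  Exchanging them in w stays in the class and increases
    [phi], the scalar product of the rank vectors of w and w', so this ends
    at w'. *)
Lemma tame_generic (K : fieldType) (f : galg K (W n)) C w w' :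
  tame (adj_swaps n) f -> generic C w -> generic C w' -> f w = f w'.
Proof.
move=> tf wC w'C.
pose phi v := (\sum_i rank w' i * rank v i)%N.
have phi_le v : (phi v <= n * (n * n))%N.
  rewrite /phi -[X in (_ <= X * _)%N]card_ord -sum_nat_const.
  by apply: leq_sum => i _; rewrite leq_mul // ltnW.
have [m] := ubnP (n * (n * n) - phi w)%N; elim: m w wC => // m IH w wC le.
pose g a := rank w' (rank w^-1%g a).
have [/forallP incr|] :=
    boolP [forall a : 'I_n, forall b : 'I_n, (b == a.+1 :> nat) ==> (g a < g b)%N].
  have g_id a : g a = a.
    by apply: incr_ord_id => {}a b ab; have /forallP/(_ b) := incr a; rewrite ab eqxx.
  congr (f _); apply: (generic_rank_eq wC w'C) => i.
  have wVK : rank w^-1%g (rank w i) = i by apply: (@rank_inj w); rewrite rankK.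
  by rewrite -[LHS](g_id (rank w i)) /g wVK.
case/forallPn=> a /forallPn[b]; rewrite negb_imply => /andP[/eqP ab].
rewrite -leqNgt leq_eqVlt => /predU1P[/ord_inj/rank_inj/rank_inj ba|lt].
  by have := ab; rewrite ba => /eqP; rewrite -[_ == _]/(_ == _)%N; lia.
have sS : swap (a, false) (b, false) \in adj_swaps n by apply/adj_swapsP; exists a, b.
have wS := generic_swap_notin wC w'C ab lt.
rewrite -(tf _ _ sS wS); apply: IH; first exact: generic_swap.
suff : (phi w < phi (swap (a, false) (b, false) * w)%g)%N.
  move: le (phi_le w) (phi_le (swap (a, false) (b, false) * w)%g).
  by move: (n * (n * n))%N (phi w) (phi (_ * w)%g) => N x y; lia.
have rankS i : rank (swap (a, false) (b, false) * w)%g i =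
    if rank w i == a then b else if rank w i == b then a else rank w i.
  by rewrite /rank WappM swapE /=; case: eqP => // _; case: eqP.
rewrite /phi; set p := rank w^-1%g a; set q := rank w^-1%g b.
have {}lt : (rank w' q < rank w' p)%N by [].
have [pa qb] : rank w p = a /\ rank w q = b by rewrite !rankK.
have pq : q != p by apply: contraTneq lt => ->; rewrite ltnn.
have ba : (b == a) = false by rewrite -(inj_eq (@ord_inj n)) ab gtn_eqF.
rewrite (bigD1 p) // (bigD1 q) //= [X in (_ < X)%N](bigD1 p) //.
rewrite [X in (_ < _ + X)%N](bigD1 q) //=.
rewrite !rankS pa qb eqxx ba eqxx !addnA.
have eqr i : (i != p) && (i != q) ->
    (rank w' i * rank (swap (a, false) (b, false) * w)%g i = rank w' i * rank w i)%N.
  case/andP=> ip iq; rewrite rankS -[X in _ == X]pa (inj_eq (@rank_inj w)) (negPf ip).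
  by rewrite -[X in _ == X]qb (inj_eq (@rank_inj w)) (negPf iq).
by rewrite (eq_bigr _ eqr) ltn_add2r ab !mulnS; lia.
Qed.

End GenericWords.

Section MantaciReutenauerBasis.
Variable n : nat.
Implicit Types (w : W n) (C D : scomp n).
Implicit Types (f g : galg rat (W n)).

(** The lexicographic order on (number of positive positions, number of links),
    as a single integer; the number of links is at most n. *)
Definition class_key C : nat :=
  ((\sum_(i < n) cpos (val C) i) * n.+1
   + \sum_(i < n | (i.+1 < n)%N) linked (val C) i)%N.

(** A generic word of C belongs to X_D only if the positive positions of D are
    positive in C and, when the signs agree, only if D refines C. *)
Lemma generic_class_key C D w :
  generic C w -> w \in XC D -> D != C -> (class_key D < class_key C)%N.
Proof.
move=> wC /mem_XC_adjacent[wp wl] DC.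
have [Cp Cl] := wC.
have ple (i : 'I_n) : (cpos (val D) i <= cpos (val C) i
    ?= iff (cpos (val D) i == cpos (val C) i))%N.
  have := wp i; rewrite Cp; case: (cpos (val D) i) => [->|_] //.
  by split=> //; case: (cpos _ _).
have [ple1 pE] := leqif_sum (fun i (_ : true) => ple i).
have links_le (E : scomp n) : (\sum_(i < n | (i.+1 < n)%N) linked (val E) i <= n)%N.
  rewrite -[X in (_ <= X)%N]card_ord -sum1_card big_mkcond /=.
  by apply: leq_sum => i _; case: ifP => // _; case: (linked _ _).
rewrite /class_key; move: ple1; rewrite leq_eqVlt pE => /orP[/forallP posE|lt]; last first.
  apply: (@leq_trans ((\sum_(i < n) cpos (val D) i).+1 * n.+1)%N).
    by rewrite mulSn addnC ltn_add2r ltnS links_le.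
  by apply: leq_trans (leq_addr _ _); rewrite leq_mul2r lt orbT.
have {}posE (i : 'I_n) : cpos (val D) i = cpos (val C) i.
  by have /eqP := posE i; case: (cpos _ _); case: (cpos _ _).
have lle (i : 'I_n) : (i.+1 < n)%N -> (linked (val D) i <= linked (val C) i
    ?= iff (linked (val D) i == linked (val C) i))%N.
  move=> iS; pose j := Ordinal iS; have := wl i j erefl.
  case L: (linked (val D) i) => lt; last by split=> //; case: (linked _ _).
  have cij : cpos (val C) i = cpos (val C) j by rewrite -!posE linked_cpos.
  by rewrite -(Cl i j erefl cij) (lt isT).
have -> : (\sum_(i < n) cpos (val D) i = \sum_(i < n) cpos (val C) i)%N.
  by apply: eq_bigr => i _; rewrite posE.
have [le_links lE] := @leqif_sum 'I_n (fun i : 'I_n => (i.+1 < n)%N)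
  (fun i : 'I_n => linked (val D) i == linked (val C) i)
  (fun i : 'I_n => linked (val D) i) (fun i : 'I_n => linked (val C) i) lle.
rewrite ltn_add2l ltn_neqAle le_links andbT lE; apply: contra DC => /forallP {}lE.
apply/eqP/val_inj/scomp_unique; rewrite ?scomp_neq0 ?sumn_csizes // => p pn.
  exact: (posE (Ordinal pn)).
have := lE (Ordinal (ltnW pn)); rewrite /= pn /=.
by case: (linked _ _); case: (linked _ _).
Qed.

Lemma generic_XC C w : generic C w -> w \in XC C.
Proof.
move=> [wp wl]; apply/mem_XC_adjacent; split=> [i ci|i j ij l]; first by rewrite wp.
by rewrite wl // ij linked_cpos.
Qed.

(** The values of the x_D on generic words form a matrix that is unitriangular
    for [class_key]. *)
Lemma xC_triangular (a : scomp n -> rat) :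
    (forall C, exists2 w, generic C w & \sum_D a D * xC D w = 0) ->
  forall C, a C = 0.
Proof.
move=> a0 C0; apply/eqP/negPn/negP=> aC0.
case: (@arg_minnP _ C0 (fun C => a C != 0) class_key aC0) => C aC Cmin; have [w wC] := a0 C.
rewrite (bigD1 C) //= big1 ?addr0 => [|D DC].
  by rewrite xCE generic_XC // mulr1; apply/eqP.
rewrite xCE; have [wD|] := boolP (w \in XC D); last by rewrite mulr0.
have := generic_class_key wC wD DC; rewrite ltnNge => /negP lt.
by have [->|/Cmin //] := eqVneq (a D) 0; rewrite mul0r.
Qed.

Lemma xC_tupleE (i : 'I_#|{: scomp n}|) : (xC_tuple n)`_i = xC (enum_val i).
Proof. by rewrite -tnth_nth tnth_mktuple. Qed.

Lemma xC_sumE (a : scomp n -> rat) w :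
  (\sum_(i < #|{: scomp n}|) a (enum_val i) *: (xC_tuple n)`_i) w
   = \sum_D a D * xC D w.
Proof.
rewrite sum_ffunE (reindex (enum_val : 'I_#|{: scomp n}| -> _)) /=; last first.
  exact/onW_bij/enum_val_bij.
by apply: eq_bigr => i _; rewrite ffunE xC_tupleE.
Qed.

Lemma xC_free : free (xC_tuple n).
Proof.
apply/freeP=> k k0 i.
pose a D := k (enum_rank D).
have aE j : k j = a (enum_val j) by rewrite /a enum_valK.
rewrite aE; apply: xC_triangular => C; have [w wC] := generic_exists C.
exists w => //; rewrite -xC_sumE.
rewrite (_ : \sum_j _ = 0) ?ffunE // -[RHS]k0.
by apply: eq_bigr => j _; rewrite aE.
Qed.

(** By triangularity, some combination of the x_C takes the values of f on one
    generic word for each composition; a function constant on the classes is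
    determined by these values since every word is generic for some C. *)
Lemma mem_MR f : f \in MR n <-> tame (adj_swaps n) f.
Proof.
split=> [/coord_span->|tf].
  elim/big_ind: _ => [|g h tg th|i _]; first exact: tame0.
    by rewrite -[g]scale1r; exact: tame_lin.
  rewrite xC_tupleE -[_ *: _]addr0; apply: tame_lin; last exact: tame0.
  exact: xC_tame.
pose N := #|{: scomp n}|.
pose wg C := projT1 (cid (generic_exists C)).
have wgP C : generic C (wg C) := projT2 (cid (generic_exists C)).
pose M : 'M[rat]_N := \matrix_(i, j) xC (enum_val i) (wg (enum_val j)).
have Mu : M \in unitmx.
  rewrite -row_free_unit -kermx_eq0; apply/rowV0P=> a /sub_kermxP aM.
  apply/rowP=> i; rewrite mxE -[i]enum_valK.
  move: (enum_val i); apply: (@xC_triangular (fun C => a 0 (enum_rank C))) => C.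
  exists (wg C); first exact: wgP.
  have /rowP/(_ (enum_rank C)) := aM; rewrite !mxE => aMC.
  rewrite (reindex (enum_val : 'I_N -> _)) /=; last exact/onW_bij/enum_val_bij.
  by rewrite -[RHS]aMC; apply: eq_bigr => j _; rewrite mxE enum_valK enum_rankK.
pose b : 'rV[rat]_N := \row_j f (wg (enum_val j)).
pose a := b *m invmx M.
pose g : galg rat (W n) := \sum_(i < N) a 0 i *: (xC_tuple n)`_i.
have gMR : g \in MR n.
  by apply: memv_suml => i _; rewrite memvZ // memv_span // mem_nth // size_tuple.
suff -> : f = g by [].
have tg : tame (adj_swaps n) g.
  rewrite /g; elim/big_ind: _ => [|g' h tg th|i _]; first exact: tame0.
    by rewrite -[g']scale1r; exact: tame_lin.
  rewrite xC_tupleE -[_ *: _]addr0; apply: tame_lin; last exact: tame0.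
  exact: xC_tame.
apply/ffunP=> w; have [C wC] := generic_cover w.
rewrite (tame_generic tf wC (wgP C)) (tame_generic tg wC (wgP C)).
have : b = a *m M by rewrite mulmxKV.
move/rowP/(_ (enum_rank C)); rewrite !mxE enum_rankK => ->.
rewrite /g sum_ffunE; apply: eq_bigr => i _.
by rewrite ffunE xC_tupleE [M _ _]mxE enum_rankK.
Qed.

Lemma MR_mul : {in MR n &, forall f g, f * g \in MR n}.
Proof. by move=> f g /mem_MR tf /mem_MR tg; apply/mem_MR/tame_mul. Qed.

Lemma xC_MR C : xC C \in MR n.
Proof. exact/mem_MR/xC_tame. Qed.

End MantaciReutenauerBasis.

(** * Insertion and deletion of a position *)
Section Insertion.
Variable n : nat.
Implicit Types (x : sidx n) (y z : sidx n.+1) (w : W n) (v : W n.+1).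

Definition skip (q : 'I_n.+1) x : sidx n.+1 := (lift q x.1, x.2).
Definition up x := skip ord_max x.
Definition top b : sidx n.+1 := (ord_max, b).

Lemma sidxSP z : (exists x, z = up x) \/ (exists b, z = top b).
Proof.
case: z => i b; case: (unliftP ord_max i) => [j ->|->]; last by right; exists b.
by left; exists (j, b).
Qed.

Lemma skip_inj q : injective (skip q).
Proof.
move=> [i b] [j c] E; congr (_, _); last exact: (congr1 snd E).
exact: lift_inj (congr1 fst E).
Qed.

Lemma skip_opp q x : skip q (sopp x) = sopp (skip q x). Proof. by []. Qed.

Lemma ival_skip q x x' : (ival (skip q x) < ival (skip q x')) = (ival x < ival x').
Proof.
case: x x' => i b [j c]; rewrite /skip !ival_pair /= /bump.
by case: (leqP q i); case: (leqP q j); case: b; case: c => /=; lia.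
Qed.

Lemma ival_skip_gt0 q x : (0 < ival (skip q x)) = (0 < ival x).
Proof. by rewrite !ival_gt0. Qed.

(** Every v in W_(n+1) is [insW y w] for a unique pair: y is the image of n+1,
    and w is the pattern of the first n letters, whose values avoid |y|. *)
Section Insert.
Variables (y : sidx n.+1) (w : W n).

Definition insW_fun z : sidx n.+1 :=
  if unlift ord_max z.1 is Some i then skip y.1 (Wapp w (i, z.2))
  else (y.1, z.2 (+) y.2).

Fact insW_up_subproof x : insW_fun (up x) = skip y.1 (Wapp w x).
Proof. by case: x => i b; rewrite /insW_fun /= liftK. Qed.

Fact insW_top_subproof b : insW_fun (top b) = (y.1, b (+) y.2).
Proof. by rewrite /insW_fun /= unlift_none. Qed.

Fact insW_inj : injective insW_fun.
Proof.
move=> z z'; have [[x ->]|[b ->]] := sidxSP z; have [[x' ->]|[c ->]] := sidxSP z';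
  rewrite ?insW_up_subproof ?insW_top_subproof.
- by move=> /skip_inj/Wapp_inj->.
- by case=> E; have := neq_lift y.1 (Wapp w x).1; rewrite E eqxx.
- by case=> E; have := neq_lift y.1 (Wapp w x').1; rewrite -E eqxx.
by case=> /addIb->.
Qed.

Fact insW_opp z : insW_fun (sopp z) = sopp (insW_fun z).
Proof.
have [[x ->]|[b ->]] := sidxSP z.
  by rewrite -skip_opp !insW_up_subproof Wapp_opp.
by rewrite -[sopp _]/(top (~~ b)) !insW_top_subproof /sopp /= addNb.
Qed.

Definition insW : W n.+1 := mkW insW_inj insW_opp.

Lemma insW_up x : Wapp insW (up x) = skip y.1 (Wapp w x).
Proof. by rewrite mkWE insW_up_subproof. Qed.

Lemma insW_top b : Wapp insW (top b) = (y.1, b (+) y.2).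
Proof. by rewrite mkWE insW_top_subproof. Qed.

Lemma insW_top0 : Wapp insW (top false) = y.
Proof. by rewrite insW_top -surjective_pairing. Qed.
End Insert.

(** The embedding of W_n as the stabilizer of n+1. *)
Definition liftW w := insW (top false) w.
(** The element of X_(n,-1) that maps n+1 to y. *)
Definition cosetW y := insW y 1%g.

Lemma cosetW_up y x : Wapp (cosetW y) (up x) = skip y.1 x.
Proof. by rewrite insW_up Wapp1. Qed.

Lemma liftW_up w x : Wapp (liftW w) (up x) = up (Wapp w x).
Proof. exact: insW_up. Qed.

Lemma liftW_top w b : Wapp (liftW w) (top b) = top b.
Proof. by rewrite insW_top addbF. Qed.

Lemma W_eq_up v v' : (forall x, Wapp v (up x) = Wapp v' (up x)) ->
  Wapp v (top false) = Wapp v' (top false) -> v = v'.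
Proof.
move=> E Et; apply: W_eqP => z; have [[x ->]|[[] ->]] := sidxSP z => //.
by rewrite -[top true]/(sopp (top false)) !Wapp_opp Et.
Qed.

Lemma insW_mul y w w' : (insW y w * liftW w')%g = insW y (w * w')%g.
Proof.
apply: W_eq_up => [x|]; rewrite WappM; first by rewrite liftW_up !insW_up WappM.
by rewrite liftW_top !insW_top0.
Qed.

Lemma insWE y w : insW y w = (cosetW y * liftW w)%g.
Proof. by rewrite insW_mul mul1g. Qed.

Lemma liftW_mul : {morph liftW : w w' / (w * w')%g}.
Proof. by move=> w w'; rewrite /liftW insW_mul. Qed.

Lemma liftW1 : liftW 1%g = 1%g.
Proof. by apply: W_eq_up => [x|]; rewrite ?liftW_up ?liftW_top !Wapp1. Qed.

Lemma liftWV w : liftW w^-1%g = (liftW w)^-1%g.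
Proof. by apply/eqP; rewrite eq_sym eq_invg_mul -liftW_mul mulgV liftW1. Qed.

Lemma liftW_inj : injective liftW.
Proof.
move=> w w' E; apply: W_eqP => x; apply: (@skip_inj ord_max).
by rewrite -!/(up _) -!liftW_up E.
Qed.

Lemma insW_inj2 y y' w w' : insW y w = insW y' w' -> y = y' /\ w = w'.
Proof.
move=> E; have yy : y = y' by rewrite -(insW_top0 y w) E insW_top0.
by split=> //; move: E; rewrite yy !insWE => /mulgI/liftW_inj.
Qed.

Lemma fix_topP v : Wapp v (top false) = top false -> exists w, v = liftW w.
Proof.
move=> vt.
have vup x : exists x', Wapp v (up x) == up x'.
  have [[x' ->]|[b E]] := sidxSP (Wapp v (up x)); first by exists x'.
  have := @Wapp_neq1 _ v (up x) (top false); rewrite E vt /= eqxx.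
  by rewrite eq_sym neq_lift => /(_ isT).
pose f x := xchoose (vup x).
have fE x : Wapp v (up x) = up (f x) by apply/eqP/(xchooseP (vup x)).
have f_inj : injective f.
  by move=> x x' E; apply/(@skip_inj ord_max)/(@Wapp_inj _ v); rewrite -!/(up _) !fE E.
have f_opp x : f (sopp x) = sopp (f x).
  by apply: (@skip_inj ord_max); rewrite -/(up _) -fE skip_opp -/(up _) -fE -Wapp_opp.
exists (mkW f_inj f_opp); apply: W_eq_up => [x|]; last by rewrite liftW_top.
by rewrite liftW_up mkWE fE.
Qed.

Lemma insWP v : exists w, v = insW (Wapp v (top false)) w.
Proof.
set y := Wapp v _; have [|w E] := @fix_topP ((cosetW y)^-1 * v)%g.
  by rewrite WappM -/y -{2}(insW_top0 y 1%g) WappK.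
by exists w; rewrite insWE -E mulKVg.
Qed.

Lemma sum_insW (M : nmodType) (F : W n.+1 -> M) :
  \sum_v F v = \sum_w \sum_y F (liftW w * (cosetW y)^-1)%g.
Proof.
rewrite (reindex_inj (@invg_inj _)) /=.
rewrite (reindex (fun t : sidx n.+1 * W n => insW t.1 t.2)) /=; last first.
  exists (fun v => (Wapp v (top false),
                    odflt 1%g [pick u | v == insW (Wapp v (top false)) u])).
    case=> z u _ /=; rewrite insW_top0; congr (_, _).
    case: pickP => [u' /eqP/insW_inj2[_ ->] //|/(_ u)]; by rewrite eqxx.
  move=> v _ /=; case: pickP => [u /eqP <-//|none].
  by have [u vE] := insWP v; have := none u; rewrite -vE eqxx.
rewrite -(pair_bigA _ (fun z u => F (insW z u)^-1%g)) /= exchange_big /=.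
rewrite (reindex_inj (@invg_inj (W n))); apply: eq_bigr => w _; apply: eq_bigr => y _.
by rewrite insWE invMg liftWV invgK.
Qed.

(** As blocks are intervals, the positions other than q carry the blocks of a
    composition. *)
Fact del_exists (D : scomp n.+1) (q : 'I_n.+1) : exists C : scomp n,
  forall t, (t < n)%N -> cpos (val C) t = cpos (val D) (bump q t) /\
  ((t.+1 < n)%N -> linked (val C) t = (bidx (val D) (bump q t) == bidx (val D) (bump q t.+1))).
Proof.
have [|C [CP CL]] := @scomp_of_data n (fun t => cpos (val D) (bump q t))
    (fun t => bidx (val D) (bump q t) == bidx (val D) (bump q t.+1)).
  by move=> t _ /eqP E; rewrite /cpos E.
by exists C => t tn; split; [exact: CP | exact: CL].
Qed.

Definition del_pos D q : scomp n := projT1 (cid (del_exists D q)).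

Lemma cpos_del D q (i : 'I_n) : cpos (val (del_pos D q)) i = cpos (val D) (lift q i).
Proof. by rewrite /del_pos; case: cid => C /= /(_ i (ltn_ord i)) []. Qed.

Lemma bidx_del D q (i j : 'I_n) : bidx (val (del_pos D q)) i = bidx (val (del_pos D q)) j <->
  bidx (val D) (lift q i) = bidx (val D) (lift q j).
Proof.
rewrite /del_pos; case: cid => C /= CD.
have mono (a b : nat) : (a <= b)%N -> (bidx (val D) (bump q a) <= bidx (val D) (bump q b))%N.
  by move=> ab; apply: leq_bidx; rewrite leq_bump2.
have main (a b : nat) : (a <= b < n)%N -> bidx (val C) a = bidx (val C) b <->
    bidx (val D) (bump q a) = bidx (val D) (bump q b).
  case/andP=> ab bn; rewrite (bidx_linked _ ab); split=> [L|E t /andP[at_ tb]].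
    elim: b ab bn L => [|b IH]; first by rewrite leqn0 => /eqP->.
    rewrite leq_eqVlt => /predU1P[-> //|ab] bn L; have bn' := ltnW bn.
    rewrite IH // => [|t /andP[at_ tb]]; last by apply: L; rewrite at_ ltnW.
    have [_ /(_ bn) CL] := CD b bn'; apply/eqP; rewrite -CL; apply: L.
    by rewrite -ltnS ab leqnn.
  have tn : (t.+1 < n)%N by apply: leq_ltn_trans bn.
  have [_ ->//] := CD t (ltnW tn); rewrite eqn_leq mono //=.
  by rewrite (leq_trans (mono _ _ tb)) // -E mono.
case: (leqP i j) => [ij|/ltnW ji]; first by apply: main; rewrite ij ltn_ord.
have [|h1 h2] := main j i; first by rewrite ji ltn_ord.
by split=> E; apply/esym; [apply: h1|apply: h2].
Qed.

Lemma lab_del D q x x' : lab (val (del_pos D q)) x = lab (val (del_pos D q)) x' <->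
  lab (val D) (skip q x) = lab (val D) (skip q x').
Proof.
rewrite /lab !cpos_del /=; split=> -[/bidx_del-> ->] //.
Qed.

(** Deleting q or q' from the same block labels the remaining positions alike:
    the two numberings only differ between q and q', inside this block. *)
Lemma lab_skip_block (C : seq int) (q q' : 'I_n.+1) x : bidx C q = bidx C q' ->
  lab C (skip q x) = lab C (skip q' x).
Proof.
suff main (a b : 'I_n.+1) : (a <= b)%N -> bidx C a = bidx C b ->
    bidx C (bump a x.1) = bidx C (bump b x.1).
  move=> E; rewrite /lab /cpos /=.
  suff -> : bidx C (bump q x.1) = bidx C (bump q' x.1) by [].
  by case: (leqP q q') => [|/ltnW] h; [exact: main|rewrite (main _ _ h)].
move=> ab E; rewrite /bump; case: (leqP a x.1) => ax; case: (leqP b x.1) => bx //.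
  rewrite (@bidx_convex C a b x.1) ?(@bidx_convex C a b x.1.+1) //; lia.
by have := leq_ltn_trans bx ax; lia.
Qed.

Lemma XC_insW D y v w :
  (v * cosetW y)%g = insW (Wapp v y) w -> v \in XC D -> w \in XC (del_pos D y.1).
Proof.
move=> E /mem_XC[vp vl].
have vE i : ival (Wapp v (lift y.1 i, false)) = ival (skip (Wapp v y).1 (Wapp w (i, false))).
  by rewrite -insW_up -E WappM cosetW_up.
apply/mem_XC; split=> [i|i j ij /bidx_del bE].
  by rewrite cpos_del => /vp; rewrite vE ival_skip_gt0.
rewrite -(ival_skip (Wapp v y).1) -!vE; apply: vl => //=.
by rewrite -[(_ < _)%N]/((bump _ i).+1 <= bump _ j)%N ltnNge leq_bump2 -ltnNge.
Qed.

Lemma XC_del_lab (D : scomp n.+1) (q q' : 'I_n.+1) :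
  bidx (val D) q = bidx (val D) q' ->
  XC (del_pos D q) = XC (del_pos D q').
Proof.
move=> qq; have b t : bidx (val D) (lift q t) = bidx (val D) (lift q' t).
  by have := @lab_skip_block (val D) q q' (t, false) qq; rewrite /lab /= => -[].
apply/setP=> w; apply/idP/idP=> /mem_XC[wp wl]; apply/mem_XC; split=> [i|i j ij].
- by move=> ci; apply: wp; rewrite cpos_del /cpos b -/(cpos _ _) -cpos_del.
- by move=> /bidx_del bij; apply: wl => //; apply/bidx_del; rewrite !b.
- by move=> ci; apply: wp; rewrite cpos_del /cpos -b -/(cpos _ _) -cpos_del.
by move=> /bidx_del bij; apply: wl => //; apply/bidx_del; rewrite -!b.
Qed.

(** [cosetW y] and [cosetW y'] agree up to labels on all positions when y and y'
    lie in one orbit. *)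
Lemma cosetW_ratio_WC D y y' : lab (val D) y = lab (val D) y' ->
  (cosetW y * (cosetW y')^-1)%g \in WC D.
Proof.
move=> yy; apply/mem_WC => t; rewrite WappM -{2}(WappVK (cosetW y') t).
set s := Wapp _ t; have [[x ->]|[b ->]] := sidxSP s.
  by rewrite !cosetW_up; apply: lab_skip_block; case: yy.
case: b; last by rewrite !insW_top0.
by rewrite -[top true]/(sopp (top false)) !Wapp_opp !insW_top0; apply/lab_oppP.
Qed.

Lemma insertion_unique D v y y' : lab (val D) y = lab (val D) y' ->
  (v * (cosetW y)^-1)%g \in XC D -> (v * (cosetW y')^-1)%g \in XC D -> y = y'.
Proof.
move=> yy vX vX'.
have kWD := cosetW_ratio_WC yy.
have : (cosetW y * (cosetW y')^-1 = 1)%g.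
  by apply: XC_unique vX kWD _; rewrite mulgA mulgKV.
by move/eqP; rewrite -eq_mulgV1 => /eqP/insW_inj2[].
Qed.

(** Start from any place [y0] in the orbit and sort the resulting word inside the
    blocks of D by some h in W_D, which moves the place to y = h^-1 y0.  On the
    other positions h is an element of W_C, with C the deletion, that takes w
    to an element of X_C; w is one already, so h does nothing there. *)
Lemma insertion_exists D v w y0 z : v = insW z w -> w \in XC (del_pos D y0.1) ->
  exists2 y, lab (val D) y = lab (val D) y0 & (v * (cosetW y)^-1)%g \in XC D.
Proof.
move=> vE wX; have [h hD uX] := XC_transversal D (v * (cosetW y0)^-1)%g.
pose y := Wapp h^-1%g y0.
have hy : Wapp h y = y0 by rewrite WappVK.
have yy : lab (val D) y = lab (val D) y0 by have /mem_WC/(_ y) := hD; rewrite hy.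
exists y => //.
have [|w1 w1E] := @fix_topP ((cosetW y0)^-1 * h * cosetW y)%g.
  by rewrite !WappM insW_top0 hy -{2}(insW_top0 y0 1%g) WappK.
have hkE : (h * cosetW y = cosetW y0 * liftW w1)%g by rewrite -w1E !mulgA mulgV mul1g.
have w1C : w1 \in WC (del_pos D y0.1).
  apply/mem_WC => x; apply/lab_del; rewrite -cosetW_up -liftW_up -WappM -hkE WappM cosetW_up.
  have /mem_WC -> := hD; apply: lab_skip_block.
  by case: yy.
have w1X : (w * w1)%g \in XC (del_pos D y0.1).
  rewrite -(@XC_del_lab D y.1); last by case: yy.
  apply: (XC_insW (v := (v * (cosetW y0)^-1 * h)%g)) uX.
  rewrite WappM hy -mulgA hkE !mulgA mulgKV vE insW_mul; congr insW.
  by rewrite WappM -{2}(insW_top0 y0 1%g) WappK insW_top0.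
have w1_1 := XC_unique wX w1C w1X.
have -> : (cosetW y = h^-1 * cosetW y0)%g.
  by apply: (mulgI h); rewrite hkE w1_1 liftW1 mulg1 mulKVg.
by rewrite invMg invgK mulgA.
Qed.

(** The sum runs over the places in one W_D-orbit at which the last letter of
    [insW z w] can be inserted: the word obtained is in X_D for exactly one of
    them if w is in X_C, and for none otherwise. *)
Lemma insertion_count D z w y0 :
  (\sum_(y | lab (val D) y == lab (val D) y0) ((insW z w * (cosetW y)^-1)%g \in XC D)
   = (w \in XC (del_pos D y0.1)))%N.
Proof.
have [wX|wX] := boolP (w \in XC (del_pos D y0.1)).
  have [y yy yX] := insertion_exists erefl wX (z := z).
  rewrite (bigD1 y) ?yy //= yX big1 // => y' /andP[/eqP yy' ne]; apply/eqP.
  rewrite eqb0; apply: contra ne => y'X; apply/eqP.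
  by apply: (insertion_unique _ y'X yX); rewrite yy.
rewrite big1 // => y /eqP yy; apply/eqP; rewrite eqb0; apply: contra wX => yX.
rewrite -(@XC_del_lab D y.1); last by case: yy.
by apply: XC_insW yX; rewrite mulgKV WappM -{2}(insW_top0 y 1%g) WappK insW_top0.
Qed.

End Insertion.

(** * The restriction morphism *)
Section Compositions.
Variable n : nat.

Fact one_block_exists : exists C : scomp n,
  (forall p, (p < n)%N -> cpos (val C) p) /\
  (forall p, (p.+1 < n)%N -> linked (val C) p).
Proof.
have [//|C [CP CL]] := @scomp_of_data n (fun=> true) (fun=> true).
by exists C; split=> p pn; rewrite ?CP ?CL.
Qed.

Definition one_block : scomp n := projT1 (cid one_block_exists).

Lemma WC_one_block w : w \in WC one_block.
Proof.
rewrite /one_block; case: cid => C /= [CP CL].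
have b (i j : 'I_n) : bidx (val C) i = bidx (val C) j.
  have main (a c : 'I_n) : (a <= c)%N -> bidx (val C) a = bidx (val C) c.
    move=> ac; apply/(bidx_linked _ ac) => t /andP[_ tc].
    by apply: CL; exact: leq_ltn_trans (ltn_ord c).
  by case: (leqP i j) => [|/ltnW] h; [exact: main | rewrite (main _ _ h)].
by apply/mem_WC => x; rewrite /lab !CP // !andbF (b _ x.1).
Qed.

Lemma letter1 i : letter (1%g : W n) i = i.*2.+1%:Z.
Proof. by rewrite /letter Wapp1 ival_pair. Qed.

Lemma XC_one (C : scomp n) : 1%g \in XC C.
Proof.
apply/mem_XC; split=> [i _|i j ij _]; rewrite -!/(letter _ _) !letter1 ?ltz_nat //.
by rewrite ltnS ltn_double.
Qed.

Lemma XC_one_block w : (w \in XC one_block) = (w == 1%g).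
Proof.
apply/idP/eqP=> [wX|->]; last exact: XC_one.
by apply: (XC_unique (XC_one one_block) (WC_one_block w)); rewrite mul1g.
Qed.

Lemma gbasisE (u w : W n) : gbasis rat u w = (w == u)%:R.
Proof. by rewrite ffunE. Qed.

Lemma MR1 : 1 \in MR n.
Proof.
suff -> : 1 = xC one_block by exact: xC_MR.
by apply/ffunP=> w; rewrite xCE XC_one_block -[1]/(gbasis rat 1%g) gbasisE.
Qed.

End Compositions.

Section Snoc.
Variable n : nat.
Implicit Types (C : scomp n).

Fact snoc_exists C : exists D : scomp n.+1,
  (forall p, (p < n.+1)%N -> cpos (val D) p = (p < n)%N && cpos (val C) p) /\
  (forall p, (p.+1 < n.+1)%N -> linked (val D) p = (p.+1 < n)%N && linked (val C) p).
Proof.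
apply: scomp_of_data => p pn /andP[pn' l].
by rewrite pn' (ltnW pn') (linked_cpos l).
Qed.

(** The composition C followed by a part -1 ([val_snoc]). *)
Definition snoc C : scomp n.+1 := projT1 (cid (snoc_exists C)).

Lemma cpos_snoc C p : (p < n.+1)%N -> cpos (val (snoc C)) p = (p < n)%N && cpos (val C) p.
Proof. by rewrite /snoc; case: cid => D /= [] CP _ /CP. Qed.

Lemma linked_snoc C p : (p.+1 < n.+1)%N ->
  linked (val (snoc C)) p = (p.+1 < n)%N && linked (val C) p.
Proof. by rewrite /snoc; case: cid => D /= [] _ CL /CL. Qed.

Lemma XC_snoc C z (w : W n) : (insW z w \in XC (snoc C)) = (w \in XC C).
Proof.
have vE (i : 'I_n) : letter (insW z w) (lift ord_max i) = ival (skip z.1 (Wapp w (i, false))).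
  by rewrite /letter -insW_up.
apply/idP/idP=> /mem_XC_adjacent[wp wl]; apply/mem_XC_adjacent; split=> [i|i j ij l].
- move=> ci; rewrite /letter -(ival_skip_gt0 z.1) -vE; apply: wp.
  by rewrite cpos_snoc ?ltn_ord // lift_max ltn_ord.
- rewrite /letter -(ival_skip z.1) -!vE; apply: wl; first by rewrite !lift_max.
  by rewrite lift_max linked_snoc ?ltnS ?ltn_ord // -ij ltn_ord.
- rewrite cpos_snoc //; case: (unliftP ord_max i) => [k ->|->]; last by rewrite /= ltnn.
  by rewrite lift_max => /andP[_ ck]; rewrite vE ival_skip_gt0; apply: wp.
have jn := ltn_ord j; move: l; rewrite linked_snoc -?ij // => /andP[jn' l].
have in' : (i < n)%N by apply: ltn_trans jn'; rewrite ij.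
have iE : i = lift ord_max (Ordinal in') by apply/ord_inj; rewrite lift_max.
have jE : j = lift ord_max (Ordinal jn') by apply/ord_inj; rewrite lift_max.
by rewrite iE jE !vE ival_skip; apply: wl.
Qed.

End Snoc.

Lemma galg_scaleE (K : fieldType) (gT : finGroupType) (c : K) (f : galg K gT) u :
  (c *: f) u = c * f u.
Proof. by rewrite ffunE. Qed.

Section Restriction.
Variable n : nat.
Implicit Types (w : W n) (v : W n.+1) (y z : sidx n.+1).
Implicit Types (C : scomp n) (D : scomp n.+1) (f g : galg rat (W n.+1)).

(** A choice of one signed index in each orbit of W_D, [pick] depending only on
    the orbit. *)
Definition orbit_rep D y : sidx n.+1 :=
  odflt y [pick y' | lab (val D) y' == lab (val D) y].

Lemma orbit_rep_lab D y : lab (val D) (orbit_rep D y) = lab (val D) y.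
Proof. by rewrite /orbit_rep; case: pickP => [y' /eqP|]. Qed.

Lemma orbit_rep_eq D y z : lab (val D) y = lab (val D) z -> orbit_rep D y = orbit_rep D z.
Proof.
move=> yz; rewrite /orbit_rep (eq_pick (Q := fun y' => lab (val D) y' == lab (val D) z)).
  by case: pickP => // /(_ z)/eqP.
by move=> y'; rewrite yz.
Qed.

Definition orbit_reps D : {set sidx n.+1} := [set y | orbit_rep D y == y].

Lemma sum_orbits (M : nmodType) D (F : sidx n.+1 -> M) :
  \sum_y F y = \sum_(y0 in orbit_reps D) \sum_(y | lab (val D) y == lab (val D) y0) F y.
Proof.
rewrite (partition_big (orbit_rep D) (mem (orbit_reps D))) => [|y _]; last first.
  by rewrite /= inE; apply/eqP/orbit_rep_eq/orbit_rep_lab.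
apply: eq_bigr => y0 /=; rewrite inE => /eqP y0E; apply: eq_bigl => y.
by apply/eqP/eqP=> [<-|/orbit_rep_eq ->//]; rewrite orbit_rep_lab.
Qed.

Definition coset_sum : galg rat (W n.+1) := \sum_y gbasis rat (cosetW y).

Lemma mul_coset_sumE f v : (f * coset_sum) v = \sum_y f (v * (cosetW y)^-1)%g.
Proof.
rewrite /coset_sum mulr_sumr sum_ffunE; apply: eq_bigr => y _.
rewrite galg_mulE (bigD1 (v * (cosetW y)^-1)%g) //= big1 ?addr0.
  by rewrite gbasisE invMg invgK mulgKV eqxx mulr1.
move=> u uy; rewrite gbasisE; case: eqP => [E|]; last by rewrite mulr0.
by case/eqP: uy; rewrite -E invMg invgK mulKVg.
Qed.

Lemma coset_sum_xC : coset_sum = xC (snoc (one_block n)).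
Proof.
apply/ffunP=> v; rewrite xCE /coset_sum sum_ffunE; under eq_bigr do rewrite gbasisE.
have [w vE] := insWP v; rewrite [in RHS]vE XC_snoc XC_one_block.
rewrite (bigD1 (Wapp v (top n false))) //= big1 ?addr0 => [|y yv].
  rewrite {1}vE; congr (_%:R); congr nat_of_bool; apply/eqP/eqP => [/insW_inj2[]//|->//].
by case: eqP => // vy; rewrite vy insW_top0 eqxx in yv.
Qed.

(** The component of f * x_K on the trivial coset of W_n.  By
    [mul_coset_sum_res] the others are its translates when f is in the
    Mantaci-Reutenauer algebra. *)
Definition res_fun f : galg rat (W n) := [ffun w => (f * coset_sum) (liftW w)].

Lemma res_fun_linear : linear res_fun.
Proof.
move=> c f g; apply/ffunP=> w.
by rewrite [LHS]ffunE mulrDl -scalerAl !ffunE.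
Qed.

Definition res : 'Hom(galg rat (W n.+1), galg rat (W n)) := linfun res_fun.

Lemma resE f w : res f w = (f * coset_sum) (liftW w).
Proof. by rewrite linear_lfunE; [rewrite [LHS]ffunE | exact: res_fun_linear]. Qed.

Lemma xC_coset_sum D z w :
  (xC D * coset_sum) (insW z w) = \sum_(y in orbit_reps D) xC (del_pos D y.1) w.
Proof.
rewrite mul_coset_sumE (sum_orbits D); apply: eq_bigr => y0 _.
rewrite xCE -(insertion_count D z w y0) natr_sum.
by apply: eq_bigr => y _; rewrite xCE.
Qed.

Lemma res_xC D : res (xC D) = \sum_(y in orbit_reps D) xC (del_pos D y.1).
Proof. by apply/ffunP=> w; rewrite resE xC_coset_sum sum_ffunE. Qed.

Lemma mul_coset_sum_res f z w : f \in MR n.+1 -> (f * coset_sum) (insW z w) = res f w.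
Proof.
move=> /coord_span ->; rewrite mulr_suml linear_sum !sum_ffunE.
apply: eq_bigr => i _; rewrite xC_tupleE linearZ /= -scalerAl !galg_scaleE.
by rewrite xC_coset_sum res_xC sum_ffunE.
Qed.

Lemma res1 : res 1 = 1.
Proof.
apply/ffunP=> w; rewrite resE mul1r /coset_sum sum_ffunE.
rewrite -[1]/(gbasis rat 1%g) gbasisE.
under eq_bigr do rewrite gbasisE.
rewrite (bigD1 (top n false)) //= big1 ?addr0 => [|y yt].
  by congr (_%:R); congr nat_of_bool; apply/eqP/eqP=> [/insW_inj2[]//|->].
by case: eqP => // /insW_inj2[E]; rewrite -E eqxx in yt.
Qed.

Lemma res_mul : {in MR n.+1 &, forall f g, res (f * g) = res f * res g}.
Proof.
move=> f g fMR gMR; apply/ffunP=> w; rewrite resE -mulrA galg_mulE.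
rewrite galg_mulE sum_insW; apply: eq_bigr => u _.
rewrite resE mul_coset_sumE mulr_suml; apply: eq_bigr => y _.
by rewrite invMg invgK -mulgA -liftWV -liftW_mul -insWE mul_coset_sum_res.
Qed.

Lemma res_ker f : f \in MR n.+1 -> res f = 0 -> f * coset_sum = 0.
Proof.
move=> fMR f0; apply/ffunP=> v; have [w ->] := insWP v.
by rewrite mul_coset_sum_res // f0 !ffunE.
Qed.

Lemma res_MR f : f \in MR n.+1 -> res f \in MR n.
Proof.
move=> /coord_span ->; rewrite linear_sum; apply: memv_suml => i _.
rewrite linearZ memvZ //= xC_tupleE res_xC.
by apply: memv_suml => y _; exact: xC_MR.
Qed.

(** From position j on, the composition consists of parts -1. *)
Definition neg_ones_from (j : nat) C := forall t, (j <= t < n)%N ->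
  ~~ cpos (val C) t /\ ((0 < t)%N -> ~~ linked (val C) t.-1).

Lemma snoc_cut j C t : neg_ones_from j C -> (j <= t.+1 <= n)%N ->
  (bidx (val (snoc C)) t < bidx (val (snoc C)) t.+1)%N.
Proof.
move=> Cj /andP[jt tn]; rewrite ltn_neqAle leq_bidx // andbT.
rewrite -[_ == _]/(linked _ t) linked_snoc ?ltnS //; apply/nandP.
have [tn'|] := boolP (t.+1 < n)%N; last by left.
by right; have [|_ ->] := Cj t.+1; first by rewrite jt.
Qed.

Lemma linked_del D (q : 'I_n.+1) p : (p.+1 < n)%N ->
  linked (val (del_pos D q)) p = (bidx (val D) (bump q p) == bidx (val D) (bump q p.+1)).
Proof.
move=> pn; have [h1 h2] := bidx_del D q (Ordinal (ltnW pn)) (Ordinal pn).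
by apply/eqP/eqP; [exact: h1 | exact: h2].
Qed.

Lemma del_snoc_ge j C (q : 'I_n.+1) : neg_ones_from j C -> (j <= q)%N ->
  del_pos (snoc C) q = C.
Proof.
move=> Cj jq; apply/val_inj/scomp_unique; rewrite ?scomp_neq0 ?sumn_csizes // => p pn.
  rewrite (cpos_del (snoc C) q (Ordinal pn)) cpos_snoc ?ltn_ord //= /bump.
  case: (leqP q p) => qp /=; last by rewrite add0n pn.
  rewrite add1n; have /Cj[/negPf -> _] : (j <= p < n)%N by rewrite (leq_trans jq).
  have [pn'|//] := boolP (p.+1 < n)%N.
  by have [|/negPf] := Cj p.+1; first by rewrite pn' andbT; lia.
rewrite linked_del //; have pn' := ltnW pn.
have [pq|qp] := ltnP p.+1 q.
  have nqp : (q <= p)%N = false by rewrite leqNgt ltnW.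
  have nqp1 : (q <= p.+1)%N = false by rewrite leqNgt pq.
  rewrite /bump nqp nqp1 !add0n -[_ == _]/(linked _ p).
  by rewrite linked_snoc ?ltnS // pn.
have jp : (j <= p.+1)%N by apply: leq_trans qp.
have [_ /(_ isT)/negPf ->] : ~~ cpos (val C) p.+1 /\ _ := Cj p.+1 (introT andP (conj jp pn)).
apply/negbTE; rewrite neq_ltn {2}/bump qp add1n; apply/orP; left.
apply: leq_ltn_trans (snoc_cut Cj _); last by rewrite pn andbT; lia.
by apply: leq_bidx; rewrite /bump; case: leqP; lia.
Qed.

Lemma del_snoc_lt j C (q : 'I_n.+1) : neg_ones_from j.+1 C -> (q <= j)%N ->
  neg_ones_from j (del_pos (snoc C) q).
Proof.
move=> Cj qj t /andP[jt tn]; split=> [|t0].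
  rewrite (cpos_del (snoc C) q (Ordinal tn)) cpos_snoc ?ltn_ord //= /bump.
  rewrite (leq_trans qj) // add1n; apply/nandP.
  have [tn'|] := boolP (t.+1 < n)%N; last by left.
  by right; have [] := Cj t.+1 => //; rewrite tn' andbT.
rewrite linked_del prednK // neq_ltn; apply/orP; left.
rewrite {2}/bump (leq_trans qj jt) add1n.
apply: leq_ltn_trans (snoc_cut Cj _); last by rewrite ltnS jt.
by apply: leq_bidx; rewrite /bump; case: leqP; lia.
Qed.

Lemma orbit_rep_top C b : (orbit_rep (snoc C) (top n b)).1 = ord_max.
Proof.
have [E _] := orbit_rep_lab (snoc C) (top n b).
apply/ord_inj/eqP; rewrite /= eqn_leq -ltnS ltn_ord leqNgt; apply/negP=> lt.
have Cn : neg_ones_from n C by move=> t; case/andP=> nt tn; lia.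
have n0 : (0 < n)%N by exact: leq_ltn_trans (leq0n _) lt.
have := @snoc_cut n C n.-1 Cn; rewrite prednK // leqnn => /(_ isT).
rewrite -[X in (_ < X)%N]E ltnNge leq_bidx //.
by rewrite -ltnS prednK.
Qed.

(** In res(x_(snoc C)) the deletions of a position from j on all give C, and at
    least one orbit, that of the last position, contributes such a term. *)
Lemma res_onto_step j C : (j <= n)%N -> neg_ones_from j C ->
    (forall y, (y.1 < j)%N -> xC (del_pos (snoc C) y.1) \in (res @: MR n.+1)%VS) ->
  xC C \in (res @: MR n.+1)%VS.
Proof.
set im := (res @: _)%VS => jn Cj IH.
have : res (xC (snoc C)) \in im by rewrite memv_img // xC_MR.
rewrite res_xC (bigID (fun y : sidx n.+1 => (j <= y.1)%N)) /=.
set low := (X in _ + X).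
have low_im : low \in im.
  by apply: memv_suml => y /andP[_]; rewrite -ltnNge => /IH.
rewrite (eq_bigr (fun=> xC C)) => [|y /andP[_ jy]]; last by rewrite (del_snoc_ge Cj).
rewrite sumr_const => h.
have {h} : xC C *+ #|[pred y in orbit_reps (snoc C) | (j <= y.1)%N]| \in im.
  by rewrite -[_ *+ _](addrK low) rpredB.
set k := #|_|; have k0 : (k%:R : rat) != 0.
  rewrite pnatr_eq0 -lt0n; apply/card_gt0P; exists (orbit_rep (snoc C) (top n false)).
  rewrite !inE (orbit_rep_eq (orbit_rep_lab _ _)) eqxx orbit_rep_top /=.
  exact: jn.
rewrite -scaler_nat => kC; rewrite -[xC C]scale1r -(mulVf k0) -scalerA.
by rewrite rpredZ.
Qed.

(** Deleting a position below j from [snoc C] leaves parts -1 from j - 1 on: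
    one position is lost before them and one part -1 was added. *)
Lemma res_onto_neg_ones j C : (j <= n)%N -> neg_ones_from j C ->
  xC C \in (res @: MR n.+1)%VS.
Proof.
elim: j C => [|j IH] C jn Cj; first by apply: res_onto_step jn Cj _.
apply: (res_onto_step jn Cj) => y yj.
by apply: IH; [exact: ltnW | exact: del_snoc_lt].
Qed.

Lemma res_onto : (res @: MR n.+1)%VS = MR n.
Proof.
apply/eqP; rewrite eqEsubv; apply/andP; split.
  by apply/subvP=> _ /memv_imgP[f fMR ->]; exact: res_MR.
apply/span_subvP=> f /(nthP 0)[i]; rewrite size_tuple => iN <-.
rewrite (xC_tupleE (Ordinal iN)); apply: (@res_onto_neg_ones n) => //.
by move=> t; case/andP=> nt tn; lia.
Qed.

End Restriction.

(** * Values of the induced characters *)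
Section InducedCharacter.
Variable n : nat.
Implicit Types (C : scomp n) (w u v h g : W n).

Lemma indC_sum C w :
  indC C w = #|WC C|%:R^-1 * (\sum_g (w ^ g \in WC C)%g)%:R.
Proof.
rewrite /indC cfIndE ?subsetT //.
rewrite (eq_bigr (fun y : W n => (w ^ y \in WC C)%g%:R)); last by move=> y _; rewrite cfun1E.
rewrite (eq_bigl predT) => [|g]; last by rewrite inE.
rewrite -natr_sum.
set a := #|_|; set b := (\sum_g _)%N.
have -> : a%:R^-1 * b%:R = ratr (a%:R^-1 * b%:R) :> algC.
  by rewrite rmorphM fmorphV /= !ratr_nat.
by rewrite ratCK.
Qed.

Lemma XC_transversal_count C g : (\sum_(h in WC C) ((g * h)%g \in XC C) = 1)%N.
Proof.
have [h hC ghX] := XC_transversal C g.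
rewrite (bigD1 h) //= ghX big1 ?addn0 // => h' /andP[h'C ne]; apply/eqP.
rewrite eqb0; apply: contra ne => gh'X.
have := @XC_unique _ C (g * h)%g (h^-1 * h')%g ghX.
rewrite groupM ?groupV // mulgA mulgK => /(_ isT gh'X) E.
by rewrite eq_sym eq_mulVg1 E.
Qed.

(** The number of fixed points of w on W_n / W_C, with the cosets represented by
    X_C. *)
Lemma indC_XC C w : indC C w = (\sum_(u in XC C) (w ^ u \in WC C)%g)%:R.
Proof.
rewrite indC_sum; set X := (\sum_(u in XC C) _)%N.
suff -> : (\sum_g (w ^ g \in WC C)%g = #|WC C| * X)%N.
  by rewrite natrM mulKf // pnatr_eq0 -lt0n cardG_gt0.
transitivity (\sum_g \sum_(h in WC C) ((g * h)%g \in XC C) * (w ^ (g * h) \in WC C)%g)%N.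
  apply: eq_bigr => g _.
  rewrite (eq_bigr (fun h => ((g * h)%g \in XC C) * (w ^ g \in WC C)%g)%N).
    by rewrite -big_distrl /= XC_transversal_count mul1n.
  by move=> h hC; rewrite conjgM groupJr.
rewrite exchange_big /= -sum_nat_const; apply: eq_bigr => h _.
transitivity (\sum_g (g \in XC C) * (w ^ g \in WC C)%g)%N.
  by rewrite [RHS](reindex_inj (mulIg h)).
by rewrite /X [RHS]big_mkcond; apply: eq_bigr => g _; case: (g \in XC C); rewrite ?mul1n.
Qed.

Lemma indC_ge0 C w : 0 <= indC C w.
Proof. by rewrite indC_XC ler0n. Qed.

Lemma indC_one_block w : indC (one_block n) w = 1.
Proof.
rewrite indC_XC (eq_bigl (pred1 1%g)) => [|u]; last by rewrite XC_one_block.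
by rewrite big_pred1_eq WC_one_block.
Qed.
End InducedCharacter.

Section InductionRestriction.
Variable n : nat.
Implicit Types (w : W n) (v : W n.+1) (y z : sidx n.+1) (D : scomp n.+1).

Lemma conj_cosetW_WC D y w :
  ((cosetW y * liftW w * (cosetW y)^-1)%g \in WC D) = (w \in WC (del_pos D y.1)).
Proof.
apply/idP/idP=> [/mem_WC wD|/mem_WC wD]; apply/mem_WC.
  move=> x; apply/lab_del; have := wD (Wapp (cosetW y) (up x)).
  by rewrite !WappM WappK liftW_up !cosetW_up.
move=> t; rewrite !WappM -{2}(WappVK (cosetW y) t).
have [[x ->]|[b ->]] := sidxSP (Wapp (cosetW y)^-1%g t); last by rewrite liftW_top.
by rewrite liftW_up !cosetW_up; apply/lab_del.
Qed.

Lemma WC_del_lab D y z : lab (val D) y = lab (val D) z ->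
  WC (del_pos D y.1) =i WC (del_pos D z.1).
Proof.
move=> [yz _] w; have E x := @lab_skip_block n (val D) y.1 z.1 x yz.
by apply/idP/idP=> /mem_WC wD; apply/mem_WC => x; apply/lab_del;
  [rewrite -!E | rewrite !E]; apply/lab_del.
Qed.

(** The Mackey formula.  A representative u in X_D of a coset fixed by w is
    written as [liftW w' * (cosetW y)^-1]; for y in a given orbit, the condition
    on u^-1 w u depends on w' only, and [insertion_count] says for which w'
    there is such a y. *)
Lemma indC_liftW D w : indC D (liftW w) = \sum_(y in orbit_reps D) indC (del_pos D y.1) w.
Proof.
under eq_bigr do rewrite indC_XC.
rewrite indC_XC -natr_sum; congr (_%:R).
rewrite big_mkcond (sum_insW (M := nat)) /=.
under eq_bigr => w' _ do rewrite (sum_orbits D).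
rewrite exchange_big /=; apply: eq_bigr => y0 _.
rewrite [RHS]big_mkcond; apply: eq_bigr => w' _ /=.
transitivity (\sum_(y | lab (val D) y == lab (val D) y0)
  ((insW (top n false) w' * (cosetW y)^-1)%g \in XC D) * (w ^ w' \in WC (del_pos D y0.1))%g)%N.
  apply: eq_bigr => y /eqP yy; rewrite -(WC_del_lab yy) -conj_cosetW_WC -/(liftW w').
  have -> : (liftW w ^ (liftW w' * (cosetW y)^-1) =
             cosetW y * liftW (w ^ w') * (cosetW y)^-1)%g.
    by rewrite /conjg invMg invgK !liftW_mul liftWV !mulgA.
  by case: ifP => _; rewrite ?mul1n.
by rewrite -big_distrl /= insertion_count; case: (w' \in _); rewrite ?mul1n.
Qed.

End InductionRestriction.

(** * The base of a group W_C *)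
Lemma free_map_functional (K : fieldType) (V : vectType K) (I : eqType)
    (Q : seq I) (b : I -> V) (l : I -> V -> K) :
    (forall q c u v, l q (c *: u + v) = c * l q u + l q v) ->
    {in Q & Q, forall q p, p != q -> l q (b p) = 0} ->
    {in Q, forall q, l q (b q) != 0} ->
  uniq Q -> free [seq b q | q <- Q].
Proof.
move=> lL; elim: Q => [|q Q IH] l0 l1 /=; first by rewrite nil_free.
case/andP=> qQ uQ; rewrite free_cons IH ?andbT //; last first.
- by move=> p pQ; apply: l1; rewrite inE pQ orbT.
- by move=> p p' pQ p'Q; apply: l0; rewrite inE ?pQ ?p'Q orbT.
have lq0 : l q 0 = 0 by have := lL q (-1) 0 0; rewrite scaler0 addr0 mulN1r addNr.
apply: contra (l1 q (mem_head _ _)) => bq; apply/eqP.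
have := coord_span (X := in_tuple [seq b q | q <- Q]) bq => ->.
elim/big_ind: _ => // [u v lu lv|i _]; first by rewrite -[u]scale1r lL lu lv mulr0 addr0.
rewrite -[_ *: _]addr0 lL lq0 addr0.
have iQ : (i < size Q)%N by rewrite -(size_map b) ltn_ord.
rewrite (nth_map q) // l0 ?mulr0 ?mem_head // ?inE ?mem_nth ?orbT //.
by apply: contraNneq qQ => <-; rewrite mem_nth.
Qed.

Section Coxeter.
Variable n : nat.
Variable C : scomp n.
Implicit Types (x y z : sidx n) (w : W n) (i j p q : 'I_n) (a v : 'rV[rat]_n).

Local Notation linkedC := (linked (val C)).
Local Notation bidxC := (bidx (val C)).
Local Notation cposC := (cpos (val C)).

Definition linked_pred q : bool := (0 < q)%N && linkedC q.-1.

Definition base_idx : seq 'I_n := [seq q <- enum 'I_n | linked_pred q || cposC q].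
(** For a position that opens a positive block this is the long root 2 e_q, and
    otherwise e_q - e_(q-1). *)
Definition base_root q : 'rV[rat]_n :=
  if linked_pred q then evec (q, false) + evec (ord_pred q, true)
  else 2 *: evec (q, false).
Definition base : seq 'rV[rat]_n := [seq base_root q | q <- base_idx].

Lemma mem_base_idx q : (q \in base_idx) = linked_pred q || cposC q.
Proof. by rewrite mem_filter mem_enum andbT. Qed.

Lemma base_idx_uniq : uniq base_idx.
Proof. by rewrite filter_uniq ?enum_uniq. Qed.

Lemma ord_pred_val q : (0 < q)%N -> ord_pred q = q.-1 :> nat.
Proof.
move=> q0; rewrite /= -subn1 -addnBAC // modnDr subn1 modn_small //.
by rewrite prednK // ltnW.
Qed.

Lemma linked_pred_bidx q : linked_pred q -> bidxC (ord_pred q) = bidxC q.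
Proof. by case/andP=> q0 /eqP; rewrite ord_pred_val // prednK. Qed.

Lemma linked_pred_lt q : linked_pred q -> (ord_pred q < q)%N.
Proof. by case/andP=> q0 _; rewrite ord_pred_val // prednK. Qed.

Lemma not_linked_pred_first p q : ~~ linked_pred q -> bidxC p = bidxC q -> (q <= p)%N.
Proof.
move=> nq E; rewrite leqNgt; apply: contra nq => pq.
have q0 : (0 < q)%N by apply: leq_ltn_trans pq.
rewrite /linked_pred q0; have [L _] := bidx_linked (val C) (ltnW pq).
by apply: L => //; rewrite -ltnS prednK // pq leqnn.
Qed.

(** Up to scalars, the family dual to the base ([tail_sum_base]). *)
Definition tail_sum q v : rat :=
  \sum_(t < n | (q <= t)%N && (bidxC t == bidxC q)) v 0 t.

Lemma tail_sum_linear q c u v :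
  tail_sum q (c *: u + v) = c * tail_sum q u + tail_sum q v.
Proof.
rewrite /tail_sum mulr_sumr -big_split; apply: eq_bigr => t _ /=.
by rewrite !mxE.
Qed.

Lemma tail_sum_evec q i b :
  tail_sum q (evec (i, b)) = (-1) ^+ b * ((q <= i)%N && (bidxC i == bidxC q))%:R.
Proof.
rewrite /tail_sum big_mkcond (bigD1 i) //= big1 => [|t ti].
  by rewrite !mxE !eqxx addr0 mulr1; case: ifP; rewrite ?mulr1 ?mulr0.
by rewrite !mxE (negPf ti) mulr0; case: ifP.
Qed.

Lemma tail_sum_base p q : p \in base_idx ->
  tail_sum q (base_root p) = if p == q then (if linked_pred q then 1 else 2) else 0.
Proof.
rewrite mem_base_idx /base_root; case: ifPn => [ip _|ip cp].
  rewrite -[evec (p, false)]scale1r tail_sum_linear !tail_sum_evec linked_pred_bidx //.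
  rewrite expr0 expr1 !mul1r mulN1r; case: (eqVneq p q) => [<-|pq].
    by rewrite ip leqnn eqxx leqNgt linked_pred_lt //= subr0.
  suff -> : (q <= ord_pred p)%N = (q <= p)%N by rewrite subrr.
  have p0 : (0 < p)%N by case/andP: ip.
  by rewrite ord_pred_val // -ltnS prednK // ltn_neqAle eq_sym pq.
rewrite -[2 *: _]addr0 tail_sum_linear tail_sum_evec expr0 mul1r.
have -> : tail_sum q 0 = 0 by rewrite /tail_sum big1 // => t _; rewrite mxE.
rewrite addr0; case: (eqVneq p q) => [<-|pq].
  by rewrite leqnn eqxx mulr1 (negPf ip).
case: (leqP q p) => [qp|_]; last by rewrite mulr0.
case: eqP => [E|_]; last by rewrite mulr0.
have := not_linked_pred_first ip (esym E); move: pq.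
by rewrite -(inj_eq (@ord_inj n)) eqn_leq qp andbT => /negPf->.
Qed.

Lemma base_free : free base.
Proof.
apply: (free_map_functional tail_sum_linear _ _ base_idx_uniq).
  by move=> q p _ pQ pq; rewrite tail_sum_base // (negPf pq).
by move=> q qQ; rewrite tail_sum_base // eqxx; case: ifP.
Qed.

(** The sum of the coordinates in the base; [tail_sum] takes the value 2 on the
    long roots. *)
Definition base_height v : rat :=
  \sum_(q <- base_idx) (if linked_pred q then 1 else 2^-1) * tail_sum q v.

Lemma base_height_linear : linear (base_height : 'rV[rat]_n -> rat^o).
Proof.
move=> c u v; rewrite /base_height scaler_sumr -big_split; apply: eq_bigr => q _ /=.
by rewrite tail_sum_linear mulrDr mulrCA.
Qed.

HB.instance Definition _ :=
  GRing.isLinear.Build rat 'rV[rat]_n rat^o _ base_height base_height_linear.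

Lemma base_height1 b : b \in base -> base_height b = 1.
Proof.
case/mapP=> p pQ ->; rewrite /base_height (bigD1_seq p) ?base_idx_uniq //=.
rewrite big1_seq ?addr0 => [|q /andP[qp _]]; rewrite tail_sum_base //.
  by rewrite eqxx; case: ifP => _; rewrite ?mulr1 ?mulVf.
by rewrite eq_sym (negPf qp) mulr0.
Qed.

Definition combination (s : seq 'rV[rat]_n) a : Prop :=
  exists c : 'rV[rat]_n -> nat, a = \sum_(b <- s) b *+ c b.

Lemma combinationD s a b : combination s a -> combination s b -> combination s (a + b).
Proof.
case=> c -> [d ->]; exists (fun e => c e + d e)%N.
by rewrite -big_split; apply: eq_bigr => i _; rewrite /= mulrnDr.
Qed.

Lemma combination0 s : combination s 0.
Proof. by exists (fun=> 0%N); rewrite big1. Qed.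

Lemma combination_mem s a : uniq s -> a \in s -> combination s a.
Proof.
move=> us sa; exists (fun b => (b == a) : nat).
by rewrite (bigD1_seq a) //= eqxx big1 ?addr0 // => b /negPf->.
Qed.

Lemma base_uniq : uniq base.
Proof. exact: free_uniq base_free. Qed.

Lemma base_mem q : linked_pred q || cposC q -> combination base (base_root q).
Proof.
move=> qQ; apply: combination_mem base_uniq _.
by apply/mapP; exists q; rewrite ?mem_base_idx.
Qed.

Lemma evec_neg i : evec (i, true) = - evec (i, false) :> 'rV[rat]_n.
Proof. exact: (evec_opp (i, false)). Qed.

Lemma combination_sub i j : (i <= j)%N -> bidxC i = bidxC j ->
  combination base (evec (j, false) - evec (i, false)).
Proof.
case: j => j; elim: j => [|j IH] jn /= ij E.
  have -> : Ordinal jn = i by apply/ord_inj => /=; lia.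
  by rewrite subrr; exact: combination0.
move: ij; rewrite leq_eqVlt => /predU1P[ij|ij].
  have -> : Ordinal jn = i by apply/ord_inj.
  by rewrite subrr; exact: combination0.
have jn' := ltnW jn; have Ej : bidxC j = bidxC i.
  by apply: bidx_convex E; rewrite -ltnS ij leqnSn.
rewrite -(subrK (evec (Ordinal jn', false)) (evec (Ordinal jn, false))) -addrA.
apply: combinationD; last exact: IH.
have jin : linked_pred (Ordinal jn) by rewrite /linked_pred /= /linked Ej E.
have := base_mem (q := Ordinal jn); rewrite jin => /(_ isT).
rewrite /base_root jin evec_neg.
by have -> : ord_pred (Ordinal jn) = Ordinal jn' by apply/ord_inj; rewrite ord_pred_val.
Qed.

Lemma combination_double i : cposC i -> combination base (2 *: evec (i, false)).
Proof.
case: i => i; elim: i => [|i IH] i_n ci.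
  by have := base_mem (q := Ordinal i_n); rewrite ci orbT => /(_ isT).
case iin: (linked_pred (Ordinal i_n)); last first.
  by have := base_mem (q := Ordinal i_n); rewrite /base_root iin ci => /(_ isT).
have E := linked_pred_bidx iin; rewrite ord_pred_val //= in E.
rewrite -(subrK (evec (Ordinal (ltnW i_n), false)) (evec (Ordinal i_n, false))) scalerDr.
apply: combinationD; last by apply: IH; rewrite /cpos /= E.
by rewrite scaler_nat mulr2n; apply: combinationD; apply: combination_sub => /=.
Qed.

Lemma pos_rootC_combination a : is_pos_rootC C a -> combination base a.
Proof.
case=> -[ra aC] a_pos.
case: ra => [[x ax]|[x [y [xy ax]]]]; rewrite {a}ax in aC a_pos *.
  move: a_pos aC; rewrite refl_long flip_WC pos_root_long ival_gt0.
  by case: x => i [] //= _; exact: combination_double.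
have xy' : x.1 != y.1 by rewrite neq_ltn xy.
move: a_pos aC; rewrite refl_short // swap_WC pos_root_short // => h /eqP[E1 E2].
case: y xy xy' h E1 E2 => j [] /= ij _ h E1 E2.
  by exfalso; case: x ij h {E1 E2} => i [] /= ij; rewrite /ival /= ?expr0 ?expr1; lia.
case: x ij h E1 E2 => i [] /= ij h E1 E2.
  by rewrite evec_neg addrC; apply: combination_sub => //; exact: ltnW.
have cj : cposC j by move: E2; case: (cposC j).
rewrite -(subrK (evec (i, false)) (evec (j, false))) addrCA -mulr2n.
apply: combinationD; first by apply: combination_sub => //; exact: ltnW.
by rewrite -scaler_nat; apply: combination_double; rewrite /cpos E1.
Qed.

Lemma base_pos_rootC b : b \in base -> is_pos_rootC C b.
Proof.
case/mapP=> q; rewrite mem_base_idx => qQ ->; rewrite /base_root.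
case: ifPn qQ => [iq _|_ cq] /=; last first.
  split; last by apply/pos_root_long; rewrite ival_gt0.
  by split; [left; exists (q, false) | rewrite refl_long flip_WC].
have lt := linked_pred_lt iq.
have ne : (q, false).1 != (ord_pred q, true).1 by rewrite /= neq_ltn lt orbT.
split; last by apply/pos_root_short => //; rewrite !ival_pair; lia.
split; first exact: short_is_root.
by rewrite refl_short // swap_WC /lab /= linked_pred_bidx.
Qed.

Lemma refl_opp a : refl (- a) = refl a.
Proof.
rewrite /refl; congr (odflt _ _); apply: eq_pick => w.
have dN u v : dotp u (- v) = - dotp u v.
  by rewrite -scaleN1r dotpZr mulN1r.
have E v : (2 * dotp v (- a) / dotp (- a) (- a)) *: - a = (2 * dotp v a / dotp a a) *: a.
  rewrite !dN (dotpC (- a)) dN opprK scalerN -scaleNr; congr (_ *: _).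
  by rewrite mulrN mulNr opprK.
by apply/asboolP/asboolP => wa v; rewrite wa E.
Qed.

Lemma root_opp a : is_root a -> is_root (- a).
Proof.
case=> [[x ->]|[x [y [xy ->]]]].
  by left; exists (sopp x); rewrite evec_opp scalerN.
by right; exists (sopp x), (sopp y); rewrite !evec_opp opprD.
Qed.

Lemma rootC_sign a : is_rootC C a -> is_pos_rootC C a \/ is_pos_rootC C (- a).
Proof.
case=> ra aC; have h0 := root_height_neq0 ra.
have [lt|le] := ltP 0 (height a); [left|right]; split=> //.
- exact/pos_rootP.
- by split; [exact: root_opp | rewrite refl_opp].
by apply/pos_rootP; split; [exact: root_opp | rewrite linearN /= oppr_gt0 lt_neqAle h0].
Qed.

Lemma base_is_base : is_baseC C base.
Proof.
split=> [a|| a /rootC_sign[]]; first exact: base_pos_rootC.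
- exact: base_free.
- by move=> /pos_rootC_combination[c ac]; exists c; left.
by move=> /pos_rootC_combination[c ac]; exists c; right; rewrite -ac opprK.
Qed.

Lemma combination_height_ge1 a : a != 0 -> combination base a -> 1 <= base_height a.
Proof.
move=> a0 [c ac].
have aE : base_height a = (\sum_(b <- base) c b)%:R.
  rewrite ac linear_sum natr_sum; apply: eq_big_seq => b bB.
  by rewrite linearMn /= base_height1.
rewrite aE ler1n lt0n; apply: contraNneq a0; rewrite ac => /eqP.
rewrite sum_nat_seq_eq0 => /allP c0; apply/eqP; rewrite big_seq big1 // => b bB.
by have /eqP-> := c0 b bB.
Qed.

(** Each b in the base is a combination of elements of s.  Its height is 1 while
    elements of s, being positive, have height at least 1; so b is one of them.
    Any further element of s would depend linearly on the base. *)
Lemma base_unique s : is_baseC C s -> perm_eq s base.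
Proof.
case=> s_pos s_free s_comb.
have us := free_uniq s_free.
have ht_s a : a \in s -> 1 <= base_height a.
  move=> sa; apply: combination_height_ge1; last exact/pos_rootC_combination/s_pos.
  have [[ra _] _] := s_pos a sa.
  by apply: contraTneq (root_height_neq0 ra) => ->; rewrite linear0 eqxx.
have sub b : b \in base -> b \in s.
  move=> bB; have [rb _] := base_pos_rootC bB; have hb := base_height1 bB.
  have [c [bE|bE]] := s_comb b rb; last first.
    move: hb; rewrite bE linearN linear_sum /= => hb.
    have : 0 <= \sum_(a <- s) base_height (a *+ c a).
      rewrite big_seq sumr_ge0 // => a sa; rewrite linearMn /= mulrn_wge0 //.
      by apply: le_trans (ht_s a sa).
    by rewrite -oppr_le0 hb; lra.
  have [/hasP[a0 sa0 ca0]|/hasPn c0] := boolP (has (fun a => c a != 0%N) s); last first.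
    have b0 : b = 0 by rewrite bE big_seq big1 // => a /c0/negPn/eqP->.
    by move: hb; rewrite b0 linear0 => /eqP; rewrite eq_sym oner_eq0.
  move: hb; rewrite bE linear_sum (bigD1_seq a0) //= linearMn /=.
  set rest := (X in _ + X) => hb.
  have rest_ge a : a \in s -> 0 <= base_height (a *+ c a).
    by move=> sa; rewrite linearMn /= mulrn_wge0 // (le_trans _ (ht_s a sa)).
  have rest0 : 0 <= rest.
    by rewrite /rest big_seq_cond sumr_ge0 // => a /andP[sa _]; exact: rest_ge.
  have ca1 : c a0 = 1%N.
    case: (c a0) ca0 hb => [|[|k]] // _ hb; exfalso.
    have := ht_s a0 sa0; have : 0 <= base_height a0 *+ k.
      by rewrite mulrn_wge0 // (le_trans _ (ht_s a0 sa0)).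
    by move: hb; rewrite !mulrS; lra.
  have r0 : rest = 0 by have := ht_s a0 sa0; rewrite ca1 mulr1n in hb; lra.
  rewrite (bigD1_seq a0) //= ca1 mulr1n big_seq_cond big1 ?addr0 // => a /andP[sa ne].
  have : rest == 0 by apply/eqP.
  rewrite /rest big_seq_cond psumr_eq0 => [/allP/(_ a sa)|a' /andP[sa' _]]; last exact: rest_ge.
  rewrite sa ne linearMn /= mulrn_eq0 => /orP[/eqP->|/eqP h0]; first by rewrite mulr0n.
  by have := ht_s a sa; rewrite h0 ler10.
apply: uniq_perm base_uniq _ => // a; apply/idP/idP=> [sa|]; last exact: sub.
apply/negPn/negP=> aB; have [c ac] := pos_rootC_combination (s_pos a sa).
have := s_free; rewrite (perm_free (perm_to_rem sa)) free_cons => /andP[/negP ns _].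
apply: ns; rewrite {1}ac big_seq; apply: memv_suml => b bB; apply: rpredMn.
apply: memv_span; rewrite mem_rem_uniq // inE sub // andbT.
by apply: contraNneq aB => <-.
Qed.

End Coxeter.

(** * Orbits of Coxeter elements *)
Section CoxeterOrbits.
Variables (n : nat) (C : scomp n).
Implicit Types (x y z : sidx n) (w : W n) (p q : 'I_n) (b : bool).
Implicit Types (F : sidx n -> nat).

Local Notation bidxC := (bidx (val C)).
Local Notation cposC := (cpos (val C)).
Local Notation labC := (lab (val C)).

Definition base_refl q : W n :=
  if linked_pred C q then swap (q, false) (ord_pred q, false) else flip (q, false).

Lemma refl_base_root q : refl (base_root C q) = base_refl q.
Proof.
rewrite /base_root /base_refl; case: ifPn => [iq|_]; last exact: refl_long.
by rewrite refl_short // /= neq_ltn (linked_pred_lt iq) orbT.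
Qed.

(** The positions of the block of q from q on, with sign b: a set that every
    simple reflection of W_C other than that of q leaves stable, and that the
    reflection of q leaves through the single index (q, b). *)
Definition cut q b : {set sidx n} :=
  [set x : sidx n | [&& (q <= x.1)%N, bidxC x.1 == bidxC q & x.2 == b]].

Lemma cut_stable p q b x : p \in base_idx C -> p != q ->
  (Wapp (base_refl p) x \in cut q b) = (x \in cut q b).
Proof.
rewrite mem_base_idx /base_refl => pC pq; case: ifPn pC => [ip _|ip /= cp].
  have pp := ord_pred_val (proj1 (andP ip)); have E := linked_pred_bidx ip.
  have le : (q <= p)%N = (q <= ord_pred p)%N.
    have p0 := proj1 (andP ip); rewrite pp.
    by move: pq; rewrite -(inj_eq (@ord_inj n)) => /eqP pq; apply/idP/idP; lia.
  rewrite swapE !inE /=; case: eqP => [->|_] /=; first by rewrite E le.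
  by case: eqP => [->|_] //=; rewrite E le.
rewrite flipE !inE /=; case: eqP => //= ->.
case: (leqP q p) => //= qp; case: eqP => //= E.
have := not_linked_pred_first ip (esym E); move: pq.
by rewrite -(inj_eq (@ord_inj n)) eqn_leq qp andbT => /negPf->.
Qed.

Lemma cut_stable_prod s q b x : {subset s <= base C} -> base_root C q \notin s ->
  (Wapp (\prod_(a <- s) refl a)%g x \in cut q b) = (x \in cut q b).
Proof.
elim: s x => [|a s IH] x sB; first by rewrite big_nil Wapp1.
rewrite inE negb_or => /andP[qa qs]; rewrite big_cons WappM.
have /mapP[p pC aE] : a \in base C by apply: sB; exact: mem_head.
rewrite aE refl_base_root cut_stable //; last by apply: contraNneq qa => <-; rewrite aE.
by apply: IH => // c cs; apply: sB; rewrite inE cs orbT.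
Qed.

(** The two sums differ by the single term at (q, b), the only index of the cut
    that the reflection moves. *)
Lemma cut_exchange F q b :
    (\sum_(x in cut q b) F (Wapp (base_refl q) x) = \sum_(x in cut q b) F x)%N ->
  F (Wapp (base_refl q) (q, b)) = F (q, b).
Proof.
have qq : (q, b) \in cut q b by rewrite inE /= leqnn !eqxx.
rewrite (bigD1 (q, b)) // [in RHS](bigD1 (q, b)) //=.
rewrite [X in (_ + X = _)%N](eq_bigr F); first by move/addIn.
case=> t c; rewrite inE /= => /andP[/and3P[qt /eqP E /eqP cb]].
rewrite xpair_eqE cb eqxx andbT => tq.
rewrite /base_refl; case: ifPn => [iq|iq].
  rewrite swapE /= (negPf tq); case: eqP => [tE|//].
  by have := linked_pred_lt iq; rewrite -tE ltnNge qt.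
by rewrite flipE /= (negPf tq).
Qed.

(** Let the product be s w, with s the reflection of q.  A function F that it
    fixes satisfies F(s w x) = F(x), and w preserves the cuts of q; hence F o s
    and F have the same sum over a cut, which yields F o s = F, then F o w = F. *)
Lemma prod_refl_invariant F s :
    uniq s -> {subset s <= base C} ->
    (forall x, F (Wapp (\prod_(a <- s) refl a)%g x) = F x) ->
  forall a, a \in s -> forall x, F (Wapp (refl a) x) = F x.
Proof.
elim: s => // a s IH /= /andP[a_s us] sB; rewrite big_cons => Fw.
have sB' : {subset s <= base C} by move=> c cs; apply: sB; rewrite inE cs orbT.
have /mapP[q qC aE] : a \in base C by apply: sB; exact: mem_head.
set w := (\prod_(a <- s) refl a)%g in Fw.
have qb_eq b : F (Wapp (base_refl q) (q, b)) = F (q, b).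
  apply: cut_exchange.
  rewrite (reindex_inj (@Wapp_inj _ w)) /=.
  apply: eq_big => [x|x _]; first by rewrite cut_stable_prod // -aE.
  by rewrite -refl_base_root -aE -WappM Fw.
have Fa x : F (Wapp (refl a) x) = F x.
  rewrite aE refl_base_root /base_refl in qb_eq *; case: ifPn qb_eq => [iq|iq] qb_eq.
    have {}qb_eq b : F (ord_pred q, b) = F (q, b).
      by have := qb_eq b; rewrite swapE /= eqxx.
    case: x => t b; rewrite swapE /=; case: eqP => [->|_]; first exact: qb_eq.
    by case: eqP => [->|//]; rewrite /= qb_eq.
  have {}qb_eq : F (q, true) = F (q, false).
    by have := qb_eq false; rewrite flipE /= eqxx.
  case: x => t b; rewrite flipE /=; case: eqP => [->|//].
  by case: b; rewrite /sopp /= qb_eq.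
move=> c; rewrite inE => /predU1P[-> //|cs]; apply: IH cs => // x.
by rewrite -[RHS]Fw WappM Fa.
Qed.

(** The orbits of w are those of W_C, expressed through invariant functions:
    this is the form in which the proof obtains it and in which it is used. *)
Definition orbits_of w := forall F,
  (forall x, F (Wapp w x) = F x) <-> (forall x y, labC x = labC y -> F x = F y).

Lemma coxeter_orbits w : is_coxeter C w -> orbits_of w.
Proof.
case=> s sbase ->; have sB := base_unique sbase; have [spos _ _] := sbase.
move=> F; split=> [Fw|Flab x]; last first.
  apply: Flab; move: x; apply/mem_WC; rewrite big_seq; apply: group_prod => a sa.
  by have [[_ aC] _] := spos a sa.
have us : uniq s by rewrite (perm_uniq sB) base_uniq.
have subs : {subset s <= base C} by move=> a; rewrite (perm_mem sB).
have inv := prod_refl_invariant us subs Fw.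
have base_inv q : q \in base_idx C -> forall x, F (Wapp (base_refl q) x) = F x.
  move=> qC x; rewrite -refl_base_root; apply: inv.
  by rewrite (perm_mem sB) map_f.
have inner_inv q b : linked_pred C q -> F (ord_pred q, b) = F (q, b).
  move=> iq; have := base_inv q; rewrite mem_base_idx iq => /(_ isT (q, b)).
  by rewrite /base_refl iq swapE /= eqxx.
have block_inv (p q : 'I_n) b : (p <= q)%N -> bidxC p = bidxC q -> F (p, b) = F (q, b).
  case: q => q; elim: q => [|q IH] q_n /= pq E.
    by congr (F (_, _)); apply/ord_inj => /=; lia.
  move: pq; rewrite leq_eqVlt => /predU1P[pq|pq]; first by congr (F (_, _)); apply/ord_inj.
  have q_n' := ltnW q_n.
  have Eq : bidxC q = bidxC p by apply: bidx_convex E; rewrite -ltnS pq leqnSn.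
  rewrite (IH q_n') // -(inner_inv (Ordinal q_n)).
    by congr (F (_, _)); apply/ord_inj; rewrite ord_pred_val.
  by rewrite /linked_pred /= /linked Eq E.
have sign_inv (p : 'I_n) : cposC p -> F (p, true) = F (p, false).
  case: p => p; elim: p => [|p IH] p_n cp.
    have := base_inv (Ordinal p_n); rewrite mem_base_idx cp orbT.
    by move=> /(_ isT (Ordinal p_n, false)); rewrite /base_refl /linked_pred /= flipE /=.
  case ip: (linked_pred C (Ordinal p_n)); last first.
    have := base_inv (Ordinal p_n); rewrite mem_base_idx cp orbT.
    by move=> /(_ isT (Ordinal p_n, false)); rewrite /base_refl ip flipE /= eqxx.
  rewrite -!(inner_inv (Ordinal p_n)) //.
  have -> : ord_pred (Ordinal p_n) = Ordinal (ltnW p_n) by apply/ord_inj; rewrite ord_pred_val.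
  by apply: IH; have := linked_pred_bidx ip; rewrite ord_pred_val //= /cpos /= => ->.
case=> i b [j c] [/= E bc].
have Eij d : F (i, d) = F (j, d).
  by case: (leqP i j) => [|/ltnW] h; [exact: block_inv|rewrite (block_inv j i)].
rewrite Eij; case: (eqVneq b c) => [->//|ne].
have cj : cposC j.
  by move: bc ne; rewrite /cpos E; case: (0 < _); rewrite ?andbT => // ->; rewrite eqxx.
by case: b c ne {bc} => -[] // _; rewrite sign_inv.
Qed.

Lemma coxeter_exists : exists w, is_coxeter C w.
Proof.
exists (\prod_(a <- base C) refl a)%g; exists (base C) => //.
exact: base_is_base.
Qed.

(** The element g^-1 w g is in W_D exactly when the labelling lab D o g^-1 is
    constant on the orbits of w, so only these orbits matter. *)
Lemma orbits_conj_WC w (D : scomp n) (g : W n) : orbits_of w ->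
  (w ^ g \in WC D)%g <-> forall x y, labC x = labC y ->
     lab (val D) (Wapp g^-1%g x) = lab (val D) (Wapp g^-1%g y).
Proof.
move=> wC; pose F x := pickle (lab (val D) (Wapp g^-1%g x)).
have FE x y : F x = F y <-> lab (val D) (Wapp g^-1%g x) = lab (val D) (Wapp g^-1%g y).
  by split=> [/(pcan_inj pickleK)|E]; rewrite /F ?E.
split=> [/mem_WC wD x y /(proj1 (wC F)) xy|gC]; last first.
  apply/mem_WC => t; rewrite /conjg !WappM -{2}(WappK g t).
  apply/FE; move: (Wapp g t); apply/(wC F) => x y /gC; exact: (FE x y).2.
apply/FE/xy => t; apply/FE; have := wD (Wapp g^-1%g t).
by rewrite /conjg !WappM WappVK.
Qed.

End CoxeterOrbits.

(** * Coxeter elements of a bipartition *)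
Section PermutedParts.
Variable n : nat.
Implicit Types (C D : scomp n) (x y : sidx n) (w : W n).

(** A bijection between the parts that preserves them is extended to positions
    by keeping the offset inside each block. *)
Lemma block_matching C C' : perm_eq (val C) (val C') ->
  exists h : W n, forall x y,
    lab (val C) x = lab (val C) y <-> lab (val C') (Wapp h x) = lab (val C') (Wapp h y).
Proof.
move=> /(perm_iotaP 0)[s s_iota CE].
pose sh := csizes (val C); pose sh' := csizes (val C').
pose off (p : nat) := reshape_offset sh p.
pose f (p : nat) := flatten_index sh' (nth 0%N s (bidx (val C) p)) (off p).
have size_s : size s = size (val C) by rewrite [RHS](congr1 size CE) size_map.
have partE i : (i < size (val C))%N -> (val C)`_i = (val C')`_(nth 0%N s i).
  by move=> iC; rewrite {1}CE (nth_map 0%N) // size_s.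
have s_inj i j : (i < size (val C))%N -> (j < size (val C))%N ->
    nth 0%N s i = nth 0%N s j -> i = j.
  move=> iC jC /eqP; rewrite nth_uniq ?size_s // => [/eqP//|].
  by rewrite (perm_uniq s_iota) iota_uniq.
have off_lt (p : 'I_n) : (off p < nth 0%N sh' (nth 0%N s (bidx (val C) p)))%N.
  have := @reshape_offsetP sh p; rewrite [sumn sh]sumn_csizes ltn_ord => /(_ isT).
  rewrite -/(bidx (val C) p) (nth_map 0) ?bidx_size // partE ?bidx_size // => lt.
  have [iC'|iC'] := ltnP (nth 0%N s (bidx (val C) p)) (size (val C')).
    by rewrite (nth_map 0).
  by move: lt; rewrite (nth_default _ iC').
have f_lt (p : 'I_n) : (f p < n)%N by rewrite -[X in (_ < X)%N](sumn_csizes C') flatten_indexP.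
pose h_fun x : sidx n := (Ordinal (f_lt x.1), x.2).
have bidx_f (p : 'I_n) : bidx (val C') (f p) = nth 0%N s (bidx (val C) p).
  exact: flatten_indexKl.
have h_inj : injective h_fun.
  case=> [p b] [q c] E; have /= := congr1 snd E => <-.
  have {}E : f p = f q by have := congr1 (fun t : sidx n => t.1 : nat) E.
  congr (_, _); apply/ord_inj.
  have bE : bidx (val C) p = bidx (val C) q.
    by apply: s_inj; rewrite ?bidx_size // -!bidx_f E.
  have oE : off p = off q.
    have := off_lt p; have := off_lt q => oq op.
    by rewrite -(flatten_indexKr op) -/(f p) E /f flatten_indexKr.
  rewrite -(reshape_indexK sh p) -(reshape_indexK sh q).
  by rewrite -!/(bidx (val C) _) bE -!/(off _) oE.
exists (mkW h_inj (fun x => erefl)) => x y; rewrite !mkWE /lab /=.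
have cposE (p : 'I_n) : cpos (val C') (f p) = cpos (val C) p.
  by rewrite /cpos bidx_f partE ?bidx_size.
rewrite !bidx_f !cposE; split=> [[-> ->] //|[E ->]].
by congr (_, _); apply: s_inj E; rewrite bidx_size.
Qed.

Lemma indC_orbits D C C' w w' : perm_eq (val C) (val C') ->
  orbits_of C w -> orbits_of C' w' -> indC D w = indC D w'.
Proof.
move=> /block_matching[h hE] wC w'C'; rewrite !indC_sum; congr (_ * _%:R).
rewrite [RHS](reindex_inj (mulgI h)) /=; apply: eq_bigr => g _; congr nat_of_bool.
apply/idP/idP => [/(orbits_conj_WC _ _ wC) H|/(orbits_conj_WC _ _ w'C') H].
  apply/(orbits_conj_WC _ _ w'C') => x y; rewrite -(WappVK h x) -(WappVK h y).
  by move=> /hE/H; rewrite invMg !WappM !WappK.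
apply/(orbits_conj_WC _ _ wC) => x y /hE/H.
by rewrite invMg !WappM !WappK.
Qed.

End PermutedParts.

Section SnocOrbits.
Variable n : nat.
Implicit Types (C : scomp n) (x y : sidx n) (w : W n).

Lemma lab_snoc_up C x y :
  lab (val (snoc C)) (up x) = lab (val (snoc C)) (up y) <-> lab (val C) x = lab (val C) y.
Proof.
have Cn : neg_ones_from n C by move=> t; case/andP=> nt tn; lia.
have := lab_del (snoc C) ord_max x y; rewrite (del_snoc_ge Cn) // => E.
by split=> /E.
Qed.

Lemma bidx_snoc_top C (i : 'I_n) : (bidx (val (snoc C)) i < bidx (val (snoc C)) n)%N.
Proof.
have Cn : neg_ones_from n C by move=> t; case/andP=> nt tn; lia.
have n0 : (0 < n)%N by apply: leq_ltn_trans (ltn_ord i).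
have := @snoc_cut n n C n.-1 Cn; rewrite prednK // leqnn => /(_ isT).
by apply: leq_ltn_trans; apply: leq_bidx; rewrite -ltnS prednK.
Qed.

(** A function on the signed indices of n+1 is invariant under w in W_n when its
    restriction to the first n is; the values at n+1 and -(n+1) are free, and
    these two are orbits of their own for [snoc C]. *)
Lemma orbits_snoc C w : orbits_of C w -> orbits_of (snoc C) (liftW w).
Proof.
move=> wC F; split=> [Fw|Flab t]; last first.
  have [[x ->]|[b ->]] := sidxSP t; last by rewrite liftW_top.
  rewrite liftW_up; apply: (proj2 (wC (F \o @up n))) => {t} x' y' xy.
  exact/Flab/lab_snoc_up.
have Fup x y : lab (val C) x = lab (val C) y -> F (up x) = F (up y).
  by apply: (proj1 (wC (F \o @up n))) => {}x /=; rewrite -liftW_up Fw.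
have up_top x b : lab (val (snoc C)) (up x) <> lab (val (snoc C)) (top n b).
  move=> /(congr1 fst) E; have := bidx_snoc_top C x.1.
  by rewrite -(lift_max x.1) -[X in (_ < X)%N]E ltnn.
move=> s t; have [[x ->]|[b ->]] := sidxSP s; have [[y ->]|[c ->]] := sidxSP t.
- by move/lab_snoc_up/Fup.
- by move/up_top.
- by move/esym/up_top.
by case; rewrite cpos_snoc //= ltnn /= !andbT => ->.
Qed.

Lemma val_snoc C : val (snoc C) = rcons (val C) (-1).
Proof.
have bidx_rcons (E : seq int) c p : (p < sumn (csizes E))%N -> bidx (rcons E c) p = bidx E p.
  elim: E p => // d E IH p /= pE; rewrite !bidx_cons.
  by case: ltnP => // dp; rewrite IH //; lia.
have bidx_last (E : seq int) c : c != 0 -> bidx (rcons E c) (sumn (csizes E)) = size E.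
  move=> c0; elim: E => [|d E IH] /=; first by rewrite bidx_cons absz_gt0 c0.
  by rewrite bidx_cons ltnNge leq_addr /= addKn IH.
have Cn := sumn_csizes C.
have last_n : bidx (rcons (val C) (-1)) n = size (val C).
  by have := bidx_last (val C) (-1) isT; rewrite [sumn _]Cn.
have sum_rcons : sumn (csizes (rcons (val C) (-1))) = n.+1.
  by rewrite /csizes map_rcons sumn_rcons [sumn _]Cn addn1.
apply: scomp_unique; rewrite ?scomp_neq0 ?sumn_csizes ?sum_rcons //.
- by rewrite all_rcons scomp_neq0.
- move=> p pn; rewrite cpos_snoc //; move: pn; rewrite ltnS leq_eqVlt => /predU1P[->|pn].
    by rewrite ltnn /cpos last_n nth_rcons ltnn eqxx.
  rewrite pn /cpos bidx_rcons ?Cn // nth_rcons.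
  by rewrite (bidx_size C (Ordinal pn)).
move=> p pn; rewrite linked_snoc //; move: pn; rewrite ltnS /linked => pn.
rewrite bidx_rcons ?Cn //; move: pn; rewrite leq_eqVlt => /predU1P[pn|pn].
  rewrite pn ltnn last_n.
  have p_n : (p < n)%N by rewrite -pn.
  by rewrite (ltn_eqF (bidx_size C (Ordinal p_n))).
by rewrite pn bidx_rcons ?Cn.
Qed.
End SnocOrbits.

Section CoxeterOfBipartition.

Definition pos_parts (C : seq int) := [seq `|x|%N | x <- C & 0 < x].
Definition neg_parts (C : seq int) := [seq `|x|%N | x <- C & x < 0].

Lemma perm_parts (C C' : seq int) :
    all (fun c => c != 0) C -> all (fun c => c != 0) C' ->
    perm_eq (pos_parts C) (pos_parts C') -> perm_eq (neg_parts C) (neg_parts C') ->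
  perm_eq C C'.
Proof.
have rebuild (E : seq int) : all (fun c => c != 0) E ->
    perm_eq E ([seq k%:Z | k <- pos_parts E] ++ [seq - k%:Z | k <- neg_parts E]).
  move=> /allP E0; rewrite /pos_parts /neg_parts -!map_comp.
  rewrite !map_id_in => [|x|x].
  - have -> : [seq x <- E | x < 0] = [seq x <- E | predC (fun x : int => 0 < x) x].
      by apply: eq_in_filter => x /E0 x0 /=; rewrite -leNgt le_eqVlt (negPf x0).
    by rewrite perm_sym perm_filterC.
  - by rewrite mem_filter => /andP[/= x0 _]; lia.
  by rewrite mem_filter => /andP[/= x0 _]; lia.
move=> C0 C'0 pp nn; rewrite (perm_trans (rebuild C C0)) //.
rewrite perm_sym (perm_trans (rebuild C' C'0)) // perm_sym.
by apply: perm_cat; exact: perm_map.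
Qed.

Lemma bip_perm n (C C' : scomp n) :
    perm_eq (bip_of_scomp C).1 (bip_of_scomp C').1 ->
    perm_eq (bip_of_scomp C).2 (bip_of_scomp C').2 ->
  perm_eq (val C) (val C').
Proof.
rewrite /bip_of_scomp /= !perm_sort ![perm_eq _ (sort _ _)]perm_sym !perm_sort.
by move=> pp nn; apply: perm_parts; rewrite ?scomp_neq0 // perm_sym.
Qed.

Lemma bip_snoc n (C : scomp n) :
  perm_eq (bip_of_scomp (snoc C)).1 (bip_of_scomp C).1 /\
  perm_eq (bip_of_scomp (snoc C)).2 (rcons (bip_of_scomp C).2 1%N).
Proof.
rewrite /bip_of_scomp val_snoc /= !filter_rcons /=; split=> //.
by rewrite map_rcons perm_sort -!cats1 perm_cat2r perm_sym perm_sort.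
Qed.

Lemma bip_exists n (l : bipart n) : exists C : scomp n, bip_of_scomp C = val l.
Proof.
case: l => -[p q] /= /and3P[/= /andP[sp p0] /andP[sq q0] /eqP pqn].
pose C := [seq k%:Z | k <- p] ++ [seq - k%:Z | k <- q].
have pq0 k : k \in p ++ q -> k != 0%N.
  by rewrite mem_cat; apply: contraTneq => ->; rewrite negb_or p0.
have Cs : is_scomp n C.
  apply/andP; split.
    rewrite /C all_cat !all_map; apply/andP; split; apply/allP => k kp /=.
      by have := pq0 k; rewrite mem_cat kp => /(_ isT); lia.
    by have := pq0 k; rewrite mem_cat kp orbT => /(_ isT); lia.
  rewrite /C big_cat !big_map -pqn !sumnE; apply/eqP; congr (_ + _)%N.
  by apply: eq_bigr => k _; rewrite abszN.
have sort_id (s : seq nat) : sorted geq s -> sort geq s = s.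
  by apply: sorted_sort => a b c ab bc; exact: leq_trans bc ab.
exists (Sub C Cs); rewrite /bip_of_scomp SubK /C !filter_cat !filter_map !map_cat -!map_comp.
have fp : [seq k <- p | preim Posz (fun x : int => 0 < x) k] = p.
  by apply/all_filterP/allP => k kp /=; have := pq0 k; rewrite mem_cat kp => /(_ isT); lia.
have fp' : [seq k <- p | preim Posz (fun x : int => x < 0) k] = [::].
  by apply/eqP; rewrite -[_ == _]negbK -has_filter; apply/hasPn.
have fq : [seq k <- q | preim (fun k : nat => - k%:Z) (fun x : int => x < 0) k] = q.
  by apply/all_filterP/allP => k kq /=; have := pq0 k; rewrite mem_cat kq orbT => /(_ isT); lia.
have fq' : [seq k <- q | preim (fun k : nat => - k%:Z) (fun x : int => 0 < x) k] = [::].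
  by apply/eqP; rewrite -[_ == _]negbK -has_filter; apply/hasPn => k _ /=; lia.
rewrite fp fp' fq fq' /= cats0; congr (_, _).
  by rewrite map_id_in ?sort_id.
by rewrite map_id_in ?sort_id // => k _ /=; rewrite abszN.
Qed.

Lemma cox_orbits n (l : bipart n) :
  exists2 C : scomp n, bip_of_scomp C = val l & orbits_of C (cox l).
Proof.
rewrite /cox; case: pickP => [w /asboolP[C Cl wC]|none] /=.
  by exists C => //; exact: coxeter_orbits.
have [C Cl] := bip_exists l; have [w wC] := coxeter_exists C.
by have /asboolP[] := none w; exists C.
Qed.

Lemma indC_cox_tau n (m : bipart n) (D : scomp n.+1) :
  indC D (cox (tau m)) = indC D (liftW (cox m)).
Proof.
have [C Cm mC] := cox_orbits m; have [C' C'm mC'] := cox_orbits (tau m).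
apply: indC_orbits mC' (orbits_snoc mC); apply: bip_perm.
  by rewrite C'm perm_sym (perm_trans (bip_snoc C).1) // Cm.
by rewrite C'm perm_sym (perm_trans (bip_snoc C).2) // Cm.
Qed.

End CoxeterOfBipartition.

(** * The simple modules and the theorem *)
Section SimpleCharacters.
Variable n : nat.
Implicit Types (l : bipart n) (C : scomp n).

Lemma pi_char_linear l c (f g : galg rat (W n)) :
  pi_char l (c *: f + g) = c * pi_char l f + pi_char l g.
Proof.
rewrite /pi_char mulr_sumr -big_split; apply: eq_bigr => i _ /=.
by rewrite linearP /= mulrDl -mulrA.
Qed.

Lemma pi_char_sum l (I : Type) (r : seq I) (P : pred I) (F : I -> galg rat (W n)) :
  pi_char l (\sum_(i <- r | P i) F i) = \sum_(i <- r | P i) pi_char l (F i).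
Proof.
apply: (big_morph (pi_char l)) => [f g|].
  by rewrite -[f in LHS]scale1r pi_char_linear mul1r.
by have := pi_char_linear l (-1) 0 0; rewrite scaler0 addr0 mulN1r addNr.
Qed.

Lemma pi_char_xC l C : pi_char l (xC C) = indC C (cox l).
Proof.
rewrite /pi_char (bigD1 (enum_rank C)) //= big1 ?addr0 => [|i iC].
  have := coord_free (enum_rank C) (enum_rank C) (xC_free n).
  by rewrite xC_tupleE enum_rankK eqxx => ->; rewrite mul1r.
have := coord_free (enum_rank C) i (xC_free n).
by rewrite xC_tupleE enum_rankK eq_sym (negPf iC) => ->; rewrite mul0r.
Qed.

Lemma DmodE l (f : galg rat (W n)) : Dmod l f = pi_char l f *: \1%VF.
Proof.
rewrite linear_lfunE // => c g h.
by rewrite pi_char_linear scalerDl scalerA.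
Qed.
End SimpleCharacters.

(** Both sides are linear, and on x_D this is the Mackey formula compared with
    the formula for res(x_D). *)
Lemma pi_char_tau n (m : bipart n) f : f \in MR n.+1 ->
  pi_char (tau m) f = pi_char m (res n f).
Proof.
move=> /coord_span ->; rewrite linear_sum !pi_char_sum; apply: eq_bigr => i _.
rewrite linearZ /= -[_ *: _]addr0 -[_ *: res n _]addr0 !pi_char_linear.
have pi0 k (l : bipart k) : pi_char l 0 = 0.
  by have := pi_char_sum l [::] xpredT (fun _ : nat => 0); rewrite !big_nil.
rewrite !pi0 xC_tupleE pi_char_xC res_xC pi_char_sum indC_cox_tau indC_liftW.
by congr (_ * _ + _); apply: eq_bigr => y _; rewrite pi_char_xC.
Qed.

(** One of the terms of the restriction of x_K to W_n is the identity, x_(n),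
    on which the character is 1; all others contribute at least 0. *)
Lemma pi_char_coset_sum_neq0 n (l : bipart n) : pi_char (tau l) (coset_sum n) != 0.
Proof.
rewrite coset_sum_xC pi_char_xC indC_cox_tau indC_liftW.
have Cn : neg_ones_from n (one_block n) by move=> t; case/andP=> nt tn; lia.
rewrite (bigD1 (orbit_rep (snoc (one_block n)) (top n false))) /=; last first.
  by rewrite inE (orbit_rep_eq (orbit_rep_lab _ _)).
rewrite orbit_rep_top (del_snoc_ge Cn) // indC_one_block gt_eqF //.
by rewrite ltr_wpDr // sumr_ge0 // => y _; exact: indC_ge0.
Qed.

Theorem theorem8p20 (n : nat) (hn : (0 < n)%N) (l m : bipart n)
    (P : vectType rat) (r : 'Hom(galg rat (W n), 'End(P)))
    (P' : vectType rat) (r' : 'Hom(galg rat (W n.+1), 'End(P')))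
    (hP : is_projective_cover (MR n) r (Dmod l))
    (hP' : is_projective_cover (MR n.+1) r' (Dmod (tau l))) :
  multiplicity (MR n.+1) r' (Dmod (tau m)) = multiplicity (MR n) r (Dmod m).
Proof.
have Dmod_res k : {in MR n.+1, forall a, Dmod (tau k) a = Dmod k (res n a)}.
  by move=> a aMR; rewrite !DmodE pi_char_tau.
have xK_MR : coset_sum n \in MR n.+1 by rewrite coset_sum_xC xC_MR.
have D_xK : Dmod (tau l) (coset_sum n) != 0.
  rewrite DmodE scaler_eq0 negb_or pi_char_coset_sum_neq0 /=.
  apply/eqP => /lfunP/(_ 1); rewrite id_lfunE zero_lfunE => /eqP.
  by rewrite oner_eq0.
have [h [k [hK kK hr]]] := cover_isom (MR1 n.+1) (@MR_mul n.+1) (res1 n)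
  (@res_mul n) (res_onto n) xK_MR (@res_ker n) (Dmod_res l) D_xK hP' hP.
apply: (multiplicity_transfer hK kK); split=> [a aMR|b].
  by exists (res n a); split; [exact: res_MR | move=> v; exact: hr | exact: Dmod_res].
rewrite -{1}res_onto => /memv_imgP[a aMR ->]; exists a.
by split=> //; [move=> v; exact: hr | exact: Dmod_res].
Qed.
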